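(* There is a randomized algorithm that, given an instance of Weighted Gerrymandering (W-GM) in which the input graph is a path, together with a tie-breaking rule $\eta$, decides the instance in time $1.708^n (n+m)^{\mathcal{O}(1)}$; and there is a deterministic algorithm that decides such instances in time $1.894^n (n+m)^{\mathcal{O}(1)}$, where $n=|V(G)|$ and $m=|\mathcal{C}|$.
   Context: Weighted Gerrymandering (W-GM): the input is a graph $G$ on $n$ vertices (voters), a set $\mathcal{C}$ of $m$ candidates, for each voter $v\in V(G)$ a weight function $w_v\colon\mathcal{C}\to\mathbb{Z}^+$, a distinguished candidate $p\in\mathcal{C}$, and a positive integer $k$. A district is a nonempty set $U\subseteq V(G)$ with $G[U]$ connected. A tie-breaking rule $\eta$ assigns to every district $U$ a single candidate $\eta(U)\in\arg\max_{q\in\mathcal{C}}\sum_{v\in U} w_v(q)$, called the winner of $U$. The question is whether $V(G)$ can be partitioned into $k$ pairwise disjoint districts such that $p$ wins strictly more of these districts than any other candidate. The randomized algorithm has one-sided error (as in the usual sense: no false positives, false negatives with probability at most $1/3$). *)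

(* Defs.v *)
From HB Require Import structures.
From mathcomp Require Import all_boot all_order all_algebra.
Set Implicit Arguments.
Unset Strict Implicit.
Unset Printing Implicit Defensive.

(** * Weighted Gerrymandering *)

Record wgm := WGM {
  nvoters : nat;
  ncands : nat;
  adj : rel 'I_nvoters;
  weight : 'I_nvoters -> 'I_ncands -> nat;
  preferred : 'I_ncands;
  ndistricts : nat;
  adj_sym : symmetric adj;
  adj_irr : irreflexive adj;
  weight_gt0 : forall v q, 0 < weight v q;
  ndistricts_gt0 : 0 < ndistricts
}.

(* The ordering s of the vertices along the path is not part of the input. *)
Definition is_path (n : nat) (e : rel 'I_n) : Prop :=
  0 < n /\
  exists s : 'I_n -> 'I_n, bijective s /\
    forall i j : 'I_n, e (s i) (s j) = (i.+1 == j :> nat) || (j.+1 == i :> nat).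

Definition induced (T : finType) (e : rel T) (U : {set T}) : rel T :=
  [rel u v | [&& u \in U, v \in U & e u v]].

Definition district (I : wgm) (U : {set 'I_(nvoters I)}) : bool :=
  (U != set0) && [forall u in U, forall v in U, connect (induced (@adj I) U) u v].

Definition chooser (I : wgm) : Type := {set 'I_(nvoters I)} -> 'I_(ncands I).

(* The values of eta on sets that are not districts are unconstrained. *)
Definition tie_breaking (I : wgm) (eta : chooser I) : Prop :=
  forall U : {set 'I_(nvoters I)}, district U ->
  forall q : 'I_(ncands I),
    \sum_(v in U) weight v q <= \sum_(v in U) weight v (eta U).

Definition wins (I : wgm) (eta : chooser I) (D : {set {set 'I_(nvoters I)}})
    (q : 'I_(ncands I)) : nat :=
  #|[set U in D | eta U == q]|.

Definition gerrymanderable (I : wgm) (eta : chooser I) : Prop :=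
  exists D : {set {set 'I_(nvoters I)}},
    [/\ partition D [set: 'I_(nvoters I)],
        #|D| = ndistricts I,
        forall U, U \in D -> district U
      & forall q, q != preferred I -> wins eta D q < wins eta D (preferred I)].

(** * Word RAM with coin flips and an oracle for the tie-breaking rule

  Every instruction takes one unit of time, and every value that is written is
  reduced modulo 2 ^ w, where w is the word length. The word length has to be
  bounded in terms of the instance, since otherwise unit-cost arithmetic on huge
  numbers would make the time bounds meaningless. *)

Inductive binop := Add | Sub | Mul | Div | Mod.

Inductive instr :=
| Const of nat & nat           (* Const r a : R[r] := a *)
| Op of binop & nat & nat & nat (* Op o r x y : R[r] := R[x] o R[y] *)
| Fetch of nat & nat           (* Fetch r x : R[r] := M[R[x]] *)
| Store of nat & nat           (* Store r x : M[R[r]] := R[x] *)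
| Jz of nat & nat              (* Jz r l : jump to line l if R[r] = 0 *)
| Flip of nat                  (* Flip r : R[r] := a fair random bit *)
| Winner of nat & nat.         (* Winner r x : R[r] := eta U,
                                  where U is the set with bit mask R[x] *)

Definition program := seq instr.

Definition uses_coins (i : instr) : bool := if i is Flip _ then true else false.

Definition deterministic (P : program) : bool := ~~ has uses_coins P.

(* Subtraction is truncated at 0, x Div 0 = 0 and x Mod 0 = x. *)
Definition eval_op (o : binop) (x y : nat) : nat :=
  match o with
  | Add => x + y
  | Sub => x - y
  | Mul => x * y
  | Div => x %/ y
  | Mod => x %% y
  end.

Record config := Config {
  pc : nat;
  reg : nat -> nat;
  mem : nat -> nat;
  coins : seq bool (* the coin flips still to come *)
}.

Definition upd (f : nat -> nat) (a x : nat) : nat -> nat :=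
  fun b => if b == a then x else f b.

Definition set_of_mask (n x : nat) : {set 'I_n} := [set v : 'I_n | odd (x %/ 2 ^ v)].

(* The machine halts when the program counter leaves the program. *)
Definition halted (P : program) (s : config) : bool := size P <= pc s.

Definition step (I : wgm) (eta : chooser I) (w : nat) (P : program)
    (s : config) : config :=
  let: Config l R M cs := s in
  let write r x := Config l.+1 (upd R r (x %% 2 ^ w)) M cs in
  if halted P s then s else
  match nth (Const 0 0) P l with
  | Const r a => write r a
  | Op o r x y => write r (eval_op o (R x) (R y))
  | Fetch r x => write r (M (R x))
  | Store r x => Config l.+1 R (upd M (R r) (R x)) cs
  | Jz r l' => Config (if R r == 0 then l' else l.+1) R M cs
  | Flip r => Config l.+1 (upd R r (head false cs %% 2 ^ w)) M (behead cs)
  | Winner r x => write r (eta (set_of_mask (nvoters I) (R x)))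
  end.

(* Memory initially holds n, m, k, p, the adjacency matrix and the weight
   matrix, both in row-major order, followed by zeros. *)
Definition input (I : wgm) : seq nat :=
  [:: nvoters I; ncands I; ndistricts I; preferred I : nat]
  ++ [seq (adj u v : nat) | u <- enum 'I_(nvoters I), v <- enum 'I_(nvoters I)]
  ++ [seq weight v q | v <- enum 'I_(nvoters I), q <- enum 'I_(ncands I)].

Definition initial (I : wgm) (r : seq bool) : config :=
  Config 0 (fun=> 0) (fun a => nth 0 (input I) a) r.

(* The number of bits of the largest of k and the weights. *)
Definition bitlength (I : wgm) : nat :=
  (trunc_log 2 (maxn (ndistricts I) (\max_v \max_q @weight I v q))).+1.

Definition wordlength (c : nat) (I : wgm) : nat :=
  c * (nvoters I + ncands I + bitlength I).

Definition run (I : wgm) (eta : chooser I) (w : nat) (P : program)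
    (t : nat) (r : seq bool) : config :=
  iter t (step eta w P) (initial I r).

Definition halts (I : wgm) (eta : chooser I) (w : nat) (P : program)
    (t : nat) (r : seq bool) : bool :=
  halted P (run eta w P t r).

Definition accepts (I : wgm) (eta : chooser I) (w : nat) (P : program)
    (t : nat) (r : seq bool) : bool :=
  halts eta w P t r && (reg (run eta w P t r) 0 != 0).

(* A run of t steps flips at most t coins, so t uniform independent bits suffice. *)
Definition accept_prob (I : wgm) (eta : chooser I) (w : nat) (P : program)
    (t : nat) : rat :=
  (#|[set r : t.-tuple bool | accepts eta w P t r]|%:R / 2%:R ^+ t)%R.

(* Main.v *)
(* The path is cut in front of its vertex 2b, where b = 19n/74 rounded down, and
   the two halves meet in the middle. A set of disjoint intervals on the left
   half, hence also a tiling, is a word of b octal digits; a tiling of the right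
   half in which intervals may be marked is a word of n - 2b ternary digits.
   There are 8^b + 3^(n - 2b) such words, which is O(1.708^n) because 8^19 and
   3^36 are at most 1.708^74.

   Fix the number t + 1 of districts that p is to win, the start a of the
   interval containing vertex 2b, and the numbers of all intervals and of
   intervals won by p to the left of a. For a vector x let A(x) be the number of
   left tilings that for each colour q with x q > 0 have exactly x q intervals
   won by q. It is computed in place, one colour after the other, on the vectors
   that occur for families of disjoint intervals; unlike those that occur for
   tilings, they are closed under setting entries to 0. A right tiling R with
   r q intervals of colour q is compatible with a left one having l q of them if
   l q <= t - r q for all q <> p. The indicator of l + r <= t is 1 minus the sum
   over 1 <= v <= r of the indicators of l = t + 1 - v, so the number of
   compatible pairs is the sum over the markings of R in which the v q marked
   intervals of colour q are the leftmost ones, of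
   (-1)^(number of marked colours) A(x), where x q = t + 1 - v q for the marked
   colours and x q = 0 for the others.

   The algorithm is deterministic, so it yields both time bounds. The table is
   addressed directly by the binary word that writes x in unary, which has at
   most n + m bits. *)

(* Ternary words on both halves would cost 3^(n/2), which exceeds 1.73^n. The gain comes from the
   left half: a continuation never follows an uncovered vertex, and excluding this pattern merely
   inside aligned pairs of vertices leaves 8 symbols for each pair instead of 9. Balancing 8^b
   against 3^(n - 2b) gives b/n = ln 3 / ln 72, about 0.2569, which 19/74 approximates; exact
   balance would give about 1.706^n, and the rest is slack for rounding.

   The obstacle is to count compatible pairs without listing them. Read as queries for upper bounds,
   the conditions l q <= t - r q address vectors that no family has, with value t at every colour
   absent from R. The identity for l + r <= t turns them into queries for exact values or for no
   condition at all, and these can be answered by a table over the vectors of families. *)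
From mathcomp Require Import all_boot all_order all_algebra zify ring.
Require Import Defs.
Import Order.TTheory GRing.Theory Num.Theory.
Set Implicit Arguments.
Unset Strict Implicit.
Unset Printing Implicit Defensive.

(** * A structured language for the word RAM *)

Inductive expr :=
| Num of nat
| Var of nat
| Bin of binop & expr & expr
| Get of expr
| Win of expr.

(** The Boolean of a loop is a static tag that says which of two bounds, polynomial or exponential,
    limits its length; the cost of a program can then be read off its nesting depths. *)
Inductive com :=
| Skip
| Asn of nat & expr
| Put of expr & expr
| Seq of com & com
| If of expr & com & com
| Loop of bool & nat & com.

(* Registers from [tmp] on hold the intermediate results of expressions. *)
Definition tmp := 50.

(** Stack discipline: the value arrives in register [d], and only registers from [d] on are changed.
    For want of a move instruction, a copy adds the source to a register just set to 0, which is
    sound as sources lie below [tmp]. *)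
Fixpoint ecomp (d : nat) (e : expr) : program :=
  match e with
  | Num a => [:: Const d a]
  | Var r => [:: Const d 0; Op Add d d r]
  | Bin o e1 e2 => ecomp d e1 ++ ecomp d.+1 e2 ++ [:: Op o d d d.+1]
  | Get e => ecomp d e ++ [:: Fetch d d]
  | Win e => ecomp d e ++ [:: Winner d d]
  end.

(** Jump targets are absolute, so lengths have to be known before the code is laid out. *)
Fixpoint clen (c : com) : nat :=
  match c with
  | Skip => 0
  | Asn _ e => size (ecomp tmp e) + 2
  | Put e1 e2 => size (ecomp tmp e1) + size (ecomp tmp.+1 e2) + 1
  | Seq c1 c2 => clen c1 + clen c2
  | If e c1 c2 => size (ecomp tmp e) + 1 + clen c1 + 2 + clen c2
  | Loop _ _ c => 3 + clen c + 2
  end.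

(** An unconditional jump is a conditional one on a register just set to 0. *)
Fixpoint compile (l : nat) (c : com) : program :=
  match c with
  | Skip => [::]
  | Asn r e => ecomp tmp e ++ [:: Const r 0; Op Add r r tmp]
  | Put e1 e2 => ecomp tmp e1 ++ ecomp tmp.+1 e2 ++ [:: Store tmp tmp.+1]
  | Seq c1 c2 => compile l c1 ++ compile (l + clen c1) c2
  | If e c1 c2 =>
      let l1 := l + size (ecomp tmp e) + 1 in
      let l2 := l1 + clen c1 + 2 in
      ecomp tmp e ++ [:: Jz tmp l2] ++ compile l1 c1
        ++ [:: Const tmp 0; Jz tmp (l2 + clen c2)] ++ compile l2 c2
  | Loop _ i c =>
      [:: Jz i (l + 3 + clen c + 2); Const tmp 1; Op Sub i i tmp]
        ++ compile (l + 3) c ++ [:: Const tmp 0; Jz tmp l]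
  end.

Lemma size_compile l c : size (compile l c) = clen c.
Proof.
elim: c l => //= [r e|e1 e2|c1 IH1 c2 IH2|e c1 IH1 c2 IH2|_ i c IH] l;
  do 4?[rewrite ?size_cat /=]; rewrite ?IH1 ?IH2 ?IH; lia.
Qed.

Fixpoint ewf (e : expr) : bool :=
  match e with
  | Num a => a < 128
  | Var r => r < tmp
  | Bin _ e1 e2 => ewf e1 && ewf e2
  | Get e | Win e => ewf e
  end.

Fixpoint writes (c : com) : seq nat :=
  match c with
  | Skip | Put _ _ => [::]
  | Asn r _ => [:: r]
  | Seq c1 c2 | If _ c1 c2 => writes c1 ++ writes c2
  | Loop _ i c => i :: writes c
  end.

Fixpoint storeless (c : com) : bool :=
  match c with
  | Skip | Asn _ _ => true
  | Put _ _ => false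
  | Seq c1 c2 | If _ c1 c2 => storeless c1 && storeless c2
  | Loop _ _ c => storeless c
  end.

Fixpoint cwf (c : com) : bool :=
  match c with
  | Skip => true
  | Asn r e => (r < tmp) && ewf e
  | Put e1 e2 => ewf e1 && ewf e2
  | Seq c1 c2 => cwf c1 && cwf c2
  | If e c1 c2 => [&& ewf e, cwf c1 & cwf c2]
  | Loop _ i c => [&& i < tmp, i \notin writes c & cwf c]
  end.

Record state := St { rg : nat -> nat; mm : nat -> nat }.

Definition setr (s : state) r x := St (upd (rg s) r x) (mm s).
Definition setm (s : state) a x := St (rg s) (upd (mm s) a x).

Arguments step : simpl never.

Section Semantics.

Variables (I : wgm) (eta : chooser I) (w : nat).

Fixpoint ev (s : state) (e : expr) : nat :=
  match e with
  | Num a => a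
  | Var r => rg s r
  | Bin o e1 e2 => eval_op o (ev s e1) (ev s e2)
  | Get e => mm s (ev s e)
  | Win e => eta (set_of_mask (nvoters I) (ev s e))
  end.

(** Only additions and multiplications can leave the range of a word: the other arithmetic
    operations return at most their first operand. *)
Fixpoint eok (s : state) (e : expr) : Prop :=
  match e with
  | Num _ | Var _ => True
  | Bin Add e1 e2 => [/\ eok s e1, eok s e2 & ev s e1 + ev s e2 < 2 ^ w]
  | Bin Mul e1 e2 => [/\ eok s e1, eok s e2 & ev s e1 * ev s e2 < 2 ^ w]
  | Bin _ e1 e2 => eok s e1 /\ eok s e2
  | Get e | Win e => eok s e
  end.

(* [bnd true] bounds the loops of exponential length, [bnd false] the others. *)
Variable bnd : bool -> nat.

Fixpoint wploop (W : (state -> Prop) -> state -> Prop) (i : nat)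
    (Q : state -> Prop) (k : nat) (s : state) : Prop :=
  if k is k'.+1 then W (wploop W i Q k') (setr s i k') else Q s.

(* Weakest precondition for termination without overflow within the loop
   bounds; a loop runs its body with its counter going down to 0. *)
Fixpoint wp (c : com) (Q : state -> Prop) (s : state) : Prop :=
  match c with
  | Skip => Q s
  | Asn r e => eok s e /\ Q (setr s r (ev s e))
  | Put e1 e2 => [/\ eok s e1, eok s e2 & Q (setm s (ev s e1) (ev s e2))]
  | Seq c1 c2 => wp c1 (wp c2 Q) s
  | If e c1 c2 => eok s e /\ if ev s e == 0 then wp c2 Q s else wp c1 Q s
  | Loop g i c => rg s i <= bnd g /\ wploop (wp c) i Q (rg s i) s
  end.

Lemma wp_conseq c s (Q Q' : state -> Prop) :
  (forall s', Q s' -> Q' s') -> wp c Q s -> wp c Q' s.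
Proof.
elim: c s Q Q' => [|r e|e1 e2|c1 IH1 c2 IH2|e c1 IH1 c2 IH2|g i c IH] s Q Q' QQ'.
- exact: QQ'.
- by case=> ? /QQ'.
- by case=> ? ? /QQ'.
- by rewrite /=; apply: IH1 => s'; apply: IH2.
- by case=> ok h; split=> //; case: eqP h => _; [apply: IH2|apply: IH1].
- case=> le wl; split=> //; move: (rg s i) wl {le} => k.
  elim: k s => [|k IHk] s /=; first exact: QQ'.
  by apply: IH => s'; apply: IHk.
Qed.

Definition keeps c (s s' : state) :=
  (forall r, r \notin writes c -> rg s' r = rg s r) /\
  (storeless c -> mm s' = mm s).

(** A frame rule: what a fragment leaves alone is read off its syntax once and for all, so that loop
    invariants mention only what changes. *)
Lemma wp_keeps c s (Q : state -> Prop) :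
  wp c Q s -> wp c (fun s' => keeps c s s' /\ Q s') s.
Proof.
elim: c s Q => [|r e|e1 e2|c1 IH1 c2 IH2|e c1 IH1 c2 IH2|g i c IH] s Q.
- by [].
- case=> ok q; split=> //; split=> //; split=> // r'.
  by rewrite inE /= /upd => /negbTE ->.
- by case=> ? ? q.
- rewrite /= => /IH1 wp1; apply: wp_conseq wp1 => s1 [[kr km]] /IH2 wp2.
  apply: wp_conseq wp2 => s2 [[kr2 km2] q]; split=> //; split.
    by move=> r; rewrite mem_cat negb_or => /andP[r1 r2]; rewrite kr2 ?kr.
  by move=> /andP[m1 m2]; rewrite km2 ?km.
- case=> ok h; split=> //; case: eqP h => _ h.
    apply: wp_conseq (IH2 _ _ h) => s2 [[kr2 km2] q]; split=> //; split.
      by move=> r; rewrite mem_cat negb_or => /andP[r1 r2]; rewrite kr2.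
    by move=> /andP[m1 m2]; rewrite km2.
  apply: wp_conseq (IH1 _ _ h) => s2 [[kr2 km2] q]; split=> //; split.
    by move=> r; rewrite mem_cat negb_or => /andP[r1 r2]; rewrite kr2.
  by move=> /andP[m1 m2]; rewrite km2.
- case=> le wl; split=> //.
  have : keeps (Loop g i c) s s by [].
  move: (rg s i) wl {le} => k; move: {1 3 5}s => s1.
  elim: k s1 => [|k IHk] s1 //=.
  move=> /IH wpc [kr km]; apply: wp_conseq wpc => s2 [[kr2 km2] wl].
  apply: IHk => //; split.
    move=> r hr; rewrite kr2 /= ?/upd; last by case/norP: hr.
    by rewrite -kr //; case/norP: hr => /negbTE ->.
  by move=> st; rewrite km2 ?km.
Qed.

Lemma wp_loop g i c s (Q : state -> Prop) (J : nat -> state -> Prop) :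
  rg s i <= bnd g -> J (rg s i) s ->
  (forall k s1, k < rg s i -> keeps (Loop g i c) s s1 -> J k.+1 s1 ->
    wp c (J k) (setr s1 i k)) ->
  (forall s1, keeps (Loop g i c) s s1 -> J 0 s1 -> Q s1) ->
  wp (Loop g i c) Q s.
Proof.
move=> le J0 JS JQ; split=> //.
have : keeps (Loop g i c) s s by [].
move: (leqnn (rg s i)) J0; move: {1 3 4}(rg s i) {le} => k; move: {2 4 5}s => s1.
elim: k s1 => [|k IHk] s1 kle Js K /=; first exact: JQ.
apply: wp_conseq (wp_keeps (JS _ _ kle K Js)) => s2 [[kr2 km2] J2].
apply: IHk => //; first exact: ltnW.
case: K => kr km; split=> [r hr|st]; last by rewrite km2 ?km.
rewrite kr2; last by case/norP: hr.
by rewrite /= /upd -kr //; case/norP: hr => /negbTE ->.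
Qed.

Lemma wp_asn r e s (Q : state -> Prop) :
  eok s e -> Q (setr s r (ev s e)) -> wp (Asn r e) Q s.
Proof. by []. Qed.

Lemma wp_put e1 e2 s (Q : state -> Prop) :
  eok s e1 -> eok s e2 -> Q (setm s (ev s e1) (ev s e2)) -> wp (Put e1 e2) Q s.
Proof. by []. Qed.

Lemma wp_seq c1 c2 s (Q : state -> Prop) : wp c1 (wp c2 Q) s -> wp (Seq c1 c2) Q s.
Proof. by []. Qed.

Lemma wp_if e c1 c2 s (Q : state -> Prop) :
  eok s e -> (0 < ev s e -> wp c1 Q s) -> (ev s e = 0 -> wp c2 Q s) ->
  wp (If e c1 c2) Q s.
Proof.
by move=> ok h1 h2; split=> //; case: eqP => [/h2|/eqP]; rewrite -?lt0n.
Qed.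

(** * Running time of structured programs *)

Fixpoint cost (c : com) : nat :=
  match c with
  | Seq c1 c2 => cost c1 + cost c2
  | If e c1 c2 => size (ecomp tmp e) + 3 + cost c1 + cost c2
  | Loop g _ c => bnd g * (cost c + 5) + 1
  | _ => clen c
  end.

Fixpoint csize (c : com) : nat :=
  match c with
  | Seq c1 c2 => csize c1 + csize c2
  | If e c1 c2 => size (ecomp tmp e) + 3 + csize c1 + csize c2
  | Loop _ _ c => csize c + 6
  | _ => clen c
  end.

Fixpoint depth (g : bool) (c : com) : nat :=
  match c with
  | Seq c1 c2 | If _ c1 c2 => maxn (depth g c1) (depth g c2)
  | Loop g' _ c => (g == g') + depth g c
  | _ => 0
  end.

(** Nesting multiplies and sequencing adds, so a program whose exponential loops are not nested in
    each other pays the exponential bound only once, times a polynomial. *)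
Lemma cost_le c : (forall g, 0 < bnd g) ->
  cost c <= csize c * bnd false ^ depth false c * bnd true ^ depth true c.
Proof.
move=> bgt0.
have one p q : 0 < bnd false ^ p * bnd true ^ q by rewrite muln_gt0 !expn_gt0 !bgt0.
have mono a p q p' q' x : p <= p' -> q <= q' -> x <= a * bnd false ^ p * bnd true ^ q ->
    x <= a * (bnd false ^ p' * bnd true ^ q').
  by move=> hp hq /leq_trans; apply; rewrite -mulnA leq_mul // leq_mul // leq_pexp2l.
elim: c => [|r e|e1 e2|c1 IH1 c2 IH2|e c1 IH1 c2 IH2|g i c IH] /=; rewrite ?muln1 //.
- rewrite -mulnA mulnDl; apply: leq_add.
    by apply: mono IH1; rewrite leq_maxl.
  by apply: mono IH2; rewrite leq_maxr.
- rewrite -mulnA !(mulnDl (_ + csize c1)) (mulnDl _ (csize c1)).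
  apply: leq_add; first apply: leq_add.
  + by rewrite leq_pmulr.
  + by apply: mono IH1; rewrite leq_maxl.
  + by apply: mono IH2; rewrite leq_maxr.
- set p := depth false c; set q := depth true c.
  have -> : (csize c + 6) * bnd false ^ ((false == g) + p) * bnd true ^ ((true == g) + q) =
     bnd g * ((csize c + 6) * (bnd false ^ p * bnd true ^ q)).
    by case: g; rewrite /= !(add0n, add1n) ?expnS -!mulnA; [rewrite !(mulnCA (bnd true))|rewrite !(mulnCA (bnd false))].
  move: IH; rewrite -/p -/q -mulnA.
  move: (one p q) (bgt0 g); set z := _ * bnd true ^ q; nia.
Qed.

(** * The machine simulates the structured semantics *)

Definition bounded (f : nat -> nat) := forall x, f x < 2 ^ w.

Hypothesis w_ge7 : 128 <= 2 ^ w.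
Hypothesis cands_lt : ncands I <= 2 ^ w.

Lemma ev_lt s e : ewf e -> bounded (rg s) -> bounded (mm s) -> eok s e ->
  ev s e < 2 ^ w.
Proof.
move=> + bR bM; elim: e => //= [a|o e1 IH1 e2 IH2|e IH] /=.
- by move=> h _; apply: leq_trans h w_ge7.
- move=> /andP[w1 w2]; case: o => /=; try by case.
  + by case=> k1 _; apply: leq_ltn_trans (leq_subr _ _) (IH1 w1 k1).
  + by case=> k1 _; apply: leq_ltn_trans (leq_div _ _) (IH1 w1 k1).
  + by case=> k1 _; apply: leq_ltn_trans (leq_mod _ _) (IH1 w1 k1).
- by move=> _ _; apply: leq_trans (ltn_ord _) cands_lt.
Qed.

Lemma run_instr (P : program) pre ins post R M cs :
  P = pre ++ ins :: post ->
  step eta w P (Config (size pre) R M cs) =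
  let write r x := Config (size pre).+1 (upd R r (x %% 2 ^ w)) M cs in
  match ins with
  | Const r a => write r a
  | Op o r x y => write r (eval_op o (R x) (R y))
  | Fetch r x => write r (M (R x))
  | Store r x => Config (size pre).+1 R (upd M (R r) (R x)) cs
  | Jz r l' => Config (if R r == 0 then l' else (size pre).+1) R M cs
  | Flip r => Config (size pre).+1 (upd R r (head false cs %% 2 ^ w)) M (behead cs)
  | Winner r x => write r (eta (set_of_mask (nvoters I) (R x)))
  end.
Proof.
move=> ->; rewrite /step /halted /= size_cat /= ifF; last by lia.
by rewrite nth_cat ltnn subnn.
Qed.

Definition agree (R R' : nat -> nat) := forall r, r < tmp -> R' r = R r.

Lemma upd_bounded f r x : bounded f -> x < 2 ^ w -> bounded (upd f r x).
Proof. by move=> bf xlt y; rewrite /upd; case: eqP. Qed.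

Lemma updm_bounded f r x : bounded f -> bounded (upd f r (x %% 2 ^ w)).
Proof. by move=> bf; apply: upd_bounded; rewrite // ltn_mod expn_gt0. Qed.

Lemma ecomp_correct s (P : program) e d pre post R cs :
  P = pre ++ ecomp d e ++ post -> tmp <= d -> ewf e -> eok s e ->
  agree (rg s) R -> bounded R -> bounded (rg s) -> bounded (mm s) ->
  exists R', [/\ iter (size (ecomp d e)) (step eta w P)
                   (Config (size pre) R (mm s) cs) =
                 Config (size pre + size (ecomp d e)) R' (mm s) cs,
                 R' d = ev s e, bounded R' &
                 forall r, r < d -> R' r = R r].
Proof.
move=> + + + + + + bS bM.
elim: e d pre post R => [a|r|o e1 IH1 e2 IH2|e IH|e IH] d pre post R eP dt we oke ag bR.
- exists (upd R d (a %% 2 ^ w)); split.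
  + by rewrite /= (run_instr _ _ _ eP) /= addn1.
  + by rewrite /upd eqxx modn_small // (leq_trans _ w_ge7).
  + exact: updm_bounded.
  + by move=> r hr; rewrite /upd ltn_eqF.
- exists (upd (upd R d (0 %% 2 ^ w)) d (rg s r %% 2 ^ w)).
  have rd : (r == d) = false by apply/eqP => e; move: we dt => /=; rewrite e; lia.
  split.
  + rewrite /= (run_instr _ _ _ eP) /= -addn1 -[1]/(size [:: Const d 0]) -size_cat.
    rewrite (@run_instr _ _ (Op Add d d r) post) -?catA //=.
    rewrite size_cat addn1 addn2; congr (Config _ (upd _ _ (_ %% _)) _ _).
    by rewrite /upd eqxx rd ag // mod0n.
  + by rewrite /upd eqxx modn_small.
  + exact/updm_bounded/updm_bounded.
  + by move=> r' hr; rewrite /upd ltn_eqF.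
- have [w1 w2] := andP we.
  have [k1 k2] : eok s e1 /\ eok s e2 by case: (o) oke => /= -[].
  rewrite /= -!catA in eP.
  have [R1 [run1 v1 b1 f1]] := IH1 d pre _ R eP dt w1 k1 ag bR.
  have ag1 : agree (rg s) R1.
    by move=> r hr; rewrite f1 ?ag // (leq_trans hr dt).
  have eP2 : P = (pre ++ ecomp d e1) ++ ecomp d.+1 e2 ++ Op o d d d.+1 :: post.
    by rewrite eP -!catA.
  have [R2 [run2 v2 b2 f2]] := IH2 d.+1 _ _ R1 eP2 (leqW dt) w2 k2 ag1 b1.
  exists (upd R2 d (ev s (Bin o e1 e2) %% 2 ^ w)); split.
  + rewrite /= !size_cat /= addn1 addnS iterS [size _ + size _]addnC iterD run1 -size_cat run2.
    rewrite -size_cat (@run_instr _ _ (Op o d d d.+1) post); last by rewrite eP2 -!catA.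
    by rewrite /= v2 f2 // v1 !size_cat; congr Config; lia.
  + by rewrite /upd eqxx modn_small //; exact: ev_lt.
  + exact: updm_bounded.
  + by move=> r hr; rewrite /upd ltn_eqF // f2 ?f1 // ltnW.
- rewrite /= -!catA in eP.
  have [R1 [run1 v1 b1 f1]] := IH d pre _ R eP dt we oke ag bR.
  exists (upd R1 d (mm s (ev s e) %% 2 ^ w)); split.
  + rewrite /= !size_cat /= addn1 iterS run1 -size_cat.
    rewrite (@run_instr _ _ (Fetch d d) post); last by rewrite eP -!catA.
    by rewrite /= v1 !size_cat !addnS.
  + by rewrite /upd eqxx modn_small.
  + exact: updm_bounded.
  + by move=> r hr; rewrite /upd ltn_eqF // f1.
- rewrite /= -!catA in eP.
  have [R1 [run1 v1 b1 f1]] := IH d pre _ R eP dt we oke ag bR.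
  exists (upd R1 d (eta (set_of_mask (nvoters I) (ev s e)) %% 2 ^ w)); split.
  + rewrite /= !size_cat /= addn1 iterS run1 -size_cat.
    rewrite (@run_instr _ _ (Winner d d) post); last by rewrite eP -!catA.
    by rewrite /= v1 !size_cat !addnS.
  + by rewrite /upd eqxx modn_small // (leq_trans (ltn_ord _) cands_lt).
  + exact: updm_bounded.
  + by move=> r hr; rewrite /upd ltn_eqF // f1.
Qed.

(** As [wp] excludes overflow, reduction modulo 2 ^ w changes none of the values written, and the
    machine follows the structured semantics. The stream [cs] of coins is never consumed. *)
Lemma compile_correct c s (Q : state -> Prop) (P : program) pre post R cs :
  P = pre ++ compile (size pre) c ++ post -> cwf c -> wp c Q s ->
  agree (rg s) R -> bounded R -> bounded (rg s) -> bounded (mm s) ->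
  exists t R' s', [/\ t <= cost c /\ Q s',
    iter t (step eta w P) (Config (size pre) R (mm s) cs) =
      Config (size pre + clen c) R' (mm s') cs,
    agree (rg s') R',
    [/\ bounded R', bounded (rg s') & bounded (mm s')] &
    forall r, r \notin writes c -> rg s' r = rg s r].
Proof.
elim: c s Q pre post R => [|r e|e1 e2|c1 IH1 c2 IH2|e c1 IH1 c2 IH2|g i c IH]
  s Q pre post R eP wf wpc ag bR bS bM.
- by exists 0, R, s; rewrite addn0.
- have [rt we] := andP wf; case: wpc => oke Qs.
  rewrite /= -!catA in eP.
  have [R1 [run1 v1 b1 f1]] := ecomp_correct cs eP (leqnn _) we oke ag bR bS bM.
  have vlt := ev_lt we bS bM oke.
  exists (size (ecomp tmp e) + 2), (upd (upd R1 r (0 %% 2 ^ w)) r (ev s e %% 2 ^ w)).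
  exists (setr s r (ev s e)); split=> //.
  + rewrite addnC iterD run1 -size_cat /=.
    rewrite (@run_instr _ _ (Const r 0) (Op Add r r tmp :: post)); last by rewrite eP -!catA.
    rewrite /= -(size_rcons _ (Const r 0)) (@run_instr _ _ (Op Add r r tmp) post).
      rewrite /= size_rcons !size_cat addnA addn2; congr (Config _ (upd _ _ (_ %% _)) _ _).
      by rewrite /upd eqxx gtn_eqF // mod0n v1.
    by rewrite eP -cats1 -!catA.
  + move=> r' hr'; rewrite /= /upd; case: eqP => // _; first by rewrite modn_small.
    by rewrite f1 // ag.
  + by split=> //=; [do 2!apply: updm_bounded|apply: upd_bounded].
  + by move=> r'; rewrite /= inE /upd => /negbTE ->.
- have [w1 w2] := andP wf; case: wpc => k1 k2 Qs.
  rewrite /= -!catA in eP.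
  have [R1 [run1 v1 b1 f1]] := ecomp_correct cs eP (leqnn _) w1 k1 ag bR bS bM.
  have eP2 : P = (pre ++ ecomp tmp e1) ++ ecomp tmp.+1 e2 ++ Store tmp tmp.+1 :: post.
    by rewrite eP -!catA.
  have ag1 : agree (rg s) R1 by move=> r hr; rewrite f1 ?ag.
  have [R2 [run2 v2 b2 f2]] := ecomp_correct cs eP2 (leqnSn _) w2 k2 ag1 b1 bS bM.
  exists (size (ecomp tmp e1) + size (ecomp tmp.+1 e2) + 1), R2.
  exists (setm s (ev s e1) (ev s e2)); split=> //.
  + rewrite /= addn1 iterS addnC iterD run1 -size_cat run2 -size_cat.
    rewrite (@run_instr _ _ (Store tmp tmp.+1) post); last by rewrite eP2 -!catA.
    rewrite /= v2 f2 // v1 !size_cat; congr Config; lia.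
  + by move=> r hr; rewrite f2 ?ag1 // (ltn_trans hr).
  + by split=> //=; apply: upd_bounded => //; apply: ev_lt.
- have [w1 w2] := andP wf; rewrite /= -!catA in eP.
  have [t1 [R1 [s1 [[T1 Q1] run1 ag1 [b1 bS1 bM1] f1]]]] :=
    IH1 _ _ _ _ _ eP w1 wpc ag bR bS bM.
  have eP2 : P = (pre ++ compile (size pre) c1) ++
      compile (size (pre ++ compile (size pre) c1)) c2 ++ post.
    by rewrite eP -!catA size_cat size_compile.
  have [t2 [R2 [s2 [[T2 Q2] run2 ag2 b2 f2]]]] :=
    IH2 _ _ _ _ _ eP2 w2 Q1 ag1 b1 bS1 bM1.
  exists (t1 + t2), R2, s2; split=> //=.
  + by split=> //; lia.
  + rewrite addnC iterD run1; move: run2; rewrite size_cat size_compile => ->.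
    by rewrite addnA.
  + by move=> r; rewrite mem_cat negb_or => /andP[r1 r2]; rewrite f2 ?f1.
- have /and3P[we w1 w2] := wf; rewrite /= -!catA /= -!catA /= in eP.
  have [oke Qs] := wpc.
  have [R1 [run1 v1 b1 f1]] := ecomp_correct cs eP (leqnn _) we oke ag bR bS bM.
  have ag1 : agree (rg s) R1 by move=> r hr; rewrite f1 ?ag.
  set E := ecomp tmp e in eP run1.
  set l1 := size pre + size E + 1 in eP; set l2 := l1 + clen c1 + 2 in eP.
  have runJ : iter (size E + 1) (step eta w P) (Config (size pre) R (mm s) cs) =
      Config (if ev s e == 0 then l2 else l1) R1 (mm s) cs.
    rewrite addn1 iterS run1 -size_cat (run_instr (ins := Jz tmp l2)
      (post := compile l1 c1 ++ [:: Const tmp 0, Jz tmp (l2 + clen c2) & compile l2 c2 ++ post])).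
      by rewrite /= v1 size_cat /l1 addn1.
    by rewrite eP -!catA.
  case: eqP Qs runJ => _ Qs runJ.
  + set pre2 := pre ++ E ++ Jz tmp l2 :: compile l1 c1 ++ [:: Const tmp 0; Jz tmp (l2 + clen c2)].
    have sz2 : size pre2 = l2.
      by rewrite /pre2 !size_cat /= size_cat size_compile /l2 /l1 /=; lia.
    have eP2 : P = pre2 ++ compile (size pre2) c2 ++ post.
      by rewrite sz2 eP /pre2 -!catA /= -!catA.
    have [t2 [R2 [s2 [[T2 Q2] run2 ag2 b2 f2]]]] :=
      IH2 _ _ _ _ _ eP2 w2 Qs ag1 b1 bS bM.
    exists (t2 + (size E + 1)), R2, s2; split=> //=.
    * by split=> //; rewrite -/E; lia.
    * rewrite iterD runJ -sz2 run2 sz2 -/E; congr Config.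
      by rewrite /l2 /l1; lia.
    * by move=> r; rewrite mem_cat negb_or => /andP[_ r2]; rewrite f2.
  + set pre1 := pre ++ E ++ [:: Jz tmp l2].
    have sz1 : size pre1 = l1 by rewrite /pre1 !size_cat /= /l1; lia.
    have eP1 : P = pre1 ++ compile (size pre1) c1 ++
        [:: Const tmp 0, Jz tmp (l2 + clen c2) & compile l2 c2 ++ post].
      by rewrite sz1 eP /pre1 -!catA.
    have [t2 [R2 [s2 [[T2 Q2] run2 ag2 [b2 bS2 bM2] f2]]]] :=
      IH1 _ _ _ _ _ eP1 w1 Qs ag1 b1 bS bM.
    have sz1' : size (pre1 ++ compile l1 c1) = l1 + clen c1.
      by rewrite size_cat sz1 size_compile.
    exists (2 + (t2 + (size E + 1))), (upd R2 tmp (0 %% 2 ^ w)), s2; split=> //=.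
    * by split=> //; rewrite -/E; lia.
    * rewrite iterD iterD runJ -sz1 run2 sz1 -sz1'.
      rewrite (run_instr (ins := Const tmp 0)
        (post := Jz tmp (l2 + clen c2) :: compile l2 c2 ++ post)); last first.
        by rewrite eP1 sz1 -!catA.
      rewrite /= -(size_rcons _ (Const tmp 0)) (run_instr (ins := Jz tmp (l2 + clen c2))
        (post := compile l2 c2 ++ post)).
        rewrite /= /upd eqxx mod0n /=; congr Config.
        by rewrite -/E /l2 /l1; lia.
      by rewrite eP1 sz1 -cats1 -!catA.
    * by move=> r hr; rewrite /upd ltn_eqF // ag2.
    * by split=> //; apply: updm_bounded.
    * by move=> r; rewrite mem_cat negb_or => /andP[r1 _]; rewrite f2.
- have /and3P[it iw wfc] := wf.
  case: wpc; move ek: (rg s i) => k kB wpk.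
  set l := size pre; set l2 := l + 3 + clen c + 2.
  set pre3 := pre ++ [:: Jz i l2; Const tmp 1; Op Sub i i tmp].
  have sz3 : size pre3 = l + 3 by rewrite size_cat.
  have sz3' : size (pre3 ++ compile (l + 3) c) = l + 3 + clen c.
    by rewrite size_cat sz3 size_compile.
  rewrite /= -!catA in eP.
  (* The bound [bnd g] is replaced by the actual number k of rounds, on which the induction runs. *)
  suff [t [R' [s' [[T Q'] run' ag' b' f']]]] : exists t R' s',
    [/\ t <= k * (cost c + 5) + 1 /\ Q s',
      iter t (step eta w P) (Config l R (mm s) cs) = Config l2 R' (mm s') cs,
      agree (rg s') R',
      [/\ bounded R', bounded (rg s') & bounded (mm s')] &
      forall r, r \notin i :: writes c -> rg s' r = rg s r].
    exists t, R', s'; split=> //.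
    + by split=> //=; apply: leq_trans T _; rewrite leq_add2r leq_mul2r kB orbT.
    + by rewrite run' /= -/l; congr Config; rewrite /l2; lia.
  elim: k {kB} s R ek ag bR bS bM wpk => [|k IHk] s R ek ag bR bS bM wpk.
    exists 1, R, s; split=> //=; rewrite /l (run_instr _ _ _ eP) /=.
    by rewrite ag // ek.
  have s1b : k < 2 ^ w by rewrite -ek ltnW // -ek.
  have run3 : iter 3 (step eta w P) (Config l R (mm s) cs) =
      Config (l + 3) (upd (upd R tmp (1 %% 2 ^ w)) i (k %% 2 ^ w)) (mm s) cs.
    rewrite /= /l (run_instr _ _ _ eP) /= ag // ek /=.
    rewrite -(size_rcons _ (Jz i l2)) (run_instr (ins := Const tmp 1)
       (post := Op Sub i i tmp :: compile (l + 3) c ++ [:: Const tmp 0, Jz tmp l & post])) /=;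
      last by rewrite eP -cats1 -!catA.
    rewrite -(size_rcons _ (Const tmp 1)) (run_instr (ins := Op Sub i i tmp)
       (post := compile (l + 3) c ++ [:: Const tmp 0, Jz tmp l & post]));
      last by rewrite eP -!cats1 -!catA.
    rewrite /= !size_rcons addn3; congr (Config _ (upd _ _ (_ %% _)) _ _).
    rewrite /upd eqxx ltn_eqF // ag // ek modn_small ?subn1 //.
    exact: leq_trans w_ge7.
  have eP3 : P = pre3 ++ compile (size pre3) c ++ [:: Const tmp 0, Jz tmp l & post].
    by rewrite sz3 eP /pre3 -!catA.
  case: (IH (setr s i k) _ _ _ (upd (upd R tmp (1 %% 2 ^ w)) i (k %% 2 ^ w)) eP3 wfc wpk).
  + move=> r hr; rewrite /= /upd; case: eqP => _; first by rewrite modn_small.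
    by rewrite ltn_eqF // ag.
  + by do 2!apply: updm_bounded.
  + exact: upd_bounded.
  + exact: bM.
  move=> t1 [R1 [s1 [[T1 Q1] run1 ag1 [b1 bS1 bM1] f1]]].
  have [|||t2 [R2 [s2 [[T2 Q2] run2 ag2 b2 f2]]]] :=
    IHk s1 (upd R1 tmp (0 %% 2 ^ w)) _ _ _ bS1 bM1 Q1.
  + by rewrite f1 //= /upd eqxx.
  + by move=> r hr; rewrite /upd ltn_eqF // ag1.
  + exact: updm_bounded.
  + exists (t2 + (2 + (t1 + 3))), R2, s2; split=> //.
    * by split=> //; lia.
    * rewrite iterD -run2; congr iter.
      rewrite iterD iterD run3 -sz3 run1 sz3 -sz3'.
      rewrite /= (run_instr (ins := Const tmp 0) (post := Jz tmp l :: post)); last first.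
        by rewrite eP3 sz3 -!catA.
      rewrite /= -(size_rcons _ (Const tmp 0)) (run_instr (ins := Jz tmp l) (post := post)).
        by rewrite /= /upd eqxx mod0n.
      by rewrite eP3 sz3 -cats1 -!catA.
    * move=> r; rewrite inE negb_or => /andP[ri rc].
      by rewrite f2 ?inE ?negb_or ?ri // f1 //= /upd (negbTE ri).
Qed.

End Semantics.

(** * Encoding vectors of multiplicities *)

(* The word consists of the blocks 1 0^(x q). *)
Fixpoint keyf (x : nat -> nat) (i acc : nat) : nat :=
  if i is q.+1 then keyf x q ((2 * acc + 1) * 2 ^ x q) else acc.

(** The number of trailing zeros gives x and the odd part gives a, so the last block of a word can
    be split off. *)
Lemma oddpart_inj a a' x x' :
  (2 * a + 1) * 2 ^ x = (2 * a' + 1) * 2 ^ x' -> a = a' /\ x = x'.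
Proof.
wlog le : a a' x x' / x <= x'.
  move=> h; case/orP: (leq_total x x') => le e; first exact: h.
  by have [-> ->] := h _ _ _ _ le (esym e).
rewrite -(subnKC le) expnD mulnCA mulnC => /eqP.
rewrite eqn_pmul2l ?expn_gt0 //; case: (x' - x) => [|d] /eqP.
  by rewrite muln1; lia.
by rewrite expnS; lia.
Qed.

Lemma keyf_inj x y i acc acc' : keyf x i acc = keyf y i acc' ->
  acc = acc' /\ forall q, q < i -> x q = y q.
Proof.
elim: i acc acc' => [|i IH] acc acc' //= /IH[/oddpart_inj[-> xy] h].
by split=> // q; rewrite ltnS leq_eqVlt => /orP[/eqP->|/h].
Qed.

Lemma eq_keyf x y i acc : (forall q, q < i -> x q = y q) -> keyf x i acc = keyf y i acc.
Proof.
elim: i acc => //= i IH acc h; rewrite h // IH // => q qi.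
by rewrite h // ltnW.
Qed.

(** Block q has 1 + x q bits; with at most n intervals and m colours a key has at most n + m bits
    and can serve as an address. *)
Lemma keyf_lt x i acc : keyf x i acc < (acc + 1) * 2 ^ (i + \sum_(q < i) x q).
Proof.
elim: i acc => [|i IH] acc /=; first by rewrite big_ord0 addn1 muln1.
apply: leq_trans (IH _) _; rewrite big_ord_recr /=; set S := \sum_(_ < _) _.
have -> : i.+1 + (S + x i) = (x i).+1 + (i + S) by lia.
rewrite [2 ^ (_.+1 + _)]expnD [X in _ <= X]mulnA leq_mul2r; apply/orP; right; rewrite expnS.
have : 0 < 2 ^ x i by rewrite expn_gt0.
move: (2 ^ x i) => B; nia.
Qed.

(** * Tilings and families of disjoint intervals *)

(* The interval [v, e) is the pair (v, e); lists of intervals go from right to left. *)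
Definition tile := (nat * nat)%type.

Fixpoint tiling (hi lo : nat) (ts : seq tile) : bool :=
  if ts is (v, e) :: ts' then [&& e == hi, v < e & tiling v lo ts'] else hi == lo.

Fixpoint family (hi : nat) (ts : seq tile) : bool :=
  if ts is (v, e) :: ts' then [&& v < e, e <= hi & family v ts'] else true.

Lemma familyW hi hi' ts : hi <= hi' -> family hi ts -> family hi' ts.
Proof. by case: ts => [|[v e] ts] //= h /and3P[-> /leq_trans-> // ->]. Qed.

Lemma family_filter P hi ts : family hi ts -> family hi (filter P ts).
Proof.
elim: ts hi => [|[v e] ts IH] hi //= /and3P[ve eh /IH f].
case: (P _) => /=; first by rewrite ve eh.
by apply: familyW f; apply: leq_trans eh; apply: ltnW.
Qed.

Lemma size_family hi ts : family hi ts -> size ts <= hi.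
Proof.
elim: ts hi => [|[v e] ts IH] hi //= /and3P[ve eh /IH]; lia.
Qed.

Lemma tiling_family hi lo ts : tiling hi lo ts -> family hi ts.
Proof.
by elim: ts hi => [|[v e] ts IH] hi //= /and3P[/eqP-> -> /IH ->]; rewrite leqnn.
Qed.

Lemma tiling_cat hi lo ts1 ts2 mid : tiling hi mid ts1 -> tiling mid lo ts2 ->
  tiling hi lo (ts1 ++ ts2).
Proof.
elim: ts1 hi => [|[v e] ts1 IH] hi /=; first by move/eqP=> ->.
by case/and3P=> -> -> /IH h /h.
Qed.

(* A code of an interval family on [0, 2b) is a word over the symbols
   0 = start of an interval, 1 = uncovered, 2 = continuation, read from right
   to left. As a continuation never follows an uncovered vertex, two adjacent
   vertices 2i, 2i + 1 take only 8 of the 9 pairs of symbols; the symbol of the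
   even vertex is negated modulo 3 so that the excluded pair is the octal
   digit 8. *)
Definition lsym (v d : nat) : nat := if odd v then d %% 3 else (3 - d %/ 3) %% 3.

(** Here [e] is the right end of the run being read. An uncovered vertex resets it, so continuations
    that reach no start are discarded, and every word, even a malformed one, decodes to a family. *)
Fixpoint ltiles (i y d e : nat) : seq tile :=
  if i is v.+1 then
    let y' := if odd v then y %/ 8 else y in
    let d' := if odd v then y %% 8 else d in
    if lsym v d' == 0 then (v, e) :: ltiles v y' d' v
    else ltiles v y' d' (if lsym v d' == 1 then v else e)
  else [::].

Lemma ltiles_family i y d e : i <= e -> family e (ltiles i y d e).
Proof.
elim: i y d e => //= v IH y d e ve.
set d' := if odd v then y %% 8 else d.
case: (lsym v d' == 0) => /=; first by rewrite ve leqnn IH.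
case: (lsym v d' == 1); last by rewrite IH // ltnW.
by apply: (@familyW v); rewrite ?IH // ltnW.
Qed.

(** What a scan that has read the vertices from [V] on can face while [ts] is still to be emitted:
    it is inside the first interval of [ts], with [e] its end, or between intervals, with
    [e = V]. *)
Definition pending (V e : nat) (ts : seq tile) : bool :=
  if ts is (v, e') :: ts' then
    [&& family v ts', v < e' & ((e' == e) && (v < V <= e)) || ((e == V) && (e' <= V))]
  else e == V.

(** After a continuation the pending end exceeds the vertex just read, whereas an uncovered vertex
    needs the pending end right behind it. Hence 1 is never read directly after 2, which excludes
    the octal digit 8. *)
Lemma pending_step v e ts : pending v.+1 e ts ->
  exists s e' ts', [/\ s <= 2, pending v e' ts', s == 1 -> e = v.+1, s == 2 -> v < e' &
    ts = if s == 0 then (v, e) :: ts' else ts'] /\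
    e' = (if s == 2 then e else v).
Proof.
case: ts => [|[v' e'] ts] /=; first by move/eqP->; exists 1, v, [::]; rewrite /= eqxx.
case/and3P=> f ve h.
have [e0|ev] := eqVneq v' v.
  rewrite {v'}e0 in f ve h *.
  exists 0, v, ts; split=> //; split=> //.
    case: ts f => [|[v2 e2] ts2] /=; first by rewrite eqxx.
    by case/and3P=> h1 h2 ->; rewrite h1 h2 eqxx orbT.
  by congr (_ :: _); congr pair; move: h ve; lia.
case/orP: h => [/andP[/eqP ee /andP[h1 h2]]|/andP[/eqP ee le]].
  exists 2, e, ((v', e') :: ts); split=> //; split=> //=.
  by rewrite f ve ee eqxx /=; lia.
have [ee'|ne] := eqVneq e' v.+1.
  exists 2, e, ((v', e') :: ts); split=> //; split=> //=; last by rewrite ee.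
  by rewrite f ve ee ee' eqxx /=; lia.
exists 1, v, ((v', e') :: ts); split=> //; split=> //=.
by rewrite f ve eqxx /=; lia.
Qed.

Lemma ltiles_complete b e ts d : pending (2 * b) e ts ->
  exists2 z, z < 8 ^ b & ltiles (2 * b) z d e = ts.
Proof.
elim: b e ts d => [|b IH] e ts d.
  rewrite muln0 => h; exists 0 => //=.
  by case: ts h => [|[v e'] ts] //= /and3P[_ h1]; lia.
have -> : 2 * b.+1 = (2 * b).+2 by lia.
case/pending_step=> s [e1 [ts1 [[s2 p1 u1 c1 ->] ee1]]].
case: (pending_step p1) => s' [e2 [ts2 [[s2' p2 u2 c2 ->] ee2]]].
(* The digit that [lsym] decodes into [s] at the odd and [s'] at the even vertex; negation modulo 3
   is its own inverse. *)
pose d' := s + 3 * ((3 - s') %% 3).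
have [z zlt ez] := IH e2 ts2 d' p2.
have d'lt : d' < 8.
  rewrite /d'; case: (s) s2 c1 => [|[|[|]]] // _ c1;
  case: (s') s2' u2 => [|[|[|]]] // _ u2; by move: (c1 isT) (u2 isT); lia.
have l1 : lsym (2 * b).+1 d' = s.
  by rewrite /lsym oddS mul2n odd_double /= /d'; move: s2 s2'; lia.
have l2 : lsym (2 * b) d' = s'.
  by rewrite /lsym mul2n odd_double /= /d'; move: s2 s2'; lia.
exists (d' + 8 * z); first by rewrite expnS; lia.
have dE : (d' + 8 * z) %% 8 = d' by lia.
have zE : (d' + 8 * z) %/ 8 = z by lia.
have oE : odd (2 * b) = false by rewrite mul2n odd_double.
rewrite [ltiles _ _ _ _]/= oE /= dE zE l1 l2; move: ez; rewrite ee2 ee1.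
by case: (s) s2 => [|[|[|]]] // _; case: (s') s2' => [|[|[|]]] //= _ ->.
Qed.

(** * The table of the left half *)

Section Colours.

Variables (col : nat -> nat -> nat) (m : nat).

Definition cnt (q : nat) (ts : seq tile) : nat := count (fun t => col t.1 t.2 == q) ts.

Hypothesis col_lt : forall v e, col v e < m.

Lemma sum_cnt ts : \sum_(q < m) cnt q ts = size ts.
Proof.
elim: ts => [|t ts IH] /=; first by rewrite big1.
rewrite big_split /= IH (bigD1 (Ordinal (col_lt t.1 t.2))) //= eqxx big1 // => q hq.
by case: eqP => //= e; case/eqP: hq; apply: val_inj.
Qed.

Variables (b p t j cp a : nat).

Let Z := 8 ^ b.

Definition ltl (z : nat) : seq tile := ltiles (2 * b) z 0 (2 * b).

Definition lcnt (z q : nat) : nat := cnt q (ltl z).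

Definition key (x : nat -> nat) : nat := keyf x m 0.

Definition zero (q : nat) (x : nat -> nat) : nat -> nat := fun r => if r == q then 0 else x r.

Lemma ltl_size z : size (ltl z) <= 2 * b.
Proof. by apply: size_family; apply: ltiles_family. Qed.

Lemma ltl_complete ts : family (2 * b) ts -> exists2 z, z < Z & ltl z = ts.
Proof.
move=> f; apply: ltiles_complete; case: ts f => [|[v e] ts] //= /and3P[-> -> ->].
by rewrite eqxx orbT.
Qed.

(** Deleting the intervals of the other colours may destroy a tiling but not a family, and every
    family has a code. *)
Lemma lcnt_restrict P z : exists2 z', z' < Z &
  forall q, lcnt z' q = if P q then lcnt z q else 0.
Proof.
have f : family (2 * b) (ltl z) by apply: ltiles_family.
have [z' z'lt e] := ltl_complete (family_filter (fun s : tile => P (col s.1 s.2)) f).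
exists z' => // q; rewrite /lcnt e /cnt count_filter.
case: ifP => Pq.
  by apply: eq_count => s /=; case: eqP => // ->; rewrite Pq.
rewrite -[RHS](count_pred0 (ltl z)); apply: eq_count => s /=.
by case: eqP => // ->; rewrite Pq.
Qed.

Definition lvalid (z : nat) : bool :=
  [&& tiling a 0 (ltl z), size (ltl z) == j &
      all (fun q => if q == p then lcnt z q == cp else lcnt z q <= t) (iota 0 m)].

(* After the colours [i, m) have been processed, the entry of the table at x
   counts the tilings with exactly x r tiles of each colour r, where x r = 0
   stands for any number if r is one of these colours. *)
Definition fits (i : nat) (x c : nat -> nat) : bool :=
  all (fun r => (x r == c r) || ((i <= r) && (x r == 0))) (iota 0 m).

Lemma fitsP i x c : reflect (forall r, r < m -> x r = c r \/ i <= r /\ x r = 0) (fits i x c).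
Proof.
apply: (iffP allP) => h r; last first.
  by rewrite mem_iota => /h[->|[-> ->]]; rewrite eqxx ?orbT.
move=> rm; have : r \in iota 0 m by rewrite mem_iota.
by move/h/orP=> [/eqP|/andP[? /eqP]]; [left|right].
Qed.

Definition lsum (f : nat -> bool) : nat := \sum_(0 <= z < Z) (lvalid z && f z).

Lemma lsum_le f : lsum f <= Z.
Proof.
apply: (@leq_trans (\sum_(0 <= z < Z) 1)); last by rewrite sum_nat_const_nat subn0 muln1.
by apply: leq_sum => z _; apply: leq_b1.
Qed.

Lemma eq_lsum f g : (forall z, z < Z -> lvalid z -> f z = g z) -> lsum f = lsum g.
Proof.
move=> h; rewrite /lsum big_nat_cond [RHS]big_nat_cond.
apply: eq_bigr => z; rewrite andbT /= => zZ.
by case: lvalid (h z zZ) => //= ->.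
Qed.

Lemma lsum_or f g h : (forall z, z < Z -> lvalid z -> f z = g z || h z) ->
  (forall z, g z -> h z -> False) -> lsum f = lsum g + lsum h.
Proof.
move=> fgh gh; rewrite (eq_lsum fgh) /lsum -big_split /=; apply: eq_bigr => z _.
by have := gh z; case: lvalid; case: (g z); case: (h z) => //= [] [].
Qed.

Definition entry (i : nat) (x : nat -> nat) : nat := lsum (fun z => fits i x (lcnt z)).

(** Many codes share one vector; a chosen code for each key keeps the in-place transform from adding
    a cell twice. *)
Variable rep : nat -> nat.

Hypothesis repP : forall z, z < Z ->
  rep (key (lcnt z)) < Z /\ key (lcnt (rep (key (lcnt z)))) = key (lcnt z).

Definition setv (q : nat) (x c : nat -> nat) : nat -> nat :=
  fun r => if r == q then c q else x r.

(* The table while colour q is being processed: each vector that occurs is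
   visited at its representative code, and the codes from z0 on are done. *)
Definition entry_at (q z0 : nat) (x : nat -> nat) : nat :=
  lsum (fun z => fits q x (lcnt z) &&
    ((x q == lcnt z q) || (z0 <= rep (key (setv q x (lcnt z)))))).

Lemma fitsS q x c : q < m -> fits q x c && (x q == c q) = fits q.+1 x c.
Proof.
move=> qm; apply/andP/fitsP => [[/fitsP h /eqP e] r rm|h].
  case: (h r rm) => [->|[h1 h2]]; first by left.
  by have [er|ne] := eqVneq r q; [left; rewrite er|right; split=> //; lia].
split; last by case: (h q qm) => [->|[]]; rewrite ?eqxx ?ltnn.
by apply/fitsP => r rm; case: (h r rm) => [->|[? ?]]; [left|right; split=> //; lia].
Qed.

(** The cell that passes the contribution of z on to x does occur for a family: in z, keep colour q
    and the colours that x prescribes. *)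
Lemma setv_restrict q x z : q < m -> fits q x (lcnt z) ->
  exists2 z', z' < Z & key (setv q x (lcnt z)) = key (lcnt z').
Proof.
move=> qm /fitsP h.
have [z' z'lt e] := lcnt_restrict (fun r => (r == q) || (x r != 0)) z.
exists z' => //; apply: eq_keyf => r rm; rewrite e /setv; case: eqP => [->//|_] /=.
by case: eqP => //= x0; case: (h r rm) => [->|[]].
Qed.

Lemma entry_at_start q x : q < m -> entry_at q Z x = entry q.+1 x.
Proof.
move=> qm; apply: eq_lsum => z zZ _; rewrite -fitsS //.
case f: (fits q x (lcnt z)) => //=; case: eqP => //= _.
have [z' z'lt ->] := setv_restrict qm f.
by rewrite leqNgt; case: (repP z'lt) => ->.
Qed.

Lemma entry_at_end q x : entry_at q 0 x = entry q x.
Proof. by apply: eq_lsum => z _ _; rewrite leq0n orbT andbT. Qed.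

(** If the visit of z0 made a difference for x, then z0 would represent a vector obtained from x by
    filling in a nonzero entry at q, and x would be its target. *)
Lemma entry_at_other q z0 x : q < m ->
  ~~ [&& rep (key (lcnt z0)) == z0, lcnt z0 q != 0 & key (zero q (lcnt z0)) == key x] ->
  entry_at q z0 x = entry_at q z0.+1 x.
Proof.
move=> qm h; apply: eq_lsum => z zZ _; case f: (fits q x (lcnt z)) => //=.
case: eqP => //= ne; rewrite [z0 <= _]leq_eqVlt; case: eqP => //= e; case/negP: h.
have [z' z'lt ez'] := setv_restrict qm f.
have [_] := repP z'lt; rewrite -ez' -e => e2.
rewrite e2 -e eqxx /=; have [_ kk] := keyf_inj e2.
have xq : x q = 0 by move/fitsP: (f) => /(_ q qm)[/ne|[]].
rewrite kk // /setv eqxx; apply/andP; split; first by apply/eqP => c0; apply: ne; rewrite xq c0.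
apply/eqP/eq_keyf => r rm; rewrite /zero; case: eqP => [->//|/eqP nq].
by rewrite kk // /setv (negbTE nq).
Qed.

Lemma entry_at_target q z0 x : q < m -> z0 < Z ->
  rep (key (lcnt z0)) = z0 -> lcnt z0 q != 0 -> key (zero q (lcnt z0)) = key x ->
  entry_at q z0 x = entry_at q z0.+1 x + entry_at q z0.+1 (lcnt z0).
Proof.
move=> qm z0Z rz0 c0 /keyf_inj[_ kx].
have xq : x q = 0 by rewrite -kx // /zero eqxx.
have xr r : r < m -> r != q -> x r = lcnt z0 r.
  by move=> rm rq; rewrite -kx // /zero (negbTE rq).
(* The source has a nonzero entry at q and targets have 0 there, so no visit of this round changes
   it: it counts exact matches only, whatever z0 is. *)
have e2 c : fits q (lcnt z0) c && ((lcnt z0 q == c q) ||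
    (z0 < rep (key (setv q (lcnt z0) c)))) = fits q x c && (lcnt z0 q == c q).
  apply/andP/andP => [[f h]|[f /eqP e]].
    have e : lcnt z0 q = c q.
      by move/fitsP: f => /(_ q qm)[//|[_ e]]; rewrite e in c0.
    rewrite e eqxx; split=> //; apply/fitsP => r rm.
    have [->|rq] := eqVneq r q; first by right.
    by move/fitsP: f => /(_ r rm); rewrite -xr.
  rewrite e eqxx; split=> //; apply/fitsP => r rm.
  have [->|rq] := eqVneq r q; first by left.
  by move/fitsP: f => /(_ r rm); rewrite -xr.
apply: lsum_or.
- move=> z zZ _; rewrite e2; case f: (fits q x (lcnt z)) => //=.
  rewrite xq; case: eqP => //= ne.
  rewrite leq_eqVlt orbC; congr (_ || _); apply/eqP/eqP => [e|e].
    have [z' z'lt ez'] := setv_restrict qm f.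
    have [_] := repP z'lt; rewrite -ez' -e => /keyf_inj[_ /(_ q qm)].
    by rewrite /setv eqxx.
  rewrite -{1}rz0; congr rep; apply: eq_keyf => r rm; rewrite /setv.
  by case: eqP => [->//|/eqP rq]; rewrite xr.
- move=> z; rewrite e2 => /andP[f h1] /andP[_ /eqP h2]; move: h1.
  rewrite xq -h2 eq_sym (negbTE c0) /= => h.
  suff e : key (setv q x (lcnt z)) = key (lcnt z0) by rewrite e rz0 ltnn in h.
  by apply: eq_keyf => r rm; rewrite /setv; case: eqP => [->//|/eqP rq]; rewrite xr.
Qed.

(** * Inclusion and exclusion over the right half *)

Variables (n k : nat).

(* Ternary digits from right to left: 0 = continuation, 1 = start of an
   unmarked interval, 2 = start of a marked one. The interval that contains
   the vertex 2b starts at a. *)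
Definition rstart (i : nat) : nat := if i == 0 then a else 2 * b + i.

Fixpoint rtiles (i y e : nat) : seq (tile * bool) :=
  if i is i'.+1 then
    if y %% 3 == 0 then rtiles i' (y %/ 3) e
    else ((rstart i', e), y %% 3 == 2) :: rtiles i' (y %/ 3) (rstart i')
  else [::].

Fixpoint utiles (i e : nat) : seq (seq tile) :=
  if i is i'.+1 then
    utiles i' e ++ map (cons (rstart i', e)) (utiles i' (rstart i'))
  else [:: [::]].

Fixpoint markings (l : nat) : seq (seq bool) :=
  if l is l'.+1 then map (cons false) (markings l') ++ map (cons true) (markings l')
  else [:: [::]].

Lemma sum_ternary (R : zmodType) N (f : nat -> R) :
  (\sum_(0 <= z < 3 * N) f z =
   \sum_(0 <= z < N) f (3 * z)%N + \sum_(0 <= z < N) f (3 * z + 1)%N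
   + \sum_(0 <= z < N) f (3 * z + 2)%N)%R.
Proof.
elim: N => [|N IH]; first by rewrite muln0 !big_nil !addr0.
have -> : 3 * N.+1 = (3 * N).+3 by lia.
rewrite !big_nat_recr //= IH !addn1 addn2.
by rewrite [X in _ = (X + _)%R]addrACA [RHS]addrACA !addrA.
Qed.

(** Each digit decides both whether an interval starts and whether it is marked, so the words run
    through the marked tilings, each once. *)
Lemma sum_rtiles (R : zmodType) i e (G : seq (tile * bool) -> R) :
  (\sum_(0 <= z < 3 ^ i) G (rtiles i z e) =
   \sum_(u <- utiles i e) \sum_(mu <- markings (size u)) G (zip u mu))%R.
Proof.
elim: i e G => [|i IH] e G; first by rewrite big_nat1 /= !big_seq1.
rewrite expnS sum_ternary /= big_cat big_map /= -addrA; congr (_ + _)%R.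
  rewrite -IH; apply: eq_bigr => z _.
  by rewrite mulnC modnMl mulnK.
under [RHS]eq_bigr do rewrite /= big_cat !big_map.
rewrite big_split /= -!(IH _ (fun x => G (_ :: x))).
by congr (_ + _)%R; apply: eq_bigr => z _; rewrite mulnC modnMDl divnMDl // addn0.
Qed.

Definition mcnt (q : nat) (ts : seq (tile * bool)) : nat :=
  count (fun x => (col x.1.1 x.1.2 == q) && x.2) ts.

(* The marked intervals of each colour are the last ones in the list. *)
Fixpoint canon (q : nat) (ts : seq (tile * bool)) : bool :=
  if ts is (s, mk) :: ts' then
    (((col s.1 s.2 == q) && mk) ==> (mcnt q ts' == cnt q (unzip1 ts'))) && canon q ts'
  else true.

Lemma canon_full q ts : mcnt q ts = cnt q (unzip1 ts) -> canon q ts.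
Proof.
elim: ts => [|[s mk] ts IH] //=.
have le : mcnt q ts <= cnt q (unzip1 ts).
  by elim: (ts) => //= x ts' IH'; apply: leq_add => //; case: (_ == q); case: x.2.
case: (_ == q) => /=; last exact: IH.
case: mk => /= e; last by lia.
have {}e : mcnt q ts = cnt q (unzip1 ts) by lia.
by rewrite e eqxx IH.
Qed.

(** A canonical marking is determined by its numbers of marked intervals, which can be chosen
    independently for the colours, between 0 and [cnt q u]; hence the sum of products is a product
    of sums. *)
Lemma sum_canonical_markings (R : comPzRingType) (u : seq tile) (F : nat -> nat -> R) :
  (\sum_(mu <- markings (size u))
     (all (fun q => canon q (zip u mu)) (iota 0 m))%:R
     * \prod_(q < m) F q (mcnt q (zip u mu)) =
   \prod_(q < m) \sum_(0 <= v < (cnt q u).+1) F q v)%R.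
Proof.
elim: u F => [|s u IH] F.
  rewrite /= big_seq1 /=; have -> : all (fun=> true) (iota 0 m) by apply/allP.
  by rewrite mul1r; apply: eq_bigr => q _; rewrite big_nat1.
rewrite /= big_cat !big_map /=; set c := col s.1 s.2.
have cm : c < m by apply: col_lt.
pose c' := Ordinal cm.
have nqc (q : 'I_m) : q != c' -> (q == c :> nat) = false.
  by apply: contraNF => /eqP e; apply/eqP/val_inj.
under eq_bigr => mu _.
  have -> : all (fun q => (((c == q) && false) ==>
     (mcnt q (zip u mu) == cnt q (unzip1 (zip u mu)))) && canon q (zip u mu)) (iota 0 m) =
     all (fun q => canon q (zip u mu)) (iota 0 m).
    by apply: eq_all => q; rewrite andbF.
  under eq_bigr => q _ do rewrite andbF add0n.
  over.
rewrite IH.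
(* Marking the first interval, of colour c, forces all later ones of this colour to be marked; [F']
   keeps just the top value of v, shifted by one. *)
pose F' (q v : nat) : R := if q == c then (if v == cnt c u then F c v.+1 else 0%R) else F q v.
rewrite [X in (_ + X)%R](_ : _ = \prod_(q < m) \sum_(0 <= v < (cnt q u).+1) F' q v)%R;
  last first.
  rewrite -IH; apply: eq_big_seq => mu mus.
  have smu : size mu = size u.
    move: mus; elim: (size u) mu => [|l IHl] mu /=; first by rewrite inE => /eqP->.
    by rewrite mem_cat => /orP[]/mapP[mu' /IHl <- ->].
  have u1 : unzip1 (zip u mu) = u by rewrite unzip1_zip // smu.
  rewrite u1 (bigD1 c') //= [in RHS](bigD1 c') //= /F' !eqxx andbT add1n.
  have -> : (\prod_(q < m | q != c') F q ((c == q) && true + mcnt q (zip u mu))%N =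
      \prod_(q < m | q != c') F' q (mcnt q (zip u mu)))%R.
    by apply: eq_bigr => q hq; rewrite /F' eq_sym nqc.
  have -> : all (fun q => (((c == q) && true) ==> (mcnt q (zip u mu) == cnt q u))
       && canon q (zip u mu)) (iota 0 m) =
     all (fun q => canon q (zip u mu)) (iota 0 m) && (mcnt c (zip u mu) == cnt c u).
    transitivity (all (predI (fun q => canon q (zip u mu))
        (fun q => (c == q) ==> (mcnt q (zip u mu) == cnt q u))) (iota 0 m)).
      by apply: eq_all => q /=; case: (c == q); rewrite /= andbC.
    rewrite all_predI; congr (_ && _); apply/allP/idP => [h|h q _].
      by have := h c; rewrite mem_iota /= cm eqxx => /(_ isT).
    by apply/implyP => /eqP <-.
  case: (mcnt c _ == _); rewrite ?andbT ?andbF //= !mul0r ?mulr0 //.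
have D (G : 'I_m -> R) : (\prod_(q < m) G q = G c' * \prod_(q < m | q != c') G q)%R.
  by rewrite (bigD1 c').
rewrite !D /=.
have -> : (\prod_(q < m | q != c') (\sum_(0 <= v < (cnt q u).+1) F' q v) =
    \prod_(q < m | q != c') (\sum_(0 <= v < (cnt q u).+1) F q v))%R.
  by apply: eq_bigr => q hq; apply: eq_bigr => v _; rewrite /F' nqc.
have -> : (\prod_(q < m | q != c') (\sum_(0 <= v < ((c == q) + cnt q u)%N.+1) F q v) =
    \prod_(q < m | q != c') (\sum_(0 <= v < (cnt q u).+1) F q v))%R.
  by apply: eq_bigr => q hq; rewrite eq_sym nqc.
rewrite -mulrDl eqxx add1n [in RHS]big_nat_recr //=; congr ((_ + _) * _)%R.
rewrite big_nat_recr //= /F' !eqxx big_nat big1 ?add0r // => v /andP[_ vlt].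
by rewrite ltn_eqF.
Qed.

Definition leftmost (e : nat) (u : seq tile) : nat := foldl (fun _ s => s.1) e u.

Definition rvalid (ts : seq (tile * bool)) : bool :=
  [&& leftmost n (unzip1 ts) == a, size ts + j == k &
      all (fun q => (if q == p then (cnt q (unzip1 ts) + cp == t.+1) && (mcnt q ts == 0)
                     else cnt q (unzip1 ts) <= t) && canon q ts) (iota 0 m)].

(** On valid words a marked colour has at most t intervals, so its entry is at least 1, and the
    value 0 is free to mean that the colour is unconstrained. *)
Definition rvec (ts : seq (tile * bool)) (q : nat) : nat :=
  if (q == p) || (mcnt q ts == 0) then 0 else t.+1 - mcnt q ts.

Definition rsign (ts : seq (tile * bool)) : nat :=
  \sum_(q < m) ((q != p :> nat) && (mcnt q ts != 0)).

Definition total : int :=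
  (\sum_(0 <= z < 3 ^ (n - 2 * b))
    (if rvalid (rtiles (n - 2 * b) z n)
     then (-1) ^+ rsign (rtiles (n - 2 * b) z n)
          * (entry 0 (rvec (rtiles (n - 2 * b) z n)))%:R
     else 0))%R.

Definition uvalid (u : seq tile) : bool :=
  [&& leftmost n u == a, size u + j == k &
      all (fun q => if q == p then cnt q u + cp == t.+1 else cnt q u <= t) (iota 0 m)].

Definition compatible (z : nat) (u : seq tile) : bool :=
  all (fun q => (q == p) || (lcnt z q + cnt q u <= t)) (iota 0 m).

Lemma prod_bool (R : comPzRingType) (f : nat -> bool) i :
  (\prod_(q < i) (f q)%:R = (all f (iota 0 i))%:R :> R)%R.
Proof.
elim: i => [|i IH]; first by rewrite big_ord0.
have -> : iota 0 i.+1 = iota 0 i ++ [:: i] by rewrite -addn1 iotaD.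
rewrite big_ord_recr IH all_cat /= andbT.
by case: all; rewrite /= ?mul1r ?mul0r.
Qed.

Lemma mcnt_le q ts : mcnt q ts <= cnt q (unzip1 ts).
Proof.
elim: ts => //= x ts IH; apply: leq_add => //.
by case: (_ == q); case: x.2.
Qed.

(** The factor that colour q contributes to a signed term. For p the counts are fixed by the guess,
    so marks are forbidden instead of being summed over. *)
Definition weigh (c : nat -> nat) (q v : nat) : int :=
  if q == p then (v == 0)%:R%R
  else if v == 0 then 1%R else (- (t.+1 - v == c q)%N%:R)%R.

(** Since c q <= t, the sum c q + N exceeds t only if c q lies between t + 1 - N and t, and then
    exactly one v cancels the 1; otherwise none does. *)
Lemma sum_weigh c q N : q != p -> c q <= t -> N <= t ->
  (\sum_(0 <= v < N.+1) weigh c q v = (c q + N <= t)%N%:R)%R.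
Proof.
move=> qp ct; elim: N => [|N IH] Nt.
  by rewrite big_nat1 /weigh (negbTE qp) addn0 ct.
rewrite big_nat_recr //= IH ?(ltnW Nt) // /weigh (negbTE qp) /= subSS.
by case: eqP => e; case: leqP => h1; case: leqP => h2 //=; lia.
Qed.

Lemma size_markings l mu : mu \in markings l -> size mu = l.
Proof.
elim: l mu => [|l IH] mu /=; first by rewrite inE => /eqP->.
by rewrite mem_cat => /orP[]/mapP[mu' /IH <- ->].
Qed.

Lemma sum_pair z u : lvalid z ->
  (\sum_(mu <- markings (size u))
     (if rvalid (zip u mu) then
        (-1) ^+ rsign (zip u mu) * (fits 0 (rvec (zip u mu)) (lcnt z))%:R
      else 0) = (uvalid u && compatible z u)%:R :> int)%R.
Proof.
case/and3P=> _ _ /allP cz.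
case uv: (uvalid u) => /=; last first.
  rewrite big_seq big1 // => mu /size_markings smu.
  rewrite ifF //; apply: contraFF uv => /and3P[].
  rewrite unzip1_zip ?smu // size_zip smu minnn => h1 h2 /allP h3.
  rewrite /uvalid h1 h2 /=; apply/allP => q qm.
  by have /andP[] := h3 q qm; case: (q == p) => // /andP[].
have /and3P[h1 h2 /allP h3] := uv.
transitivity (\sum_(mu <- markings (size u))
     (all (fun q => canon q (zip u mu)) (iota 0 m))%:R
     * \prod_(q < m) weigh (lcnt z) q (mcnt q (zip u mu)))%R.
  rewrite big_seq [RHS]big_seq; apply: eq_bigr => mu /size_markings smu.
  have uz : unzip1 (zip u mu) = u by rewrite unzip1_zip ?smu.
  set ts := zip u mu in uz *.
  have -> : rvalid ts = all (fun q => canon q ts) (iota 0 m)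
      && all (fun q => (q == p) ==> (mcnt q ts == 0)) (iota 0 m).
    rewrite /rvalid uz h1 {1}/ts size_zip smu minnn h2 /= -all_predI.
    apply: eq_in_all => q qm /=; move: (h3 q qm).
    by case: (q == p) => /= ->; rewrite andbC.
  case: (all (fun q => canon q ts) _) => /=; last by rewrite mul0r.
  rewrite mul1r.
  (* Each factor splits into a condition and a sign, and the product regroups into validity for p,
     [fits] and the total sign. *)
  rewrite (eq_bigr (fun q : 'I_m => (((q == p :> nat) ==> (mcnt q ts == 0))
       && ((rvec ts q == lcnt z q) || (rvec ts q == 0)))%:R
     * (-1) ^+ ((q != p :> nat) && (mcnt q ts != 0)))%R); last first.
    move=> q _; have qm : (q : nat) \in iota 0 m by rewrite mem_iota /= ltn_ord.
    rewrite /weigh /rvec; have := h3 q qm; have := mcnt_le q ts; rewrite uz.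
    case: eqP => //= _; first by rewrite expr0 mulr1 orbT andbT.
    case: (mcnt q ts) => [|v] /=; first by rewrite orbT mulr1.
    move=> hv ht; rewrite expr1 mulrN1 orbC.
    by have -> : (t.+1 - v.+1 == 0) = false by lia.
  rewrite big_split /= (prod_bool _ (fun q => ((q == p) ==> (mcnt q ts == 0))
       && ((rvec ts q == lcnt z q) || (rvec ts q == 0)))).
  rewrite -(big_morph (fun i : nat => (-1) ^+ i)%R (exprD (-1)%R) (expr0 _)) -/(rsign ts).
  set A := all _ _; set B := all _ _.
  have -> : B = A && fits 0 (rvec ts) (lcnt z) by rewrite -all_predI.
  by case: A; rewrite ?mul0r //= mulrC.
rewrite sum_canonical_markings.
rewrite (eq_bigr (fun q : 'I_m => ((q == p :> nat) || (lcnt z q + cnt q u <= t))%N%:R)%R).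
  by rewrite (prod_bool _ (fun q => (q == p) || (lcnt z q + cnt q u <= t))).
move=> q _; have qm : (q : nat) \in iota 0 m by rewrite mem_iota /= ltn_ord.
have := h3 q qm; have := cz q qm; case: eqP => [->|/eqP qp] hc hu.
  by rewrite big_nat_recl //= /weigh eqxx big1 ?addr0.
by rewrite sum_weigh.
Qed.

(** Once the sums are exchanged, the signs cancel within each pair of a left code and a right
    tiling. What remains is a plain count, nonzero as soon as one pair contributes. *)
Lemma total_count :
  total = (\sum_(0 <= z < Z) \sum_(u <- utiles (n - 2 * b) n)
             [&& lvalid z, uvalid u & compatible z u])%:R%R.
Proof.
rewrite /total (sum_rtiles _ n (fun ts => if rvalid ts then
   ((-1) ^+ rsign ts * (entry 0 (rvec ts))%:R)%R else 0%R)).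
rewrite exchange_big /= natr_sum; apply: eq_bigr => u _.
rewrite natr_sum (eq_bigr (fun mu => \sum_(0 <= z < Z)
   (lvalid z)%:R * (if rvalid (zip u mu) then
     (-1) ^+ rsign (zip u mu) * (fits 0 (rvec (zip u mu)) (lcnt z))%:R else 0))%R).
  rewrite exchange_big /=; apply: eq_bigr => z _; rewrite -mulr_sumr.
  by case lv: (lvalid z); rewrite ?mul0r // mul1r sum_pair.
move=> mu _; case: ifP => _; last by rewrite big1 // => z _; rewrite mulr0.
rewrite /entry /lsum natr_sum mulr_sumr; apply: eq_bigr => z _.
by case: lvalid; rewrite ?mul0r ?mulr0 // mul1r.
Qed.

Lemma utiles_tiling i e u : a <= 2 * b -> 2 * b + i <= e -> u \in utiles i e ->
  tiling e (leftmost e u) u.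
Proof.
move=> ab; elim: i e u => [|i IH] e u ie /=; first by rewrite inE => /eqP->/=.
rewrite mem_cat => /orP[/IH|/mapP[u' u'i ->]] /=; first by apply; lia.
rewrite eqxx /=; have -> : rstart i < e by rewrite /rstart; case: eqP; lia.
rewrite /=; case: i IH u'i ie => [|i] IH u'i ie.
  by move: u'i; rewrite /= inE => /eqP-> /=.
by apply: IH; rewrite // /rstart /=; lia.
Qed.

Hypotheses (b_lt : 2 * b < n) (p_lt : p < m).

Definition winning (ts : seq tile) : Prop :=
  [/\ tiling n 0 ts, size ts = k & forall q, q < m -> q != p -> cnt q ts < cnt p ts].

Lemma cnt_cat q ts1 ts2 : cnt q (ts1 ++ ts2) = cnt q ts1 + cnt q ts2.
Proof. exact: count_cat. Qed.

Lemma total_sound : total != 0%R -> exists ts, winning ts.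
Proof.
rewrite total_count pnatr_eq0 sum_nat_seq_eq0 => /allPn[z _] /=.
rewrite sum_nat_seq_eq0 => /allPn[u uin] /=.
rewrite eqb0 negbK => /and3P[/and3P[tz sz /allP cz] /and3P[/eqP lu su /allP cu] /allP c].
have ab : a <= 2 * b.
  have : family (2 * b) (ltl z) by apply: ltiles_family.
  by case: (ltl z) tz => [|[v e] l] /=; [move/eqP->|case/and3P=> /eqP-> _ _ /and3P[]].
have pm : p \in iota 0 m by rewrite mem_iota.
exists (u ++ ltl z); split.
- apply: tiling_cat tz; rewrite -lu; apply: utiles_tiling uin; lia.
- by rewrite size_cat (eqP sz) (eqP su).
- move=> q qm qp; have qi : q \in iota 0 m by rewrite mem_iota.
  have := c q qi; have := cu p pm; have := cz p pm.
  by rewrite !eqxx (negbTE qp) /= !cnt_cat /lcnt; lia.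
Qed.

Lemma total_neq0 z u : z < Z -> u \in utiles (n - 2 * b) n -> lvalid z -> uvalid u ->
  compatible z u -> total != 0%R.
Proof.
move=> zZ uin lz uu c; rewrite total_count pnatr_eq0 sum_nat_seq_eq0.
apply/allPn; exists z; first by rewrite mem_index_iota.
rewrite /= sum_nat_seq_eq0; apply/allPn; exists u => //=.
by rewrite lz uu c.
Qed.

End Colours.

(** Every vertex right of the cut selects one of the two branches of [utiles]; the interval around
    vertex 2b takes the start branch at position 0, whatever its true start a is. *)
Lemma tiling_split b i v e ts : tiling e 0 ((v, e) :: ts) -> v <= 2 * b + i < e ->
  exists a u l, [/\ (v, e) :: ts = u ++ l, a <= 2 * b, tiling a 0 l,
                    u \in utiles b a i.+1 e & leftmost e u = a].
Proof.
elim: i v e ts => [|i IH] v e ts /= /and3P[_ ve tl] /andP[vi ie].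
  exists v, [:: (v, e)], ts; split=> //; first by rewrite addn0 in vi.
  by rewrite /= !inE eqxx orbT.
have [vE|vE] := eqVneq v (2 * b + i.+1).
  case: ts tl => [|[v' e'] ts] /=; first by rewrite vE => /eqP; lia.
  move=> tl; have /and3P[/eqP e'v v'v tl'] := tl.
  rewrite e'v in tl v'v *; have [||a [u [l [E ab tal uin lu]]]] := IH v' v ts.
  - by rewrite /= eqxx v'v.
  - by move: v'v; rewrite vE; lia.
  exists a, ((v, e) :: u), l; split=> //; first by rewrite E.
  rewrite [utiles _ _ _ _]/= mem_cat; apply/orP; right.
  by rewrite /rstart -vE; apply: map_f.
have [||a [u [l [E ab tal uin lu]]]] := IH v e ts.
- by rewrite /= eqxx ve.
- by lia.
exists a, u, l; split=> //.
by rewrite [utiles _ _ _ _]/= mem_cat; apply/orP; left.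
Qed.

Theorem total_spec col m b p n k : (forall v e, col v e < m) -> 2 * b < n -> p < m ->
  (exists t j cp a, [/\ t <= n, j <= n, cp <= n, a <= n &
     total col m b p t j cp a n k != 0%R]) <->
  exists ts, winning col m p n k ts.
Proof.
move=> col_lt b_lt p_lt; split.
  by case=> t [j [cp [a [_ _ _ _ /(total_sound col_lt b_lt p_lt)]]]].
case=> -[|[v e] ts]; first by case=> /eqP n0; lia.
move=> [ti sz win]; have := ti; rewrite [tiling _ _ _]/= => /and3P[/eqP e_n ve _].
rewrite e_n in ti sz win ve *.
have [||a [u [l [E ab tl uin lu]]]] := @tiling_split b (n - (2 * b).+1) v n ts; rewrite //; try lia.
have := size_family (tiling_family ti); rewrite E size_cat => szn.
rewrite E in win sz; set w := u ++ l in win.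
have cntw q : cnt col q w = cnt col q u + cnt col q l by apply: count_cat.
have cnt_le q (s : seq tile) : cnt col q s <= size s by apply: count_size.
(* Some colour wins the rightmost interval; if it is not p, then p wins strictly more than it. So
   the predecessor taken below is exact. *)
have cp0 : 0 < cnt col p w.
  have h : 0 < cnt col (col v n) w by rewrite /w -E /= eqxx.
  by have [<-//|/win] := eqVneq (col v n) p; move=> /(_ (col_lt _ _)); lia.
have [z z8 zl] := ltl_complete (familyW ab (tiling_family tl)).
(* Here p wins t + 1 intervals in all, of which cp are among the j intervals left of a. *)
exists (cnt col p w).-1, (size l), (cnt col p l), a.
have ln : size l <= n by apply: leq_trans szn; apply: leq_addl.
have un : cnt col p u + cnt col p l <= n.
  by apply: leq_trans szn; apply: leq_add; apply: cnt_le.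
split=> //.
- by apply: leq_trans (leq_pred _) _; rewrite cntw.
- by apply: leq_trans un; apply: leq_addl.
- by apply: leq_trans ab _; apply: ltnW.
apply: (total_neq0 col_lt z8 (u := u)).
- by move: uin; congr (_ \in utiles _ _ _ _); lia.
- rewrite /lvalid zl tl eqxx /=; apply/allP => q; rewrite mem_iota /= => qm.
  rewrite /lcnt zl; case: eqP => [->//|/eqP qp].
  by have := win q qm qp; rewrite !cntw; lia.
- apply/and3P; split; first by rewrite lu.
    by rewrite -sz size_cat.
  apply/allP => q; rewrite mem_iota /= => qm; case: eqP => [->|/eqP qp].
    by rewrite prednK // cntw.
  by have := win q qm qp; rewrite !cntw; lia.
- apply/allP => q; rewrite mem_iota /= => qm; case: eqP => //= /eqP qp.
  by have := win q qm qp; rewrite /lcnt zl !cntw; lia.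
Qed.

(** * The program *)

Notation "x ⊕ y" := (Bin Add x y) (at level 50, left associativity).
Notation "x ⊖ y" := (Bin Defs.Sub x y) (at level 50, left associativity).
Notation "x ⊗ y" := (Bin Mul x y) (at level 40, left associativity).
Notation "x ⊘ y" := (Bin Div x y) (at level 40, left associativity).
Notation "x ⊙ y" := (Bin Mod x y) (at level 40, left associativity).
Notation "r ::= e" := (Asn r e) (at level 60).
Notation "c1 ;; c2" := (Seq c1 c2) (at level 80, right associativity).
Coercion Var : nat >-> expr.

(** Truncated subtraction detects only one strict inequality, hence two tests. *)
Definition IfEq (x y : expr) (c1 c2 : com) : com := If (x ⊖ y) c2 (If (y ⊖ x) c2 c1).

(** The less obvious registers: [rE] is the base of the current table, [rq] the colour that the
    transform removes, [rqq] the colour being scanned, [rc] and [rmk] its numbers of tiles and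
    marked tiles, [rch] the right end expected of the next tile, [rpi] the guess, [rP] and [rN] the
    positive and negative parts of the sum. *)
Notation res := 0 (only parsing).
Notation rn := 1 (only parsing).
Notation rm := 2 (only parsing).
Notation rk := 3 (only parsing).
Notation rp := 4 (only parsing).
Notation rU := 5 (only parsing).
Notation rb2 := 6 (only parsing).
Notation rEL := 7 (only parsing).
Notation rER := 8 (only parsing).
Notation rh := 9 (only parsing).
Notation rpi := 10 (only parsing).
Notation rt := 11 (only parsing).
Notation rj := 12 (only parsing).
Notation rcp := 13 (only parsing).
Notation ra := 14 (only parsing).
Notation rE := 15 (only parsing).
Notation rq := 16 (only parsing).
Notation rz := 17 (only parsing).
Notation rqq := 18 (only parsing).
Notation ry := 19 (only parsing).
Notation rd := 20 (only parsing).
Notation rv := 21 (only parsing).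
Notation re := 22 (only parsing).
Notation rc := 23 (only parsing).
Notation rJ := 24 (only parsing).
Notation rch := 25 (only parsing).
Notation rok := 26 (only parsing).
Notation rkey := 27 (only parsing).
Notation rkey2 := 28 (only parsing).
Notation rmk := 29 (only parsing).
Notation rsg := 30 (only parsing).
Notation rtot := 31 (only parsing).
Notation rx := 32 (only parsing).
Notation rP := 33 (only parsing).
Notation rN := 34 (only parsing).
Notation rcol := 35 (only parsing).
Notation ri := 36 (only parsing).
Notation rsym := 37 (only parsing).
Notation rcur := 38 (only parsing).
Notation rprev := 39 (only parsing).
Notation rnxt := 40 (only parsing).
Notation rdeg := 41 (only parsing).
Notation ru := 42 (only parsing).
Notation racc := 43 (only parsing).
Notation rpw := 44 (only parsing).

(** The mask of [v, e) is the difference of two suffix masks. *)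
Definition tile_colour : com :=
  rcol ::= Win (Get (rU ⊕ rv) ⊖ Get (rU ⊕ re)).

Definition left_tile : com :=
  tile_colour ;;
  rJ ::= rJ ⊕ Num 1 ;;
  IfEq re rch (rch ::= rv) (rok ::= Num 0) ;;
  IfEq rcol rqq
    (rc ::= rc ⊕ Num 1 ;; rkey ::= rkey ⊕ rkey ;;
     IfEq rqq rq Skip (rkey2 ::= rkey2 ⊕ rkey2))
    Skip.

Definition left_scan : com :=
  ry ::= rz ;; rd ::= Num 0 ;; re ::= rb2 ;; rv ::= rb2 ;;
  Loop false rv (
    If (rv ⊙ Num 2)
      (rd ::= ry ⊙ Num 8 ;; ry ::= ry ⊘ Num 8 ;; rsym ::= rd ⊙ Num 3)
      (rsym ::= (Num 3 ⊖ rd ⊘ Num 3) ⊙ Num 3) ;;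
    If rsym (IfEq rsym (Num 1) (re ::= rv) Skip) (left_tile ;; re ::= rv)).

(** The word is scanned anew for every colour: the registers cannot hold a vector, but the key can
    be written block by block, first a 1 and then a 0 for each tile of the colour. *)
Definition left_colour : com :=
  rkey ::= rkey ⊕ rkey ⊕ Num 1 ;; rkey2 ::= rkey2 ⊕ rkey2 ⊕ Num 1 ;;
  rc ::= Num 0 ;; rJ ::= Num 0 ;; rch ::= ra ;;
  left_scan ;;
  IfEq rqq rp (IfEq rc rcp Skip (rok ::= Num 0)) (If (rc ⊖ rt) (rok ::= Num 0) Skip) ;;
  If rch (rok ::= Num 0) Skip ;;
  IfEq rJ rj Skip (rok ::= Num 0).

(* For the left code in rz, computes its key, the key without the colour rq
   and whether it is a tiling that fits the parameters. *)
Definition left : com :=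
  rkey ::= Num 0 ;; rkey2 ::= Num 0 ;; rok ::= Num 1 ;; rqq ::= rm ;;
  Loop false rqq left_colour.

Definition right_tile : com :=
  tile_colour ;;
  rJ ::= rJ ⊕ Num 1 ;;
  IfEq rcol rqq
    (rc ::= rc ⊕ Num 1 ;;
     If (rd ⊖ Num 1) (rmk ::= rmk ⊕ Num 1) (If rmk (rok ::= Num 0) Skip))
    Skip.

Definition right_scan : com :=
  ry ::= rz ;; re ::= rn ;; ri ::= rh ;;
  Loop false ri (
    rd ::= ry ⊙ Num 3 ;; ry ::= ry ⊘ Num 3 ;;
    If rd
      (If ri (rv ::= rb2 ⊕ ri) (rv ::= ra) ;; right_tile ;; re ::= rv)
      Skip).

(** A right word may ask for a vector of total above n, which no left family has. Doubling stops
    once [rtot] exceeds n, so that the key still fits in a word; [right] then rejects the right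
    word. *)
Definition shift_key : com :=
  rx ::= (rt ⊕ Num 1) ⊖ rmk ;;
  Loop false rx (rtot ::= rtot ⊕ Num 1 ;; If (rtot ⊖ rn) Skip (rkey ::= rkey ⊕ rkey)).

Definition right_colour : com :=
  rkey ::= rkey ⊕ rkey ⊕ Num 1 ;;
  rc ::= Num 0 ;; rmk ::= Num 0 ;; rJ ::= Num 0 ;;
  right_scan ;;
  IfEq rqq rp
    (IfEq (rc ⊕ rcp) (rt ⊕ Num 1) (If rmk (rok ::= Num 0) Skip) (rok ::= Num 0))
    (If (rc ⊖ rt) (rok ::= Num 0) Skip ;;
     If rmk (rsg ::= Num 1 ⊖ rsg ;; shift_key) Skip) ;;
  IfEq re ra Skip (rok ::= Num 0) ;;
  IfEq (rJ ⊕ rj) rk Skip (rok ::= Num 0).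

Definition right : com :=
  rkey ::= Num 0 ;; rtot ::= Num 0 ;; rsg ::= Num 0 ;; rok ::= Num 1 ;; rqq ::= rm ;;
  Loop false rqq right_colour ;;
  If (rtot ⊖ rn) (rok ::= Num 0) Skip.

(** Codes come in decreasing order and overwrite each other, so the representative of a key is its
    smallest code. *)
Definition fill : com :=
  rz ::= rEL ;;
  Loop true rz (
    left ;;
    Put (rU ⊕ rU ⊕ rkey) rz ;;
    If rok (Put (rE ⊕ rkey) (Get (rE ⊕ rkey) ⊕ Num 1)) Skip).

Definition zeta : com :=
  rq ::= rm ;;
  Loop false rq (
    rz ::= rEL ;;
    Loop true rz (
      left ;;
      IfEq rkey rkey2 Skip
        (IfEq (Get (rU ⊕ rU ⊕ rkey)) rz
          (Put (rE ⊕ rkey2) (Get (rE ⊕ rkey2) ⊕ Get (rE ⊕ rkey))) Skip))).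

(** Registers hold no negative numbers, so the two signs are summed separately. As the total is a
    count, testing whether the positive part exceeds the negative one is enough. *)
Definition sum_up : com :=
  rP ::= Num 0 ;; rN ::= Num 0 ;; rz ::= rER ;;
  Loop true rz (
    right ;;
    If rok
      (If rsg (rN ::= rN ⊕ Get (rE ⊕ rkey)) (rP ::= rP ⊕ Get (rE ⊕ rkey)))
      Skip) ;;
  If (rP ⊖ rN) (res ::= Num 1) Skip.

(** The guess is a number with the digits t, j, cp, a in base n + 1. Every guess gets its own table
    zone, so that no table needs clearing. *)
Definition decode : com :=
  rt ::= rpi ⊙ (rn ⊕ Num 1) ;; rx ::= rpi ⊘ (rn ⊕ Num 1) ;;
  rj ::= rx ⊙ (rn ⊕ Num 1) ;; rx ::= rx ⊘ (rn ⊕ Num 1) ;;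
  rcp ::= rx ⊙ (rn ⊕ Num 1) ;; ra ::= rx ⊘ (rn ⊕ Num 1) ;;
  rE ::= (rpi ⊕ Num 3) ⊗ rU.

Definition search : com :=
  rpi ::= (rn ⊕ Num 1) ⊗ (rn ⊕ Num 1) ;; rpi ::= rpi ⊗ rpi ;;
  Loop false rpi (decode ;; fill ;; zeta ;; sum_up).

Definition setup : com :=
  rn ::= Get (Num 0) ;; rm ::= Get (Num 1) ;; rk ::= Get (Num 2) ;; rp ::= Get (Num 3) ;;
  rU ::= Num 8 ;; ri ::= rn ⊕ rm ;; Loop false ri (rU ::= rU ⊕ rU) ;;
  rb2 ::= (Num 19 ⊗ rn) ⊘ Num 74 ;;
  rEL ::= Num 1 ;; ri ::= rb2 ;; Loop false ri (rEL ::= rEL ⊗ Num 8) ;;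
  rb2 ::= rb2 ⊕ rb2 ;; rh ::= rn ⊖ rb2 ;;
  rER ::= Num 1 ;; ri ::= rh ;; Loop false ri (rER ::= rER ⊗ Num 3).

(** An end of the path is a vertex with fewer than two neighbours; this includes the only vertex if
    n = 1. *)
Definition find_end : com :=
  ru ::= rn ;;
  Loop false ru (
    rdeg ::= Num 0 ;; rv ::= rn ;;
    Loop false rv (rdeg ::= rdeg ⊕ Get (Num 4 ⊕ ru ⊗ rn ⊕ rv)) ;;
    If (Num 2 ⊖ rdeg) (rcur ::= ru) Skip).

(* Stores at U + i the mask of the vertices at the positions i, ..., n - 1. *)
Definition order_path : com :=
  find_end ;;
  rprev ::= rn ;; racc ::= Num 0 ;; ri ::= rn ;;
  Loop false ri (
    rpw ::= Num 1 ;; rx ::= rcur ;; Loop false rx (rpw ::= rpw ⊕ rpw) ;;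
    racc ::= racc ⊕ rpw ;; Put (rU ⊕ ri) racc ;;
    rv ::= rn ;;
    Loop false rv (
      If (Get (Num 4 ⊕ rcur ⊗ rn ⊕ rv)) (IfEq rv rprev Skip (rnxt ::= rv)) Skip) ;;
    rprev ::= rcur ;; rcur ::= rnxt).

Definition gerry : com := setup ;; order_path ;; search.

Lemma gerry_wf : cwf gerry.
Proof. by []. Qed.

Lemma gerry_depth : depth true gerry = 1.
Proof. by []. Qed.

Arguments wp : simpl never.
Arguments upd _ _ _ _ /.

(** * Correctness of the program *)

(* Rewrites what a program fragment leaves alone back to the state before it. *)
Ltac kp := repeat match goal with
  | K : keeps ?c ?s ?s' |- context[rg ?s' ?r] => rewrite (proj1 K r isT)
  | K : keeps ?c ?s ?s' |- context[mm ?s'] => rewrite (proj2 K isT)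
  end.

Section Program.

Variables (I : wgm) (eta : chooser I) (w : nat) (bnd : bool -> nat).

Notation WP := (wp eta w bnd).

Lemma wp_ifeq x y c1 c2 s (Q : state -> Prop) :
  eok eta w s x -> eok eta w s y ->
  (ev eta s x = ev eta s y -> WP c1 Q s) ->
  (ev eta s x <> ev eta s y -> WP c2 Q s) -> WP (IfEq x y c1 c2) Q s.
Proof.
move=> ox oy h1 h2; apply: wp_if => [|h|h]; first by [].
  by apply: h2 => e; move: h; rewrite /= e subnn.
apply: wp_if => [|h'|h']; first by [].
  by apply: h2 => e; move: h'; rewrite /= e subnn.
by apply: h1; move: h h' => /= /eqP; rewrite subn_eq0 => ? /eqP; rewrite subn_eq0; lia.
Qed.

Lemma wp_skip s (Q : state -> Prop) : Q s -> WP Skip Q s.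
Proof. by []. Qed.

Lemma wp_use c s (R Q : state -> Prop) : WP c R s ->
  (forall s', keeps c s s' -> R s' -> Q s') -> WP c Q s.
Proof. by move=> /wp_keeps h hQ; apply: wp_conseq h => s' [K r]; apply: hQ. Qed.

Local Notation n := (nvoters I).
Local Notation m := (ncands I).

Variables (b k p : nat) (S : nat -> nat).

(** Memory consists of zones of U cells: input, suffix masks, representatives, then one table for
    each guess. Keys need only 2 ^ (n + m) cells; the factor 8 makes room for the input as well. *)
Let U := 2 ^ (n + m + 3).
Let h := n - 2 * b.
Let V := 2 ^ w.

Ltac bd := rewrite -?[2 ^ w]/V; do ?split => //; lia.

Definition colour (v e : nat) : nat := eta (set_of_mask n (S v - S e)).

Hypothesis b_lt : 2 * b < n.
Hypothesis p_lt : p < m.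
(** A word must accommodate the addresses of the last table zone and, by [sums_lt], sums of 3 ^ h
    entries of at most 8 ^ b each. *)
Hypothesis addresses_lt : ((n + 1) ^ 4 + 4) * U <= V.
Hypothesis sums_lt : 8 ^ b * 3 ^ h * 8 <= V.
Hypothesis bnd_poly : (n + m + 1) ^ 4 <= bnd false.
Hypothesis bnd_exp : 8 ^ b + 3 ^ h <= bnd true.

Lemma colour_lt v e : colour v e < m.
Proof. exact: ltn_ord. Qed.

Lemma U_ge : 8 * (n + m + 1) <= U.
Proof.
rewrite /U expnD mulnC leq_mul2r /=; have := ltn_expl (n + m) (ltnSn 1); lia.
Qed.

Lemma U_lt : 5 * U <= V.
Proof.
apply: leq_trans addresses_lt; apply: leq_mul => //.
have : 0 < (n + 1) ^ 4 by rewrite expn_gt0 addn1.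
lia.
Qed.

Record context (s : state) : Prop := Context {
  ctx_n : rg s rn = n;
  ctx_m : rg s rm = m;
  ctx_k : rg s rk = k;
  ctx_p : rg s rp = p;
  ctx_U : rg s rU = U;
  ctx_b2 : rg s rb2 = 2 * b;
  ctx_EL : rg s rEL = 8 ^ b;
  ctx_ER : rg s rER = 3 ^ h;
  ctx_h : rg s rh = h;
  ctx_S : forall i, i <= n -> mm s (U + i) = S i }.

Lemma context_keeps c s s' :
  all (fun r => r \notin writes c) [:: rn; rm; rk; rp; rU; rb2; rEL; rER; rh] ->
  storeless c -> keeps c s s' -> context s -> context s'.
Proof.
move=> /allP wr st [kr km] [*]; split; rewrite ?kr ?km //; exact: wr.
Qed.

Lemma tile_colour_ok s : context s -> rg s rv <= n -> rg s re <= n ->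
  WP tile_colour (fun s' => rg s' rcol = colour (rg s rv) (rg s re)) s.
Proof.
move=> C vn en; apply: wp_asn; rewrite /= (ctx_U C) ?(ctx_S C) //.
have := U_ge; have := U_lt; rewrite -/V; by do ?split => //; lia.
Qed.

Lemma left_tile_ok s : context s -> rg s rv <= n -> rg s re <= n ->
  rg s rJ <= n -> rg s rc <= n ->
  (colour (rg s rv) (rg s re) = rg s rqq -> rg s rkey + rg s rkey < V) ->
  (colour (rg s rv) (rg s re) = rg s rqq -> rg s rqq != rg s rq ->
     rg s rkey2 + rg s rkey2 < V) ->
  let hit := colour (rg s rv) (rg s re) == rg s rqq in
  WP left_tile (fun s' =>
    [/\ rg s' rJ = rg s rJ + 1,
        rg s' rch = if rg s re == rg s rch then rg s rv else rg s rch,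
        rg s' rok = if rg s re == rg s rch then rg s rok else 0 &
        [/\ rg s' rc = rg s rc + hit,
            rg s' rkey = rg s rkey * 2 ^ hit &
            rg s' rkey2 = rg s rkey2 * 2 ^ (hit && (rg s rqq != rg s rq))]]) s.
Proof.
move=> C vn en jn cn kV k2V hit; have UV := U_lt; have Ug := U_ge.
apply: wp_seq; apply: (wp_use (tile_colour_ok C vn en)) => s1 K1 e1.
apply: wp_seq; apply: wp_asn; first by rewrite /=; kp; bd.
apply: wp_seq; apply: (@wp_use _ _ (fun s2 =>
    rg s2 rch = (if rg s re == rg s rch then rg s rv else rg s rch) /\
    rg s2 rok = (if rg s re == rg s rch then rg s rok else 0))).
  apply: wp_ifeq => //= e; move: e; kp => e; apply: wp_asn => //=; kp.
    by rewrite e eqxx.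
  by case: eqP.
move=> s2 K2 [ech eok]; apply: wp_ifeq => //=; kp => /=; rewrite e1; kp => e.
  have he : hit by apply/eqP.
  apply: wp_seq; apply: wp_asn; first by rewrite /=; kp => /=; kp; bd.
  apply: wp_seq; apply: wp_asn; first by rewrite /=; kp => /=; kp; split=> //; apply: kV.
  apply: wp_ifeq => //=; kp => /=; kp => e'.
    apply: wp_skip => /=; rewrite ech eok; kp => /=; kp.
    by rewrite he -e' eqxx /= muln1 expn1 muln2 addnn.
  apply: wp_asn => /=; kp => /=; kp; first by split=> //; apply: k2V => //; apply/eqP.
  have -> : rg s rqq != rg s rq by apply/eqP.
  by rewrite ech eok he !expn1 !muln2 !addnn.
have -> : hit = false by apply/negbTE/eqP.
by apply: wp_skip; rewrite ech eok; kp => /=; kp; rewrite addn0 !muln1.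
Qed.

Fixpoint chain (r : nat * nat) (ts : seq tile) : nat * nat :=
  if ts is s :: ts' then chain (if s.2 == r.2 then (r.1, s.1) else (0, r.2)) ts' else r.

(** The chain checks contiguity only; that no tile is empty comes from being a family. *)
Lemma chain_tiling hi ok ts : family hi ts -> forall a,
  ((chain (ok, a) ts).1 != 0) && ((chain (ok, a) ts).2 == 0) = (ok != 0) && tiling a 0 ts.
Proof.
elim: ts hi ok => [|[v e] ts IH] hi ok //= /and3P[ve _ f] a.
by case: (e == a); rewrite (IH v) //= ?andbF // ve.
Qed.

Definition cnt2 (x q : nat) (ts : seq tile) : nat :=
  if q == x then 0 else cnt colour q ts.

Lemma left_scan_ok s : context s ->
  let q := rg s rqq in let ts := ltl b (rg s rz) in
  rg s rJ + size ts <= n -> rg s rc + cnt colour q ts <= n ->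
  rg s rkey * 2 ^ cnt colour q ts < V ->
  rg s rkey2 * 2 ^ cnt2 (rg s rq) q ts < V ->
  WP left_scan (fun s' =>
    [/\ rg s' rJ = rg s rJ + size ts,
        (rg s' rok, rg s' rch) = chain (rg s rok, rg s rch) ts,
        rg s' rc = rg s rc + cnt colour q ts,
        rg s' rkey = rg s rkey * 2 ^ cnt colour q ts &
        rg s' rkey2 = rg s rkey2 * 2 ^ cnt2 (rg s rq) q ts]) s.
Proof.
move=> C q ts jn cn kV k2V.
do 4![apply: wp_seq; apply: wp_asn; first by []].
rewrite /= (ctx_b2 C); set s0 := setr _ _ _.
(* What has been accumulated, together with what the tiles [rem] still to be decoded will add, is
   constant. *)
pose J (i : nat) (s1 : state) := let rem := ltiles i (rg s1 ry) (rg s1 rd) (rg s1 re) in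
  [/\ i <= rg s1 re <= n,
      rg s1 rJ + size rem = rg s rJ + size ts,
      chain (rg s1 rok, rg s1 rch) rem = chain (rg s rok, rg s rch) ts,
      rg s1 rc + cnt colour q rem = rg s rc + cnt colour q ts &
      rg s1 rkey * 2 ^ cnt colour q rem = rg s rkey * 2 ^ cnt colour q ts /\
      rg s1 rkey2 * 2 ^ cnt2 (rg s rq) q rem = rg s rkey2 * 2 ^ cnt2 (rg s rq) q ts].
have bn : 2 * b <= n by apply: ltnW.
have nb : n <= bnd false.
  by apply: leq_trans bnd_poly; rewrite -{1}(expn1 n); apply: (@leq_trans ((n + m + 1) ^ 1)); rewrite ?leq_pexp2l // ?expn1; lia.
apply: (@wp_loop _ _ _ _ false rv _ s0 _ J).
- exact: leq_trans bn nb.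
- by rewrite /J /s0 /= leqnn bn.
- move=> i s1 ilt K [/andP[ie en]]; set rem := ltiles _ _ _ _ => hJ hch hc [hk hk2].
  have C0 : context s0 by case: C.
  have C1 : context s1 by apply: context_keeps K C0.
  set y := if odd i then rg s1 ry %/ 8 else rg s1 ry.
  set d := if odd i then rg s1 ry %% 8 else rg s1 rd.
  apply: wp_seq; apply: (@wp_use _ _ (fun s2 =>
    [/\ rg s2 ry = y, rg s2 rd = d & rg s2 rsym = lsym i d])).
    apply: wp_if => //=; rewrite /y /d /lsym modn2.
      by case: (odd i).
    by case: (odd i).
  move=> s2 K2 [ey ed es].
  have C2 : context s2 by apply: (context_keeps _ _ K2) => //; case: C1.
  have remE : rem = if lsym i d == 0 then (i, rg s1 re) :: ltiles i y d i
    else ltiles i y d (if lsym i d == 1 then i else rg s1 re) by [].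
  rewrite {}remE {rem} in hJ hch hc hk hk2.
  have sym2 : lsym i d <= 2 by rewrite /lsym; case: (odd i); lia.
  apply: wp_if; rewrite /= ?es //.
    case: (lsym i d) sym2 es hJ hch hc hk hk2 => [|sym] //= sym2 es hJ hch hc hk hk2 _.
    apply: wp_ifeq => //=; rewrite es => e.
      apply: wp_asn => //=; rewrite /J /=; kp => /=.
      rewrite e eqxx in hJ hch hc hk hk2.
      by rewrite ey ed; split=> //; lia.
    apply: wp_skip; rewrite /J /=; kp => /=.
    have se : (sym.+1 == 1) = false by apply/eqP.
    rewrite se in hJ hch hc hk hk2.
    by rewrite ey ed; split=> //; lia.
  move=> sym0; rewrite sym0 eqxx /= in hJ hch hc hk hk2.
  apply: wp_seq; apply: (wp_use (left_tile_ok C2 _ _ _ _ _ _)).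
  + by kp => /=; lia.
  + by kp.
  + by kp => /=; lia.
  + by kp => /=; lia.
  + kp => /=; kp; rewrite -/q => /eqP hit; apply: leq_ltn_trans kV.
    by rewrite -hk hit /= expnS mulnA muln2 addnn leq_pmulr // expn_gt0.
  + kp => /=; kp; rewrite -/q => /eqP hit nx; apply: leq_ltn_trans k2V.
    by rewrite -hk2 /cnt2 (negbTE nx) /= hit /= expnS mulnA muln2 addnn leq_pmulr // expn_gt0.
  move=> s3 K3 [eJ ech eok [ec ek ek2]].
  apply: wp_asn => //=; rewrite /J /=; kp => /=; kp.
  rewrite eJ ech eok ec ek ek2; kp => /=; kp; rewrite -/q ey ed.
  split.
  + by rewrite leqnn; lia.
  + by rewrite -hJ; lia.
  + by rewrite -hch; case: eqP.
  + by rewrite -hc addnA.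
  + rewrite -hk -hk2 -!mulnA -!expnD; split=> //; congr (_ * 2 ^ _).
    by rewrite /cnt2 /=; case: (q == _); rewrite ?andbF ?andbT.
- move=> s1 K [_ hJ hch hc [hk hk2]].
  move: hJ hch hc hk hk2 => /=; rewrite !addn0 muln1 /cnt2 if_same expn0 muln1.
  by move=> <- <- <- <- <-.
Qed.

Lemma lt8 x : 8 * x < U -> x < V.
Proof. by have := U_lt; lia. Qed.

Lemma block_lt a x : 8 * ((a + a + 1) * 2 ^ x) < U -> a + a < V /\ a + a + 1 < V.
Proof.
move=> /lt8 lt; have {}lt : a + a + 1 < V.
  by apply: leq_ltn_trans lt; rewrite leq_pmulr // expn_gt0.
by split=> //; apply: ltn_trans lt; rewrite addn1.
Qed.

Lemma keyf_ge x i acc : acc <= keyf x i acc.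
Proof.
elim: i acc => //= i IH acc; apply: leq_trans (IH _).
have : 0 < 2 ^ x i by rewrite expn_gt0.
nia.
Qed.

Lemma key_lt (x : nat -> nat) : \sum_(q < m) x q <= n -> 8 * key m x < U.
Proof.
move=> le; rewrite /U addnC expnD ltn_pmul2l //.
apply: leq_trans (keyf_lt _ _ _) _; rewrite mul1n leq_exp2l //; lia.
Qed.

(** Accumulators only grow towards the finished key, so its bound excludes overflow within a
    block. *)
Lemma keyS_lt (x : nat -> nat) i acc : \sum_(q < m) x q <= n -> keyf x i.+1 acc = key m x ->
  8 * ((acc + acc + 1) * 2 ^ x i) < U.
Proof.
move=> /key_lt le e; apply: leq_ltn_trans le; rewrite leq_mul2l /= -e /=.
by apply: leq_trans (keyf_ge _ _ _); rewrite mul2n addnn.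
Qed.

Lemma sum_lcnt z : \sum_(q < m) lcnt colour b z q <= n.
Proof.
rewrite (sum_cnt colour_lt); apply: leq_trans (ltl_size _ _) _; exact: ltnW.
Qed.

Lemma sum_zero x (f : nat -> nat) : \sum_(q < m) zero x f q <= \sum_(q < m) f q.
Proof. by apply: leq_sum => q _; rewrite /zero; case: eqP. Qed.

Lemma small_bnd x : x <= n + m + 1 -> x <= bnd false.
Proof.
move=> le; apply: leq_trans bnd_poly; apply: leq_trans le _.
rewrite -{1}(expn1 (n + m + 1)); apply: leq_pexp2l => //; lia.
Qed.

Definition left_check (t j cp a z q : nat) : bool :=
  [&& tiling a 0 (ltl b z), size (ltl b z) == j &
      if q == p then lcnt colour b z q == cp else lcnt colour b z q <= t].

Lemma left_colour_ok s : context s ->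
  let z := rg s rz in let q := rg s rqq in let c := lcnt colour b z q in
  8 * ((rg s rkey + rg s rkey + 1) * 2 ^ c) < U ->
  8 * ((rg s rkey2 + rg s rkey2 + 1) * 2 ^ zero (rg s rq) (lcnt colour b z) q) < U ->
  WP left_colour (fun s' =>
    [/\ rg s' rkey = (2 * rg s rkey + 1) * 2 ^ c,
        rg s' rkey2 = (2 * rg s rkey2 + 1) * 2 ^ zero (rg s rq) (lcnt colour b z) q &
        (rg s' rok != 0) = (rg s rok != 0) &&
          left_check (rg s rt) (rg s rj) (rg s rcp) (rg s ra) z q]) s.
Proof.
move=> C z q c kb k2b.
have cn : c <= n.
  apply: leq_trans (ltnW b_lt); apply: leq_trans (ltl_size b z).
  exact: count_size.
have [k1 k2] := block_lt kb; have [k3 k4] := block_lt k2b.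
have c2 : cnt2 (rg s rq) q (ltl b z) = zero (rg s rq) (lcnt colour b z) q by [].
apply: wp_seq; apply: wp_asn; first by rewrite /= -/V; do ?split.
apply: wp_seq; apply: wp_asn; first by rewrite /= -/V; do ?split.
do 3![apply: wp_seq; apply: wp_asn => //].
rewrite /=; set s0 := setr _ rch _.
have C0 : context s0 by case: C.
apply: wp_seq; apply: (wp_use (left_scan_ok C0 _ _ _ _)); rewrite /= -/z -/q.
- by apply: leq_trans (ltnW b_lt); apply: ltl_size.
- exact: cn.
- exact: lt8 kb.
- exact: lt8 k2b.
move=> s1 K1 [eJ ech ec0 ek ek2].
have {ec0}ec : rg s1 rc = c by rewrite ec0.
have fam : family (2 * b) (ltl b z) by apply: ltiles_family.
have := chain_tiling (rg s rok) fam (rg s ra); rewrite -ech /= => chE.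
apply: wp_seq; apply: (@wp_use _ _ (fun s2 => (rg s2 rok != 0) =
    (rg s1 rok != 0) && (if q == p then c == rg s rcp else c <= rg s rt))).
  apply: wp_ifeq => //=; kp; rewrite /= (ctx_p C) => e.
    have -> : q == p by apply/eqP.
    apply: wp_ifeq => //=; rewrite ?ec /=; kp; rewrite /= => e'.
      by apply: wp_skip; rewrite e' eqxx andbT.
    by apply: wp_asn => //=; move/eqP/negbTE: e' => ->; rewrite andbF.
  have -> : (q == p) = false by apply/eqP.
  apply: wp_if => //=; rewrite ?ec /=; kp; rewrite /= => e'.
    by apply: wp_asn => //=; rewrite leqNgt -subn_gt0 e' andbF.
  by apply: wp_skip; rewrite -subn_eq0 e' andbT.
move=> s2 K2 ok2.
apply: wp_seq; apply: (@wp_use _ _ (fun s3 => (rg s3 rok != 0) =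
    (rg s2 rok != 0) && (rg s1 rch == 0))).
  apply: wp_if => //=; kp => e; first by apply: wp_asn => //=; rewrite (gtn_eqF e) andbF.
  by apply: wp_skip; rewrite e andbT.
move=> s3 K3 ok3.
apply: (@wp_use _ _ (fun s4 => (rg s4 rok != 0) =
    (rg s3 rok != 0) && (size (ltl b z) == rg s rj))).
  apply: wp_ifeq => //=; kp; rewrite eJ /=; kp => /= e.
    by apply: wp_skip; rewrite -e eqxx andbT.
  by apply: wp_asn => //=; move/eqP/negbTE: e => ->; rewrite andbF.
move=> s4 K4 ok4; split; kp.
- by rewrite ek mul2n addnn.
- by rewrite ek2 c2 mul2n addnn.
- rewrite ok4 ok3 ok2 /left_check -/(lcnt colour b z q) -/c.
  move: chE; case: (rg s1 rok != 0) => /=; case: (rg s1 rch == 0) => /=; rewrite ?andbF ?andbT /=;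
  case: (rg s rok != 0) => //= <- //=; by rewrite ?andbF // andbC.
Qed.

Lemma left_ok s : context s ->
  let z := rg s rz in
  WP left (fun s' =>
    [/\ rg s' rkey = key m (lcnt colour b z),
        rg s' rkey2 = key m (zero (rg s rq) (lcnt colour b z)) &
        (rg s' rok != 0) =
          lvalid colour m b p (rg s rt) (rg s rj) (rg s rcp) (rg s ra) z]) s.
Proof.
move=> C z.
do 4![apply: wp_seq; apply: wp_asn => //].
rewrite /= (ctx_m C); set s0 := setr _ _ _.
have C0 : context s0 by case: C.
set x := rg s rq.
pose J i s1 :=
  [/\ keyf (lcnt colour b z) i (rg s1 rkey) = key m (lcnt colour b z),
      keyf (zero x (lcnt colour b z)) i (rg s1 rkey2) = key m (zero x (lcnt colour b z)) &
      (rg s1 rok != 0) = all (left_check (rg s rt) (rg s rj) (rg s rcp) (rg s ra) z)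
        (iota i (m - i))].
apply: (@wp_loop _ _ _ _ false rqq _ s0 _ J).
- by apply: small_bnd; rewrite /s0 /=; lia.
- by rewrite /J /s0 /= subnn.
- move=> i s1 ilt K [hk hk2 hok].
  have C1 : context s1 by apply: context_keeps K C0.
  have C1' : context (setr s1 rqq i) by case: C1.
  have sz : \sum_(q < m) zero x (lcnt colour b z) q <= n.
    exact: leq_trans (sum_zero _ _) (sum_lcnt z).
  apply: (wp_use (left_colour_ok C1' _ _)) => /=; kp => /=.
  + exact: keyS_lt (sum_lcnt z) hk.
  + exact: keyS_lt sz hk2.
  + move=> s2 K2 [ek ek2 eok]; rewrite /J ek ek2 eok hok; split=> //.
    by rewrite -(subnSK ilt) /= andbC.
- move=> s1 K [hk hk2 hok]; split=> //; rewrite hok subn0 /lvalid /left_check.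
  apply/allP/and3P => [hall|[h1 h2 /allP h3] q qm]; last by rewrite h1 h2 h3.
  (* Tests that do not depend on the colour are repeated in each round; the round of p witnesses
     them. *)
  have /and3P[h1 h2 _] : left_check (rg s rt) (rg s rj) (rg s rcp) (rg s ra) z p.
    by apply: hall; rewrite mem_iota.
  by split=> //; apply/allP => q /hall /and3P[].
Qed.

(** * Scanning the right half *)

Fixpoint late_marks (q mk : nat) (ts : seq (tile * bool)) : bool :=
  if ts is (s, marked) :: ts' then
    if colour s.1 s.2 == q then
      if marked then late_marks q mk.+1 ts' else (mk == 0) && late_marks q mk ts'
    else late_marks q mk ts'
  else true.

(** The program rejects an unmarked tile that comes after a marked one of its colour. This is
    [canon] read forwards: once a mark has been seen, all remaining tiles of the colour must be
    marked. *)
Lemma late_marksE q mk ts :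
  late_marks q mk ts =
  if mk == 0 then canon colour q ts else mcnt colour q ts == cnt colour q (unzip1 ts).
Proof.
elim: ts mk => [|[s marked] ts IH] mk /=; first by rewrite if_same.
have le := mcnt_le colour q ts.
case: (colour _ _ == q) => /=; last by rewrite IH.
case: marked => /=; rewrite IH /=.
  case: mk => [|mk] //=; case: eqP => //= e; first by rewrite canon_full.
case: mk => [|mk] //=; apply/esym/eqP; lia.
Qed.

Lemma right_tile_ok s : context s -> rg s rv <= n -> rg s re <= n ->
  rg s rJ <= n -> rg s rc <= n -> rg s rmk <= n -> 0 < rg s rd < 3 ->
  let hit := colour (rg s rv) (rg s re) == rg s rqq in
  let marked := rg s rd == 2 in
  WP right_tile (fun s' =>
    [/\ rg s' rJ = rg s rJ + 1,
        rg s' rc = rg s rc + hit,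
        rg s' rmk = rg s rmk + (hit && marked) &
        rg s' rok = if [&& hit, ~~ marked & rg s rmk != 0] then 0 else rg s rok]) s.
Proof.
move=> C vn en jn cn mn dlt hit marked; have UV := U_lt; have Ug := U_ge.
apply: wp_seq; apply: (wp_use (tile_colour_ok C vn en)) => s1 K1 e1.
apply: wp_seq; apply: wp_asn; first by rewrite /=; kp; bd.
apply: wp_ifeq => //=; rewrite e1; kp => e; last first.
  have -> : hit = false by apply/negbTE/eqP.
  by apply: wp_skip => /=; kp; rewrite !addn0.
have -> : hit by apply/eqP.
apply: wp_seq; apply: wp_asn; first by rewrite /=; kp; bd.
rewrite /marked; apply: wp_if => //=; kp => e2.
  have -> : rg s rd == 2 by lia.
  apply: wp_asn; first by rewrite /=; kp; bd.
  by rewrite /=; kp.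
have -> : (rg s rd == 2) = false by lia.
apply: wp_if => //=; kp => e3.
  by apply: wp_asn => //=; kp; rewrite -lt0n e3 addn0.
by apply: wp_skip; rewrite e3 /=; kp; rewrite !addn0.
Qed.

Lemma right_scan_ok s : context s -> rg s ra <= n ->
  let q := rg s rqq in let ts := rtiles b (rg s ra) h (rg s rz) n in
  rg s rJ = 0 -> rg s rc = 0 -> rg s rmk = 0 ->
  WP right_scan (fun s' =>
    [/\ rg s' rJ = size ts, rg s' rc = cnt colour q (unzip1 ts),
        rg s' rmk = mcnt colour q ts,
        (rg s' rok != 0) = (rg s rok != 0) && canon colour q ts &
        rg s' re = leftmost n (unzip1 ts)]) s.
Proof.
move=> C an q ts j0 c0 mk0.
do 3![apply: wp_seq; apply: wp_asn => //].
rewrite /= (ctx_n C) (ctx_h C); set s0 := setr _ _ _.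
have C0 : context s0 by case: C.
pose J (i : nat) (s1 : state) := let rem := rtiles b (rg s ra) i (rg s1 ry) (rg s1 re) in
  [/\ i <= h /\ rg s1 re <= n,
      rg s1 rJ + size rem = size ts,
      rg s1 rc + cnt colour q (unzip1 rem) = cnt colour q (unzip1 ts),
      rg s1 rmk + mcnt colour q rem = mcnt colour q ts &
      (rg s1 rok != 0) && late_marks q (rg s1 rmk) rem = (rg s rok != 0) && late_marks q 0 ts
      /\ leftmost (rg s1 re) (unzip1 rem) = leftmost n (unzip1 ts)].
have sts : size ts <= h.
  rewrite /ts; elim: (h) (rg s rz) (n) => //= i IH y e.
  by case: ifP => _ /=; rewrite ?ltnS ?IH // leqW.
have hn : h <= n by apply: leq_subr.
have cts : cnt colour q (unzip1 ts) <= size ts by rewrite -(size_map fst ts); apply: count_size.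
have mts := mcnt_le colour q ts.
apply: (@wp_loop _ _ _ _ false ri _ s0 _ J).
- by apply: small_bnd; rewrite /s0 /=; lia.
- by rewrite /J /s0 /= j0 c0 mk0; split.
- move=> i s1 ilt K [[ih en]]; set rem := rtiles _ _ _ _ _ => hJ hc hmk [hok hlm].
  have C1 : context s1 by apply: context_keeps K C0.
  set d := rg s1 ry %% 3; set y := rg s1 ry %/ 3.
  have remE : rem = if d == 0 then rtiles b (rg s ra) i y (rg s1 re)
    else ((rstart b (rg s ra) i, rg s1 re), d == 2)
           :: rtiles b (rg s ra) i y (rstart b (rg s ra) i) by [].
  rewrite {}remE {rem} in hJ hc hmk hok hlm.
  do 2![apply: wp_seq; apply: wp_asn => //].
  apply: wp_if => //=; rewrite -/d -/y => d0; last first.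
    apply: wp_skip; rewrite /J /= -/y; move: hJ hc hmk hok hlm; rewrite d0 /=.
    by move=> *; split=> //; split=> //; exact: ltnW.
  rewrite (gtn_eqF d0) /= in hJ hc hmk hok hlm.
  set s2 := setr _ ry y.
  have d3 : d < 3 by rewrite ltn_mod.
  have stn : rstart b (rg s ra) i <= n by rewrite /rstart; case: eqP => // _; lia.
  have C2 : context s2 by case: C1.
  apply: wp_seq; apply: (@wp_use _ _ (fun s3 => rg s3 rv = rstart b (rg s ra) i)).
    have UV := U_lt; have Ug := U_ge; have Cb := ctx_b2 C1.
    apply: wp_if => //= i0.
      apply: wp_asn => //=; first by rewrite Cb; bd.
      by rewrite Cb /rstart gtn_eqF.
    by apply: wp_asn => //=; kp; rewrite /rstart i0.
  move=> s3 K3 ev3.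
  have C3 : context s3 by apply: (context_keeps _ _ K3).
  apply: wp_seq; apply: (wp_use (right_tile_ok C3 _ _ _ _ _ _)).
  + by rewrite ev3.
  + by kp.
  + by kp; rewrite /s2 /=; lia.
  + by kp; rewrite /s2 /=; lia.
  + by kp; rewrite /s2 /=; lia.
  + by kp; rewrite /s2 /= d0.
  move=> s4 K4 [eJ ec emk eok].
  apply: wp_asn => //; rewrite /J /=; move: eJ ec emk eok; kp; rewrite ev3 /s2 /= -/d.
  kp; rewrite -/q => -> -> -> ->.
  split.
  + by split=> //; exact: ltnW.
  + by rewrite -hJ addn1 addSnnS.
  + by rewrite -hc addnA.
  + by rewrite -hmk addnA.
  + split=> //; rewrite -hok.
    case: (colour _ _ == q) => /=; last by rewrite addn0.
    case: (d == 2) => /=; first by rewrite addn1.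
    by rewrite addn0; case: (rg s1 rmk) => [|mk] //=; rewrite andbF.
- move=> s1 K [_ hJ hc hmk [hok hlm]].
  move: hJ hc hmk hok hlm; rewrite /= !addn0 andbT => -> -> -> -> ->.
  by rewrite late_marksE.
Qed.

(** The key has a 1 for each of the c blocks begun so far and at most min(rtot, n) zeros, hence at
    most n + m bits even for vectors that will be rejected. *)
Lemma shift_key_ok s c : context s -> rg s rt <= n -> c <= m ->
  let x := rg s rt + 1 - rg s rmk in
  rg s rtot + x <= m * (n + 1) -> rg s rkey < 2 ^ (c + minn (rg s rtot) n) ->
  WP shift_key (fun s' =>
    [/\ rg s' rtot = rg s rtot + x,
        rg s' rtot <= n -> rg s' rkey = rg s rkey * 2 ^ x &
        rg s' rkey < 2 ^ (c + minn (rg s' rtot) n)]) s.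
Proof.
move=> C tn cm x tx kb.
have U8 : 2 ^ (n + m) * 8 = U by rewrite /U [in RHS]expnD.
have PV : 2 ^ (n + m) * 2 < V by have := U_lt; have := U_ge; move: U8; clear; lia.
have tV : rg s rtot + x < V.
  apply: leq_ltn_trans PV; apply: leq_trans tx _; rewrite -[X in X <= _]muln1 leq_mul //.
  rewrite mulnC expnD leq_mul //; last exact/ltnW/ltn_expl.
  by rewrite addn1; apply: ltn_expl.
have tV1 : rg s rt + 1 < V.
  by have := U_lt; have := U_ge; move: tn; clear; lia.
have xn : x <= n + m + 1 by rewrite /x; move: tn; clear; lia.
apply: wp_seq; apply: wp_asn; first by rewrite /= -/V; do ?split.
rewrite /=; set s0 := setr _ _ _.
have C0 : context s0 by case: C.
pose J i s1 :=
  [/\ rg s1 rtot + i = rg s rtot + x,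
      rg s rtot + x <= n -> rg s1 rkey * 2 ^ i = rg s rkey * 2 ^ x &
      rg s1 rkey < 2 ^ (c + minn (rg s1 rtot) n)].
apply: (@wp_loop _ _ _ _ false rx _ s0 _ J).
- exact: small_bnd.
- by [].
- move=> i s1 ilt K [ht hk hb].
  have C1 : context s1 by apply: context_keeps K C0.
  have ht' : rg s1 rtot + 1 + i = rg s rtot + x by rewrite -ht -addnA add1n.
  have t1V : rg s1 rtot + 1 < V.
    by apply: leq_ltn_trans tV; rewrite -ht' leq_addr.
  apply: wp_seq; apply: wp_asn; first by rewrite /= -/V; do ?split.
  apply: wp_if => //=; rewrite (ctx_n C1) => e.
    apply: wp_skip; rewrite /J /=; split=> //.
      by move: e ht'; clear; lia.
    by apply: leq_trans hb _; rewrite leq_exp2l // leq_add2l; clear; lia.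
  have tlt : rg s1 rtot < n by move: e; clear; lia.
  have m1 : minn (rg s1 rtot) n = rg s1 rtot by apply/minn_idPl/ltnW.
  have m2 : minn (rg s1 rtot + 1) n = rg s1 rtot + 1 by apply/minn_idPl; rewrite addn1.
  have kU : 2 ^ (c + rg s1 rtot) <= 2 ^ (n + m).
    by rewrite leq_exp2l // addnC leq_add // ltnW.
  rewrite m1 in hb.
  have kV : rg s1 rkey + rg s1 rkey < V by move: hb kU PV; clear; lia.
  apply: wp_asn; first by rewrite /= -/V; do ?split.
  rewrite /J /= m2; split=> //.
    by move=> h1; rewrite -(hk h1) expnS mulnA muln2 addnn.
  by rewrite addnA addn1 expnS; move: hb; clear; lia.
- move=> s1 K [ht hk hb]; rewrite addn0 in ht; split=> //.
  by rewrite ht => /hk; rewrite muln1.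
Qed.

Definition right_check (t j cp a q : nat) (ts : seq (tile * bool)) : bool :=
  [&& leftmost n (unzip1 ts) == a, size ts + j == k &
      (if q == p then (cnt colour q (unzip1 ts) + cp == t.+1) && (mcnt colour q ts == 0)
       else cnt colour q (unzip1 ts) <= t) && canon colour q ts].

Lemma small_lt x : x <= 4 * (n + m + 1) -> x < V.
Proof. by have := U_lt; have := U_ge; lia. Qed.

Lemma size_rtiles a i y e : size (rtiles b a i y e) <= i.
Proof. by elim: i y e => //= i IH y e; case: ifP => _ /=; rewrite ?ltnS ?IH // leqW. Qed.

Lemma right_colour_ok s c : context s -> rg s ra <= n -> rg s rt <= n -> rg s rcp <= n ->
  rg s rj <= n -> rg s rsg <= 1 -> c < m ->
  let q := rg s rqq in let ts := rtiles b (rg s ra) h (rg s rz) n in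
  let x := rvec colour p (rg s rt) ts q in
  rg s rtot + x <= m * (n + 1) -> rg s rkey < 2 ^ (c + minn (rg s rtot) n) ->
  WP right_colour (fun s' =>
    [/\ rg s' rtot = rg s rtot + x,
        rg s' rtot <= n -> rg s' rkey = (2 * rg s rkey + 1) * 2 ^ x,
        rg s' rkey < 2 ^ (c.+1 + minn (rg s' rtot) n),
        rg s' rsg = (if (q != p) && (mcnt colour q ts != 0) then 1 - rg s rsg else rg s rsg) &
        (rg s' rok != 0) = (rg s rok != 0) &&
          right_check (rg s rt) (rg s rj) (rg s rcp) (rg s ra) q ts]) s.
Proof.
move=> C an tn cpn jn sg1 cm q ts x totb kb; have UV := U_lt; have Ug := U_ge.
have U8 : 2 ^ (n + m) * 8 = U by rewrite /U [in RHS]expnD.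
have kU : 2 ^ (c + minn (rg s rtot) n) <= 2 ^ (n + m).
  by rewrite leq_exp2l //; have := geq_minr (rg s rtot) n; lia.
have sts : size ts <= n by apply: leq_trans (size_rtiles _ _ _ _) (leq_subr _ _).
have cts : cnt colour q (unzip1 ts) <= n.
  by apply: leq_trans sts; rewrite -(size_map fst ts); apply: count_size.
apply: wp_seq; apply: wp_asn; first by rewrite /=; bd.
do 3![apply: wp_seq; apply: wp_asn => //].
rewrite /=; set s0 := setr _ rJ _.
have C0 : context s0 by case: C.
apply: wp_seq; apply: (wp_use (right_scan_ok C0 _ _ _ _)) => //.
rewrite /= -/q -/ts => s1 K1 [eJ ec emk eok ere].
have C1 : context s1 by apply: (context_keeps _ _ K1).
have kb1 : rg s rkey + rg s rkey + 1 < 2 ^ (c.+1 + minn (rg s rtot) n).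
  by rewrite addSn expnS; lia.
set ok2 := if q == p then (cnt colour q (unzip1 ts) + rg s rcp == (rg s rt).+1)
   && (mcnt colour q ts == 0) else cnt colour q (unzip1 ts) <= rg s rt.
apply: wp_seq; apply: (@wp_use _ _ (fun s2 =>
  [/\ rg s2 rtot = rg s rtot + x,
      rg s2 rtot <= n -> rg s2 rkey = (2 * rg s rkey + 1) * 2 ^ x,
      rg s2 rkey < 2 ^ (c.+1 + minn (rg s2 rtot) n),
      rg s2 rsg = (if (q != p) && (mcnt colour q ts != 0) then 1 - rg s rsg else rg s rsg) &
      (rg s2 rok != 0) = (rg s1 rok != 0) && ok2])).
  apply: wp_ifeq => //=; kp; rewrite /= (ctx_p C) -/q => e.
    have x0 : x = 0 by rewrite /x /rvec -e eqxx.
    have qp : q == p by apply/eqP.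
    rewrite /ok2 qp x0 /= addn0 muln1.
    apply: wp_ifeq => //=; kp; rewrite ?ec ?emk /=; first by bd.
    - by bd.
    - move=> e1; have -> : cnt colour q (unzip1 ts) + rg s rcp == (rg s rt).+1.
        by rewrite e1 addn1.
      apply: wp_if => //=; kp; rewrite emk => mk0.
        apply: wp_asn => //=; kp; rewrite /= (gtn_eqF mk0) andbF mul2n -addnn.
        by split.
      apply: wp_skip; kp; rewrite /= mk0 eqxx andbT mul2n -addnn; by split.
    - move=> e1; have -> : (cnt colour q (unzip1 ts) + rg s rcp == (rg s rt).+1) = false.
        by apply/eqP => e2; apply: e1; rewrite e2 addn1.
      by apply: wp_asn => //=; kp; rewrite /= andbF mul2n -addnn; split.
  have qp : (q == p) = false by apply/eqP.
  rewrite /ok2 qp /=.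
  apply: wp_seq; apply: (@wp_use _ _ (fun s2 =>
     (rg s2 rok != 0) = (rg s1 rok != 0) && (cnt colour q (unzip1 ts) <= rg s rt))).
    apply: wp_if => //=; kp; rewrite ec /= => e1.
      by apply: wp_asn => //=; rewrite leqNgt -subn_gt0 e1 andbF.
    by apply: wp_skip; rewrite -subn_eq0 e1 andbT.
  move=> s2 K2 eok2.
  have C2 : context s2 by apply: (context_keeps _ _ K2).
  apply: wp_if => //=; kp; rewrite emk => mk0; last first.
    have x0 : x = 0 by rewrite /x /rvec mk0 eqxx orbT.
    by apply: wp_skip; kp; rewrite /= mk0 x0 addn0 muln1 mul2n -addnn eok2; split.
  have x0 : x = rg s rt + 1 - mcnt colour q ts.
    by rewrite /x /rvec qp (gtn_eqF mk0) addn1.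
  rewrite -lt0n mk0.
  apply: wp_seq; apply: wp_asn => //; set s3 := setr _ _ _.
  have C3 : context s3 by case: C2.
  apply: (wp_use (@shift_key_ok s3 c.+1 C3 _ _ _ _)).
  + by rewrite /s3 /=; kp.
  + by [].
  + by rewrite /s3 /=; kp; rewrite emk /= -x0.
  + by rewrite /s3 /=; kp.
  move=> s4 K4; rewrite {1 2 3 4 5 6}/s3 /=; kp; rewrite emk /= -x0 => -[et ek ekb].
  split=> //.
  + by move/ek => ->; rewrite mul2n -addnn.
  + by rewrite /s3 /=; kp.
move=> s2 K2 [et ek ekb esg eok2].
apply: wp_seq; apply: (@wp_use _ _ (fun s3 => (rg s3 rok != 0) =
    (rg s2 rok != 0) && (leftmost n (unzip1 ts) == rg s ra))).
  apply: wp_ifeq => //=; kp; rewrite ere /= => e.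
    by apply: wp_skip; rewrite e eqxx andbT.
  by apply: wp_asn => //=; move/eqP/negbTE: e => ->; rewrite andbF.
move=> s3 K3 ok3.
apply: (@wp_use _ _ (fun s4 => (rg s4 rok != 0) =
    (rg s3 rok != 0) && (size ts + rg s rj == k))).
  apply: wp_ifeq => //=; kp; rewrite eJ /= ?(ctx_k C).
  - by do ?split => //; apply: small_lt; move: sts jn; clear; lia.
  - by move=> e; apply: wp_skip; rewrite e eqxx andbT.
  - by move=> e; apply: wp_asn => //=; move/eqP/negbTE: e => ->; rewrite andbF.
move=> s4 K4 ok4; kp; split=> //.
rewrite ok4 ok3 eok2 eok /right_check -/ok2.
by case: (_ != 0); case: canon; case: (_ == rg s ra); case: (_ == k); case: (ok2).
Qed.

Definition params (s : state) : Prop :=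
  [/\ rg s rt <= n, rg s rj <= n, rg s rcp <= n & rg s ra <= n].

Lemma params_keeps c s s' : all (fun r => r \notin writes c) [:: rt; rj; rcp; ra] ->
  keeps c s s' -> params s -> params s'.
Proof.
move=> /allP wr [kr _] [p1 p2 p3 p4].
by split; rewrite kr //; apply: wr; rewrite !inE.
Qed.

Lemma rvec_le t ts q : rvec colour p t ts q <= t.+1.
Proof. by rewrite /rvec; case: ifP => // _; apply: leq_subr. Qed.

Lemma right_ok s : context s -> params s ->
  let t := rg s rt in let ts := rtiles b (rg s ra) h (rg s rz) n in
  let x := rvec colour p t ts in
  WP right (fun s' =>
    [/\ (rg s' rok != 0) = rvalid colour m p t (rg s rj) (rg s rcp) (rg s ra) n k ts
          && (\sum_(q < m) x q <= n),
        \sum_(q < m) x q <= n -> rg s' rkey = key m x &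
        rg s' rsg = odd (rsign colour m p ts)]) s.
Proof.
move=> C [tn jn cpn an] t ts x.
have UV := U_lt; have Ug := U_ge.
do 5![apply: wp_seq; apply: wp_asn => //].
rewrite /= (ctx_m C); set s0 := setr _ _ _.
have C0 : context s0 by case: C.
pose sg (q : nat) : nat := (q != p) && (mcnt colour q ts != 0).
pose T := \sum_(q < m) x q.
have Tb : T <= m * (n + 1).
  apply: (@leq_trans (\sum_(q < m) (n + 1))); last by rewrite sum_nat_const card_ord.
  apply: leq_sum => q _.
  by apply: leq_trans (rvec_le _ _ _) _; rewrite addn1 ltnS.
pose J i s1 :=
  [/\ rg s1 rtot + \sum_(q < i) x q = T,
      T <= n -> keyf x i (rg s1 rkey) = key m x,
      rg s1 rkey < 2 ^ (m - i + minn (rg s1 rtot) n),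
      rg s1 rsg = odd (rsign colour m p ts) (+) odd (\sum_(q < i) sg q) &
      (rg s1 rok != 0) = all (fun q => right_check t (rg s rj) (rg s rcp) (rg s ra) q ts)
        (iota i (m - i))].
apply: wp_seq; apply: (@wp_loop _ _ _ _ false rqq _ s0 _ J).
- by apply: small_bnd; rewrite /s0 /=; move: Ug; clear; lia.
- by rewrite /J /s0 /= subnn min0n /rsign addbb; split.
- move=> i s1 ilt K [ht hk hb hsg hok].
  have C1 : context s1 by apply: context_keeps K C0.
  have C1' : context (setr s1 rqq i) by case: C1.
  have e11 : rg s1 rt = t by kp.
  have e12 : rg s1 rj = rg s rj by kp.
  have e13 : rg s1 rcp = rg s rcp by kp.
  have e14 : rg s1 ra = rg s ra by kp.
  have e17 : rg s1 rz = rg s rz by kp.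
  have im : m - i.+1 < m by rewrite -subSn ?leq_subr // subSS leq_subr.
  rewrite big_ord_recr /= in ht; rewrite big_ord_recr /= in hsg.
  apply: (wp_use (@right_colour_ok _ (m - i.+1) C1' _ _ _ _ _ im _ _)) => /=;
    rewrite ?e11 ?e12 ?e13 ?e14 ?e17 //.
  + by rewrite hsg; case: (_ (+) _).
  + rewrite -/ts -/x; apply: leq_trans Tb; by rewrite -ht leq_add2l leq_addl.
  rewrite -/ts -/x => s2 K2 [et ek ekb esg eok]; rewrite /J.
  have mi : (m - i.+1).+1 = m - i by rewrite subnSK.
  rewrite mi in ekb; split=> //.
  + by rewrite et -ht -addnA [x i + _]addnC.
  + move=> Tn; rewrite ek; first by rewrite -hk.
    by apply: leq_trans Tn; rewrite et -ht leq_add2l leq_addl.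
  + rewrite esg hsg oddD /sg; case: (_ && _) => /=; last by rewrite addbF.
    by case: odd; case: odd.
  + by rewrite eok hok -mi /= andbC.
- move=> s1 K [ht hk hb hsg hok].
  have C1 : context s1 by apply: context_keeps K C0.
  rewrite big_ord0 addn0 in ht; rewrite big_ord0 addbF in hsg.
  have rv : rvalid colour m p t (rg s rj) (rg s rcp) (rg s ra) n k ts = (rg s1 rok != 0).
    rewrite hok subn0 /rvalid; apply/and3P/allP => [[h1 h2 /allP h3] q qm|hall].
      by rewrite /right_check h1 h2 h3.
    have /and3P[h1 h2 _] : right_check t (rg s rj) (rg s rcp) (rg s ra) p ts.
      by apply: hall; rewrite mem_iota.
    by split=> //; apply/allP => q /hall /and3P[].
  rewrite rv -/T; apply: wp_if => //=; rewrite (ctx_n C1) ht => e.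
    apply: wp_asn => //=; split=> //.
    by rewrite leqNgt -subn_gt0 e andbF.
  apply: wp_skip; split=> //.
  by rewrite -subn_eq0 e andbT.
Qed.

(** * The table: filling, transforming and summing up *)

Definition outside (E : nat) (s s' : state) : Prop :=
  forall addr, ~~ (2 * U <= addr < 3 * U) -> ~~ (E <= addr < E + U) ->
  mm s' addr = mm s addr.

Lemma outside_trans E s1 s2 s3 : outside E s1 s2 -> outside E s2 s3 -> outside E s1 s3.
Proof. by move=> o1 o2 x h1 h2; rewrite o2 ?o1. Qed.

Lemma outside_put E s a x : (2 * U <= a < 3 * U) || (E <= a < E + U) ->
  outside E s (setm s a x).
Proof.
move=> ha addr h1 h2 /=; case: eqP => // e; move: ha h1 h2; rewrite e.
by case: (_ && _); case: (_ && _).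
Qed.

Lemma context_outside E c s s' :
  all (fun r => r \notin writes c) [:: rn; rm; rk; rp; rU; rb2; rEL; rER; rh] ->
  keeps c s s' -> 3 * U <= E -> outside E s s' -> context s -> context s'.
Proof.
move=> /allP wr [kr _] EU o [*]; split; rewrite ?kr //; try exact: wr.
by move=> i iN; have Ug := U_ge; rewrite o; auto; move: Ug EU iN; clear; lia.
Qed.

Local Notation vec := (lcnt colour b).

Lemma key_vec_lt z : 8 * key m (vec z) < U.
Proof. exact: key_lt (sum_lcnt z). Qed.

Lemma key_zero_lt q z : 8 * key m (zero q (vec z)) < U.
Proof. by apply: key_lt; apply: leq_trans (sum_zero _ _) (sum_lcnt z). Qed.

Lemma fits_key x c : fits m m x c = (key m x == key m c).
Proof.
apply/fitsP/eqP => [hx|/keyf_inj[_ hx] r rm]; last by left; apply: hx.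
apply: eq_keyf => r rm; case: (hx r rm) => // -[mr _].
by move: (leq_trans rm mr); rewrite ltnn.
Qed.

Lemma pow8_lt : 8 ^ b < V.
Proof.
apply: leq_trans sums_lt; have : 0 < 3 ^ h by rewrite expn_gt0.
have : 0 < 8 ^ b by rewrite expn_gt0.
by move: (8 ^ b) (3 ^ h) => x y; clear; nia.
Qed.

Definition representing (s : state) : Prop := forall z, z < 8 ^ b ->
  mm s (2 * U + key m (vec z)) < 8 ^ b /\
  key m (vec (mm s (2 * U + key m (vec z)))) = key m (vec z).

Definition table (E t j cp a i : nat) (s : state) : Prop := forall x, key m x < U ->
  mm s (E + key m x) = entry colour m b p t j cp a i x.

Lemma fill_ok s E : 3 * U <= E -> E + U <= V -> context s -> params s -> rg s rE = E ->
  (forall kappa, kappa < U -> mm s (E + kappa) = 0) ->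
  WP fill (fun s' => [/\ outside E s s', representing s' &
    table E (rg s rt) (rg s rj) (rg s rcp) (rg s ra) m s']) s.
Proof.
move=> EU EV C P eE fresh.
apply: wp_seq; apply: wp_asn => //; rewrite /= (ctx_EL C); set s0 := setr _ _ _.
have C0 : context s0 by case: C.
pose valid z := lvalid colour m b p (rg s rt) (rg s rj) (rg s rcp) (rg s ra) z.
(* Only the codes from i on have been entered, among the representatives as well as in the
   counts. *)
pose J i s1 :=
  [/\ i <= 8 ^ b, outside E s s1,
      forall z, i <= z < 8 ^ b ->
        i <= mm s1 (2 * U + key m (vec z)) < 8 ^ b /\
        key m (vec (mm s1 (2 * U + key m (vec z)))) = key m (vec z) &
      forall x, key m x < U -> mm s1 (E + key m x) =
        \sum_(i <= z < 8 ^ b) (valid z && fits m m x (vec z))].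
apply: (@wp_loop _ _ _ _ true rz _ s0 _ J).
- by apply: leq_trans bnd_exp; apply: leq_addr.
- split=> //; first by move=> z; rewrite leqNgt; case: (z < _).
  by move=> x xU; rewrite fresh // big_geq.
- move=> i s1 ilt K [_ hout hrep htab].
  have hout0 : outside E s0 s1 := hout.
  have C1 : context s1 by apply: (context_outside _ K EU hout0).
  have C1' : context (setr s1 rz i) by case: C1.
  apply: wp_seq; apply: (wp_use (left_ok C1')) => /= s2 K2 [ek _ eok].
  have C2 : context s2 by apply: (context_keeps _ _ K2).
  have e11 : rg s1 rt = rg s rt by kp.
  have e12 : rg s1 rj = rg s rj by kp.
  have e13 : rg s1 rcp = rg s rcp by kp.
  have e14 : rg s1 ra = rg s ra by kp.
  rewrite e11 e12 e13 e14 -/(valid i) in eok.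
  have kU := key_vec_lt i; have UV := U_lt.
  have k1 : key m (vec i) < U by move: kU; clear; lia.
  have rz2 : rg s2 rz = i by kp.
  have rE2 : rg s2 rE = E by kp => /=; kp; exact: eE.
  have m2 : mm s2 = mm s1 by kp.
  set a1 := 2 * U + key m (vec i).
  apply: wp_seq; apply: wp_put => //=.
    by rewrite ek (ctx_U C2) -/V; move: kU UV; clear; move=> *; do ?split => //; lia.
  rewrite ek (ctx_U C2) rz2 addnn -mul2n -/a1.
  set s3 := setm s2 a1 i.
  have a1U : 2 * U <= a1 < 3 * U by rewrite /a1; move: k1; clear; lia.
  have hout3 : outside E s s3.
    apply: outside_trans hout _; rewrite /s3.
    by move=> addr h1 h2; rewrite -m2; apply: outside_put h1 h2; rewrite a1U.
  have hrep3 z : i <= z < 8 ^ b -> i <= mm s3 (2 * U + key m (vec z)) < 8 ^ b /\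
        key m (vec (mm s3 (2 * U + key m (vec z)))) = key m (vec z).
    move=> /andP[iz zZ]; rewrite /s3 /= /a1 eqn_add2l; case: eqP => [->|ne].
      by rewrite leqnn ilt.
    have iz' : i < z by rewrite ltn_neqAle iz andbT; apply/eqP => e; apply: ne; rewrite e.
    rewrite m2; have [|/andP[r1 r2] r3] := hrep z; first by rewrite iz'.
    by rewrite (ltnW r1) r2.
  have htab3 x : key m x < U -> mm s3 (E + key m x) =
      \sum_(i.+1 <= z < 8 ^ b) (valid z && fits m m x (vec z)).
    move=> xU; rewrite /s3 /= ifF ?m2 ?htab //.
    by apply/negbTE; move: a1U EU; clear; lia.
  have Zb x : \sum_(i <= z < 8 ^ b) (valid z && fits m m x (vec z)) <= 8 ^ b.
    apply: (@leq_trans (\sum_(i <= z < 8 ^ b) 1)).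
      by apply: leq_sum => z _; apply: leq_b1.
    by rewrite sum_nat_const_nat muln1 leq_subr.
  have sumE x : \sum_(i <= z < 8 ^ b) (valid z && fits m m x (vec z)) =
      (valid i && fits m m x (vec i)) + \sum_(i.+1 <= z < 8 ^ b) (valid z && fits m m x (vec z)).
    by rewrite big_ltn.
  apply: wp_if => //=; rewrite ?lt0n ?eok => vi.
    have Eek : rg s2 rE + rg s2 rkey = E + key m (vec i) by rewrite rE2 ek.
    have fi : fits m m (vec i) (vec i) by rewrite fits_key.
    apply: wp_put => /=; rewrite ?Eek.
    - by split=> //; rewrite -/V; move: k1 EV; clear; lia.
    - have := Zb (vec i); rewrite sumE vi fi /= -htab3 // => le.
      split=> //; first by split=> //; rewrite -/V; move: k1 EV; clear; lia.
      by rewrite -/V; apply: leq_ltn_trans pow8_lt; rewrite addnC.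
    set s4 := setm _ _ _.
    have m4 y : mm s4 y = if y == E + key m (vec i) then mm s3 (E + key m (vec i)) + 1
        else mm s3 y by [].
    split; first exact: ltnW.
    - apply: outside_trans hout3 _; apply: outside_put.
      by apply/orP; right; move: k1; clear; lia.
    - move=> z zi; rewrite m4 ifF; first exact: hrep3.
      by apply/negbTE; have := key_vec_lt z; move: EU; clear; lia.
    - move=> x xU; rewrite m4 eqn_add2l sumE vi andTb.
      rewrite fits_key; case: eqP => [e|_]; last by rewrite add0n htab3.
      rewrite htab3 // addnC; congr (_ + _).
      by apply: eq_bigr => z _; rewrite !fits_key e.
  have vi' : valid i = false by rewrite -eok; apply/negbTE; rewrite negbK; apply/eqP.
  apply: wp_skip; split=> //; first exact: ltnW.
  by move=> x xU; rewrite sumE vi' add0n htab3.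
- by move=> s1 K [_ hout hrep htab]; split.
Qed.

(** The representatives are consulted throughout the transform and must stay fixed, which [outside]
    would not ensure. *)
Definition private (E : nat) (s s' : state) : Prop :=
  forall addr, ~~ (E <= addr < E + U) -> mm s' addr = mm s addr.

Lemma private_outside E s s' : private E s s' -> outside E s s'.
Proof. by move=> h' addr _; apply: h'. Qed.

Lemma zeta_ok s E : 3 * U <= E -> E + U <= V -> context s -> params s -> rg s rE = E ->
  representing s -> table E (rg s rt) (rg s rj) (rg s rcp) (rg s ra) m s ->
  WP zeta (fun s' => private E s s' /\
    table E (rg s rt) (rg s rj) (rg s rcp) (rg s ra) 0 s') s.
Proof.
move=> EU EV C P eE repS tabS; have UV := U_lt; have Ug := U_ge.
set t := rg s rt in tabS *; set j := rg s rj in tabS *.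
set cp := rg s rcp in tabS *; set a := rg s ra in tabS *.
apply: wp_seq; apply: wp_asn => //; rewrite /= (ctx_m C); set s0 := setr _ _ _.
have C0 : context s0 by case: C.
pose rep kappa := mm s (2 * U + kappa).
have repP : forall z, z < 8 ^ b -> rep (key m (vec z)) < 8 ^ b /\
  key m (lcnt colour b (rep (key m (vec z)))) = key m (lcnt colour b z) := repS.
pose J i s1 := private E s s1 /\ table E t j cp a i s1.
apply: (@wp_loop _ _ _ _ false rq _ s0 _ J).
- by apply: small_bnd; rewrite /s0 /=; move: Ug; clear; lia.
- by [].
- move=> q s1 qm K [hpr htab]; rewrite /= in qm.
  have hout : outside E s0 s1 := private_outside hpr.
  have C1 : context s1 by apply: (context_outside _ K EU hout).
  apply: wp_seq; apply: wp_asn => //; rewrite /= (ctx_EL C1).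
  set s2 := setr _ rz _.
  have C2 : context s2 by case: C1.
  pose J2 i s3 := [/\ i <= 8 ^ b, private E s s3 & forall x, key m x < U ->
    mm s3 (E + key m x) = entry_at colour m b p t j cp a rep q i x].
  apply: (@wp_loop _ _ _ _ true rz _ s2 _ J2).
  + by apply: leq_trans bnd_exp; apply: leq_addr.
  + split=> // x xU; rewrite htab // -(entry_at_start p t j cp a repP) //.
  + move=> z s3 zlt K3 [_ hpr3 htab3].
    have hout3 : outside E s2 s3.
      by move=> addr h1 h2; rewrite hpr3 // -hpr.
    have C3 : context s3 by apply: (context_outside _ K3 EU hout3).
    have C3' : context (setr s3 rz z) by case: C3.
    apply: wp_seq; apply: (wp_use (left_ok C3')) => /= s4 K4 [ek ek2 _].
    have C4 : context s4 by apply: (context_keeps _ _ K4).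
    have q4 : rg s3 rq = q by kp.
    rewrite q4 in ek2.
    have rz4 : rg s4 rz = z by kp.
    have rE4 : rg s4 rE = E by kp => /=; kp => /=; kp; exact: eE.
    have m4 : mm s4 = mm s3 by kp.
    have kz := key_vec_lt z; have k0 := key_zero_lt q z.
    have kz' : key m (vec z) < U by move: kz; clear; lia.
    have k0' : key m (zero q (vec z)) < U by move: k0; clear; lia.
    have r4 : mm s4 (2 * U + key m (vec z)) = rep (key m (vec z)).
      by rewrite m4 hpr3 //; move: kz' EU; clear; lia.
    (* No update is due if z does not represent its vector or if colour q does not occur in z. *)
    have done_other s5 : mm s5 = mm s4 ->
        ~~ ((rep (key m (vec z)) == z) && (vec z q != 0)) -> J2 z s5.
      move=> m5 hh; split; first exact: ltnW.
        by move=> addr had; rewrite m5 m4 hpr3.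
      move=> x xU; rewrite m5 m4 htab3 //.
      symmetry; apply: (entry_at_other _ _ _ _ _ repP qm).
      by apply: contra hh => /and3P[-> ->].
    apply: wp_ifeq => //=; rewrite ek ek2 => e.
      apply: wp_skip; apply: done_other => //; rewrite negb_and negbK; apply/orP; right.
      by have [_ /(_ q qm)] := keyf_inj e; rewrite /zero eqxx => ->.
    have cz : vec z q != 0.
      apply/eqP => c0; apply: e; apply: eq_keyf => r rm; rewrite /zero.
      by case: eqP => // ->.
    apply: wp_ifeq => //=; rewrite ?ek ?(ctx_U C4) ?addnn -?mul2n ?rz4 ?r4.
    * by rewrite -/V; move: kz UV; clear; move=> *; do ?split => //; lia.
    * move=> er; set a2 := E + key m (zero q (vec z)).
      have sumE : entry_at colour m b p t j cp a rep q z (zero q (vec z)) =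
          mm s4 a2 + mm s4 (E + key m (vec z)).
        by rewrite m4 /a2 !htab3 //; apply: entry_at_target.
      apply: wp_put => /=; rewrite ?rE4 ?ek ?ek2.
      - by rewrite -/V; move: k0' EV; clear; move=> *; do ?split => //; lia.
      - rewrite -/a2 -sumE -/V; have := lsum_le colour m b p t j cp a; rewrite /entry_at => le.
        have := leq_ltn_trans (le _) pow8_lt => {}le.
        by rewrite le; move: k0' kz' EV; rewrite /a2; clear; move=> *; do ?split => //; lia.
      rewrite -/a2 -sumE; set s5 := setm _ _ _.
      split; first exact: ltnW.
        move=> addr had; rewrite /s5 /= ifF ?m4 ?hpr3 //.
        by apply: contraNF had => /eqP ->; rewrite /a2; move: k0'; clear; lia.
      move=> x xU; rewrite /s5 /= /a2 eqn_add2l; case: eqP => [ex|nx].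
        rewrite (entry_at_target p t j cp a repP qm zlt er cz (esym ex)).
        by rewrite (entry_at_target p t j cp a repP qm zlt er cz (erefl _)) -!htab3 // ex.
      rewrite m4 htab3 //; symmetry; apply: (entry_at_other _ _ _ _ _ repP qm).
      by rewrite !negb_and; apply/orP; right; apply/orP; right; apply/eqP => ex; apply: nx.
    * move=> er; apply: wp_skip; apply: done_other => //.
      by rewrite negb_and; apply/orP; left; apply/eqP.
  + move=> s3 K3 [_ hpr3 htab3]; split=> // x xU.
    by rewrite htab3 // entry_at_end.
- by move=> s1 K [hpr htab]; split.
Qed.

(** Every nonzero entry of a fitting x is an exact count, so the total of x is at most n. This is
    why [right] may drop vectors of larger total. *)
Lemma entry_overflow t j cp a (x : nat -> nat) : n < \sum_(q < m) x q ->
  entry colour m b p t j cp a 0 x = 0.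
Proof.
move=> lt; rewrite /entry /lsum big1 // => z _; case f: (fits _ _ _ _); last by rewrite andbF.
suff : \sum_(q < m) x q <= n by rewrite leqNgt lt.
apply: leq_trans (sum_lcnt z); apply: leq_sum => q _.
by move/fitsP: f => /(_ q (ltn_ord q))[->|[_ ->]].
Qed.

Lemma entry_le t j cp a i x : entry colour m b p t j cp a i x <= 8 ^ b.
Proof. exact: lsum_le. Qed.

Lemma sum_up_ok s E : E + U <= V -> context s -> params s -> rg s rE = E ->
  table E (rg s rt) (rg s rj) (rg s rcp) (rg s ra) 0 s ->
  WP sum_up (fun s' => rg s' res =
    if total colour m b p (rg s rt) (rg s rj) (rg s rcp) (rg s ra) n k != 0%R
    then 1 else rg s res) s.
Proof.
move=> EV C P eE tab.
set t := rg s rt in tab *; set j := rg s rj in tab *.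
set cp := rg s rcp in tab *; set a := rg s ra in tab *.
do 3![apply: wp_seq; apply: wp_asn => //]; rewrite /= (ctx_ER C); set s0 := setr _ rz _.
have C0 : context s0 by case: C.
pose tl z := rtiles b a h z n.
pose val z := entry colour m b p t j cp a 0 (rvec colour p t (tl z)).
pose term z : int := (if rvalid colour m p t j cp a n k (tl z)
  then (-1) ^+ rsign colour m p (tl z) * (val z)%:R else 0)%R.
pose J i s1 := [/\ (Posz (rg s1 rP) - Posz (rg s1 rN) = \sum_(i <= z < 3 ^ h) term z)%R,
  rg s1 rP + i * 8 ^ b <= 3 ^ h * 8 ^ b & rg s1 rN + i * 8 ^ b <= 3 ^ h * 8 ^ b].
have PN x : x <= 3 ^ h * 8 ^ b -> x < V.
  move=> le; apply: leq_ltn_trans le _; apply: leq_trans sums_lt.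
  have : 0 < 8 ^ b * 3 ^ h by rewrite muln_gt0 !expn_gt0.
  by rewrite [3 ^ h * _]mulnC; move: (8 ^ b * _) => y; clear; lia.
apply: wp_seq; apply: (@wp_loop _ _ _ _ true rz _ s0 _ J).
- by apply: leq_trans bnd_exp; apply: leq_addl.
- by rewrite /J /s0 /= big_geq // subrr; split.
- move=> z s1 zlt K [hPN hP hN]; rewrite /= in zlt.
  have C1 : context s1 by apply: context_keeps K C0.
  have C1' : context (setr s1 rz z) by case: C1.
  have P1' : params (setr s1 rz z) by case: P => *; split=> /=; kp.
  apply: wp_seq; apply: (wp_use (right_ok C1' P1')).
  have e11 : rg s1 rt = t by kp.
  have e12 : rg s1 rj = j by kp.
  have e13 : rg s1 rcp = cp by kp.
  have e14 : rg s1 ra = a by kp.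
  rewrite /= e11 e12 e13 e14 -/(tl z) => s2 K2 [eok ek esg].
  have sumE : (\sum_(z <= y < 3 ^ h) term y = term z + \sum_(z.+1 <= y < 3 ^ h) term y)%R.
    by rewrite big_ltn.
  have rE2 : rg s2 rE = E by kp => /=; kp; exact: eE.
  have m2 : mm s2 = mm s by kp => /=; kp.
  have vz : val z <= 8 ^ b by apply: entry_le.
  have hP' : rg s1 rP + val z + z * 8 ^ b <= 3 ^ h * 8 ^ b.
    by move: hP vz; rewrite mulSn; clear; lia.
  have hN' : rg s1 rN + val z + z * 8 ^ b <= 3 ^ h * 8 ^ b.
    by move: hN vz; rewrite mulSn; clear; lia.
  apply: wp_if => //= ok.
    have : rg s2 rok != 0 by rewrite -lt0n.
    rewrite eok => /andP[rv sn].
    have kn := ek sn.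
    have k8 := key_lt sn.
    have kU : key m (rvec colour p t (tl z)) < U by move: k8; clear; lia.
    have valE : mm s2 (rg s2 rE + rg s2 rkey) = val z by rewrite m2 rE2 kn tab.
    have kV : rg s2 rE + rg s2 rkey < V by rewrite rE2 kn; move: kU EV; clear; lia.
    have P2 : rg s2 rP = rg s1 rP by kp.
    have N2 : rg s2 rN = rg s1 rN by kp.
    have ev33 : rg s1 rP + val z < V.
      by apply: PN; apply: leq_trans hP'; apply: leq_addr.
    have ev34 : rg s1 rN + val z < V.
      by apply: PN; apply: leq_trans hN'; apply: leq_addr.
    have tE : term z = ((-1) ^+ (rg s2 rsg) * (val z)%:R)%R.
      by rewrite /term rv esg signr_odd.
    apply: wp_if => //= sg.
      have sg1 : rg s2 rsg = 1 by move: sg; rewrite esg; case: odd.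
      apply: wp_asn => /=; rewrite valE N2 ?P2; first by do ?split.
      split=> /=; rewrite ?P2 //; last by move: hP; rewrite mulSn; clear; lia.
      rewrite sumE tE sg1 -hPN PoszD expr1 natz; ring.
    apply: wp_asn => /=; rewrite valE ?N2 P2; first by do ?split.
    split=> /=; rewrite ?N2 //; last by move: hN; rewrite mulSn; clear; lia.
    rewrite sumE tE sg -hPN PoszD expr0 natz; ring.
  have t0 : term z = 0%R.
    have := eok; rewrite ok /term; case: (rvalid _ _ _ _ _ _ _ _ _ _) => //=.
    move=> /esym/negbT; rewrite -ltnNge => /(entry_overflow t j cp a) v0.
    by rewrite /val v0 mulr0.
  apply: wp_skip; rewrite /J; kp => /=; rewrite sumE t0 add0r; split=> //.
    by move: hP; rewrite mulSn; clear; lia.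
  by move: hN; rewrite mulSn; clear; lia.
- move=> s1 K [hPN _ _].
  have totE : total colour m b p t j cp a n k = (Posz (rg s1 rP) - Posz (rg s1 rN))%R.
    by rewrite hPN.
  (* Being a count, the total is not negative, so truncated subtraction decides whether it is 0. *)
  have [y yE] : exists y : nat, total colour m b p t j cp a n k = Posz y.
    by rewrite (total_count colour_lt) natz; eexists.
  rewrite yE in totE *.
  have PNy : rg s1 rP = y + rg s1 rN by move: totE; clear; lia.
  have -> : (Posz y != 0%R) = (0 < y) by rewrite lt0n.
  apply: wp_if => //=; rewrite PNy addnK => hy.
    by apply: wp_asn => //=; rewrite hy.
  by apply: wp_skip; rewrite hy; kp.
Qed.

Definition total_at (x : nat) : int :=
  total colour m b p (x %% (n + 1)) (x %/ (n + 1) %% (n + 1))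
    (x %/ (n + 1) %/ (n + 1) %% (n + 1)) (x %/ (n + 1) %/ (n + 1) %/ (n + 1)) n k.

Lemma total_atP :
  (exists2 x, x < (n + 1) ^ 4 & total_at x != 0%R) <->
  exists ts, winning colour m p n k ts.
Proof.
rewrite -(total_spec _ colour_lt b_lt p_lt).
have n0 : 0 < n + 1 by rewrite addn1.
have md y : y %% (n + 1) <= n by have := ltn_pmod y n0; clear; lia.
split=> [[x xlt ne]|[t [j [cp [a [tn jn cpn an ne]]]]]].
  do 4!eexists; split; last exact: ne; rewrite ?md //.
  rewrite -ltnS -(addn1 n) !ltn_divLR // -!mulnA.
  by move: xlt; rewrite !expnS expn0 muln1.
have dm (y z : nat) : y <= n -> (y + (n + 1) * z) %% (n + 1) = y /\ (y + (n + 1) * z) %/ (n + 1) = z.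
  move=> yn; have yn1 : y < n + 1 by rewrite addn1.
  by rewrite addnC mulnC modnMDl divnMDl // modn_small // divn_small // addn0.
exists (t + (n + 1) * (j + (n + 1) * (cp + (n + 1) * a))).
  have st y z q : y <= n -> z < q -> y + (n + 1) * z < (n + 1) * q.
    move=> yn zq; apply: (@leq_trans ((n + 1) * z.+1)); last by rewrite leq_mul2l zq orbT.
    by rewrite mulnS ltn_add2r addn1.
  rewrite !expnS expn0 muln1; do 3![apply: (st) => //].
  by rewrite addn1.
rewrite /total_at; have [-> ->] := dm t (j + (n + 1) * (cp + (n + 1) * a)) tn.
by have [-> ->] := dm j (cp + (n + 1) * a) jn; have [-> ->] := dm cp a cpn.
Qed.

Lemma decode_ok s : context s -> rg s rpi < (n + 1) ^ 4 ->
  let x := rg s rpi in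
  WP decode (fun s' =>
    [/\ rg s' rt = x %% (n + 1), rg s' rj = x %/ (n + 1) %% (n + 1),
        rg s' rcp = x %/ (n + 1) %/ (n + 1) %% (n + 1),
        rg s' ra = x %/ (n + 1) %/ (n + 1) %/ (n + 1) &
        rg s' rE = (x + 3) * U]) s.
Proof.
move=> C xlt x; have n1 : n + 1 < V by apply: small_lt; clear; lia.
do 6![apply: wp_seq; apply: wp_asn; first by rewrite /= ?(ctx_n C); do ?split].
have xV : (x + 3) * U < V.
  apply: leq_trans addresses_lt; rewrite ltn_mul2r expn_gt0 /=.
  by move: xlt; rewrite -/x; clear; lia.
apply: wp_asn; last by rewrite /= (ctx_n C) (ctx_U C).
rewrite /= (ctx_U C) -/x -/V; do ?split => //.
apply: leq_ltn_trans xV; rewrite leq_pmulr // expn_gt0 //.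
Qed.

Lemma search_ok s : context s -> rg s res = 0 ->
  (forall addr, 3 * U <= addr -> mm s addr = 0) ->
  WP search (fun s' => rg s' res != 0 <-> exists ts, winning colour m p n k ts) s.
Proof.
move=> C r0 fresh; have UV := U_lt; have Ug := U_ge.
have n1 : n + 1 < V by apply: small_lt; clear; lia.
have n4V : (n + 1) ^ 4 < V.
  apply: leq_trans addresses_lt; apply: (@leq_trans ((n + 1) ^ 4 + 4)).
    by rewrite -addn1 leq_add2l.
  by rewrite leq_pmulr // expn_gt0.
have n2V : (n + 1) * (n + 1) < V.
  by apply: leq_ltn_trans n4V; rewrite -[_ * _]/((n + 1) ^ 2) leq_pexp2l // addn1.
have n22 : (n + 1) * (n + 1) * ((n + 1) * (n + 1)) = (n + 1) ^ 4.
  by rewrite !expnS expn0 muln1 !mulnA.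
apply: wp_seq; apply: wp_asn; first by rewrite /= (ctx_n C).
apply: wp_seq; apply: wp_asn; first by rewrite /= (ctx_n C) n22.
rewrite /= (ctx_n C) n22; set s0 := setr _ _ _.
have C0 : context s0 by case: C.
(* Guesses are made in decreasing order, so the zones of the guesses to come lie below (i + 3) * U
   and are still blank. *)
pose J i s1 :=
  [/\ i <= (n + 1) ^ 4,
      forall y, y <= n -> mm s1 (U + y) = S y,
      forall addr, 3 * U <= addr < (i + 3) * U -> mm s1 addr = 0 &
      (rg s1 res != 0) = has (fun x => total_at x != 0%R) (iota i ((n + 1) ^ 4 - i))].
apply: (@wp_loop _ _ _ _ false rpi _ s0 _ J).
- by apply: leq_trans bnd_poly; rewrite /s0 /= leq_exp2r // leq_add2r leq_addr.
- split=> //; first by case: C0.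
    by move=> addr /andP[h1 _]; apply: fresh.
  by rewrite /s0 /= subnn r0.
- move=> i s1 ilt [K _] [_ hS hfresh hres]; rewrite /= in ilt.
  have C1 : context (setr s1 rpi i).
    have k1 r : r \notin writes (Loop false rpi (decode;; fill;; zeta;; sum_up)) ->
      rg s1 r = rg s r.
      by move=> hr; rewrite K // /s0 /=; case/norP: hr => /negbTE ->.
    by case: C => *; split; rewrite //= k1.
  apply: wp_seq; apply: (wp_use (decode_ok C1 _)) => //= s2 K2 [et ej ecp ea eE].
  have C2 : context s2 by apply: (context_keeps _ _ K2).
  have n0 : 0 < n + 1 by rewrite addn1.
  have md y : y %% (n + 1) <= n by have := ltn_pmod y n0; clear; lia.
  have P2 : params s2.
    split; rewrite ?et ?ej ?ecp ?ea ?md // -ltnS -(addn1 n) !ltn_divLR // -!mulnA.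
    by move: ilt; rewrite !expnS expn0 muln1.
  set E := (i + 3) * U in eE.
  have EU : 3 * U <= E by rewrite leq_mul2r leq_addl orbT.
  have EV : E + U <= V.
    apply: leq_trans addresses_lt; rewrite /E addnC -mulSn leq_mul2r; apply/orP; right.
    by move: ilt; clear; lia.
  have m2 : mm s2 = mm s1 by kp.
  apply: wp_seq; apply: (wp_use (fill_ok EU EV C2 P2 eE _)).
    move=> kappa kU; rewrite m2 hfresh //; apply/andP; split.
      by apply: leq_trans EU _; apply: leq_addr.
    by rewrite /E addSn mulSn addnC ltn_add2r.
  move=> s3 K3 [out3 rep3 tab3].
  have C3 : context s3 by apply: (context_outside _ K3 EU out3).
  have P3 : params s3 by apply: (params_keeps _ K3).
  have eE3 : rg s3 rE = E by rewrite (proj1 K3 rE isT).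
  have e11 : rg s3 rt = rg s2 rt by rewrite (proj1 K3 rt isT).
  have e12 : rg s3 rj = rg s2 rj by rewrite (proj1 K3 rj isT).
  have e13 : rg s3 rcp = rg s2 rcp by rewrite (proj1 K3 rcp isT).
  have e14 : rg s3 ra = rg s2 ra by rewrite (proj1 K3 ra isT).
  rewrite -e11 -e12 -e13 -e14 in tab3.
  apply: wp_seq; apply: (wp_use (zeta_ok EU EV C3 P3 eE3 rep3 tab3)) => s4 K4 [pr4 tab4].
  have out4 := private_outside pr4.
  have C4 : context s4 by apply: (context_outside _ K4 EU out4).
  have P4 : params s4 by apply: (params_keeps _ K4).
  have eE4 : rg s4 rE = E by rewrite (proj1 K4 rE isT).
  have f11 : rg s4 rt = rg s3 rt by rewrite (proj1 K4 rt isT).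
  have f12 : rg s4 rj = rg s3 rj by rewrite (proj1 K4 rj isT).
  have f13 : rg s4 rcp = rg s3 rcp by rewrite (proj1 K4 rcp isT).
  have f14 : rg s4 ra = rg s3 ra by rewrite (proj1 K4 ra isT).
  rewrite -f11 -f12 -f13 -f14 in tab4.
  apply: (wp_use (sum_up_ok EV C4 P4 eE4 tab4)) => s5 K5 er.
  have m5 : mm s5 = mm s4 by rewrite (proj2 K5 isT).
  split; first exact: ltnW.
  + by move=> y yn; rewrite m5 (ctx_S C4).
  + move=> addr /andP[h1 h2].
    have nE : ~~ (E <= addr < E + U) by rewrite leqNgt h2.
    have n2 : ~~ (2 * U <= addr < 3 * U) by rewrite [addr < _]ltnNge h1 andbF.
    rewrite m5 out4 // out3 // m2 hfresh // h1 /=; apply: leq_trans h2 _.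
    by rewrite leq_mul2r addSn leqnSn orbT.
  + rewrite er f11 f12 f13 f14 e11 e12 e13 e14 et ej ecp ea -/(total_at i).
    have -> : rg s4 res = rg s1 res.
      by rewrite (proj1 K4 res isT) (proj1 K3 res isT) (proj1 K2 res isT).
    by rewrite -(subnSK ilt) /= -hres; case: (total_at i != 0%R).
- move=> s1 _ [_ _ _ ->]; rewrite subn0 -total_atP; split.
    by case/hasP=> x; rewrite mem_iota => /andP[_ xlt] ne; exists x.
  by case=> x xlt ne; apply/hasP; exists x; rewrite ?mem_iota.
Qed.

(** * Preprocessing: constants and the order along the path *)

Lemma setup_ok s : b = (19 * n) %/ 74 ->
  mm s 0 = n -> mm s 1 = m -> mm s 2 = k -> mm s 3 = p ->
  WP setup (fun s' =>
    [/\ [/\ rg s' rn = n, rg s' rm = m, rg s' rk = k & rg s' rp = p],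
        rg s' rU = U, rg s' rb2 = 2 * b, rg s' rh = h &
        rg s' rEL = 8 ^ b /\ rg s' rER = 3 ^ h]) s.
Proof.
move=> bE m0 m1 m2 m3; have UV := U_lt; have Ug := U_ge.
do 5![apply: wp_seq; apply: wp_asn => //].
apply: wp_seq; apply: wp_asn.
  by rewrite /= m0 m1; do ?split => //; apply: small_lt; clear; lia.
rewrite /= m0 m1 m2 m3; set s0 := setr _ ri _.
apply: wp_seq; apply: (@wp_loop _ _ _ _ false ri _ s0 _ (fun i s1 => rg s1 rU * 2 ^ i = U)).
- by apply: small_bnd; rewrite /s0 /=; clear; lia.
- by rewrite /s0 /= /U [in RHS]expnD mulnC.
- move=> i s1 _ _ e.
  have e' : (rg s1 rU + rg s1 rU) * 2 ^ i = U by rewrite -e expnS mulnA muln2 addnn.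
  apply: wp_asn => //=; do ?split => //; rewrite -/V; apply: leq_ltn_trans (_ : U < V).
    by rewrite -e' leq_pmulr // expn_gt0.
  by move: UV Ug; clear; lia.
move=> s1 K1; rewrite muln1 => eU.
have n1 : rg s1 rn = n by kp.
apply: wp_seq; apply: wp_asn.
  rewrite /= n1; do ?split => //; rewrite -/V.
  by move: UV Ug; clear; lia.
do 2![apply: wp_seq; apply: wp_asn => //]; rewrite /= n1 -bE; set s2 := setr _ ri _.
have h8 : 0 < 8 ^ b by rewrite expn_gt0.
have h3 : 0 < 3 ^ h by rewrite expn_gt0.
have p8 : 8 ^ b < V by apply: pow8_lt.
have p3 : 3 ^ h < V.
  by apply: leq_trans sums_lt; move: h8 h3; move: (8 ^ b) (3 ^ h) => x y; clear; nia.
have bn : 2 * b <= n by apply: ltnW.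
apply: wp_seq; apply: (@wp_loop _ _ _ _ false ri _ s2 _ (fun i s1 => rg s1 rEL * 8 ^ i = 8 ^ b)).
- by apply: small_bnd; rewrite /s2 /=; move: bn; clear; lia.
- by rewrite /s2 /= mul1n.
- move=> i s3 _ _ e.
  have e' : rg s3 rEL * 8 * 8 ^ i = 8 ^ b by rewrite -e expnS mulnA.
  apply: wp_asn => //=; do ?split => //; rewrite -/V; apply: leq_ltn_trans p8.
  by rewrite -e' leq_pmulr // expn_gt0.
move=> s3 K3; rewrite muln1 => eEL.
have b3 : rg s3 rb2 = b by kp.
have n3 : rg s3 rn = n by kp => /=; rewrite n1.
apply: wp_seq; apply: wp_asn.
  rewrite /= b3; do ?split => //; apply: small_lt; move: bn; clear; lia.
do 3![apply: wp_seq; apply: wp_asn => //]; rewrite /= b3 n3 addnn -mul2n -/h.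
set s4 := setr _ ri _.
apply: (@wp_loop _ _ _ _ false ri _ s4 _ (fun i s1 => rg s1 rER * 3 ^ i = 3 ^ h)).
- by apply: small_bnd; rewrite /s4 /= /h; clear; lia.
- by rewrite /s4 /= mul1n.
- move=> i s5 _ _ e.
  have e' : rg s5 rER * 3 * 3 ^ i = 3 ^ h by rewrite -e expnS mulnA.
  apply: wp_asn => //=; do ?split => //; rewrite -/V; apply: leq_ltn_trans p3.
  by rewrite -e' leq_pmulr // expn_gt0.
move=> s5 K5; rewrite muln1 => eER; kp => /=; kp => /=; kp => /=.
by rewrite eU eEL eER.
Qed.

Definition path_order (A : nat -> nat -> bool) (sigma : nat -> nat) : Prop :=
  [/\ forall i, i < n -> sigma i < n,
      forall i j, i < n -> j < n -> sigma i = sigma j -> i = j,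
      forall v, v < n -> exists2 i, i < n & sigma i = v &
      forall i j, i < n -> j < n -> A (sigma i) (sigma j) = (i.+1 == j) || (j.+1 == i)].

Definition degree (A : nat -> nat -> bool) (u : nat) : nat := \sum_(0 <= v < n) A u v.

Lemma path_order_rev A sigma : path_order A sigma ->
  path_order A (fun i => sigma (n - i.+1)).
Proof.
case=> lt inj sur adj; have rv i : i < n -> n - i.+1 < n by clear; lia.
split.
- by move=> i /rv/lt.
- by move=> i j i_n jn /inj; move: (rv i i_n) (rv j jn) => r1 r2 /(_ r1 r2); move: i_n jn; clear; lia.
- move=> v /sur[i i_n <-]; exists (n - i.+1); first exact: rv.
  by congr sigma; move: i_n; clear; lia.
- move=> i j i_n jn; rewrite adj ?rv //; move: i_n jn; clear => i_n jn.
  by apply/orP/orP => -[/eqP|/eqP] e; [right|left|right|left]; apply/eqP; lia.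
Qed.

Lemma sum_indicator c N : \sum_(0 <= v < N) (v == c) = (c < N).
Proof.
elim: N => [|N IH]; first by rewrite big_nil.
by rewrite big_nat_recr //= IH ltnS; case: (ltngtP c N).
Qed.

Lemma degree_end A sigma : path_order A sigma -> degree A (sigma 0) < 2.
Proof.
move=> [lt inj sur adj]; have n0 : 0 < n by apply: leq_ltn_trans b_lt.
apply: (@leq_ltn_trans (\sum_(0 <= v < n) (v == sigma 1))); last first.
  by rewrite sum_indicator; case: (sigma 1 < n).
rewrite /degree big_nat [X in _ <= X]big_nat; apply: leq_sum => v /andP[_ /sur[i i_n <-]].
by rewrite adj //; case: i i_n => [|[|i]] i_n //; rewrite !eqxx.
Qed.

Lemma degree_inner A sigma i : path_order A sigma -> i.+2 < n ->
  1 < degree A (sigma i.+1).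
Proof.
move=> [lt inj sur adj] i_n; have i0 : i < n by move: i_n; clear; lia.
have i1 : i.+1 < n by move: i_n; clear; lia.
apply: (@leq_trans (\sum_(0 <= v < n) ((v == sigma i) + (v == sigma i.+2)))).
  by rewrite big_split /= !sum_indicator !lt.
rewrite /degree big_nat [X in _ <= X]big_nat; apply: leq_sum => v _.
have ne : (sigma i == sigma i.+2) = false.
  by apply/eqP => /(inj _ _ i0 i_n); clear; lia.
case: eqP => [->|_]; first by rewrite ne adj // eqxx orbT.
by case: eqP => // ->; rewrite adj // eqxx.
Qed.

(** Inner vertices have degree at least 2, so c is first or last; if need be, reversing the order
    puts it at position n - 1, where the walk starts. *)
Lemma end_order A sigma c : path_order A sigma -> c < n -> degree A c < 2 ->
  exists2 tau, path_order A tau & c = tau n.-1.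
Proof.
move=> ord cn deg; have [lt inj sur adj] := ord.
have [i i_n ec] := sur c cn; rewrite -ec in deg.
have [ei|ne] := eqVneq i n.-1; first by exists sigma; rewrite -?ei.
case: i i_n ec deg ne => [|i] i_n ec deg ne; last first.
  have : 1 < degree A (sigma i.+1).
    by apply: (degree_inner ord); move: i_n ne; clear; lia.
  by move: deg; clear; lia.
exists (fun i => sigma (n - i.+1)); first exact: path_order_rev.
by rewrite -ec; congr sigma; move: i_n; clear; lia.
Qed.

Lemma cell_ltU u v : u < n -> v < n -> 4 + u * n + v < U.
Proof.
move=> un vn; apply: (@leq_trans (n * n + 4)); first by move: un vn; clear; nia.
apply: (@leq_trans (2 ^ (n + 3))).
  elim: (n) => // i IH; rewrite addSn expnS; move: IH; clear; nia.
by rewrite /U leq_exp2l // leq_add2r leq_addr.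
Qed.

Lemma cell_lt u v : u < n -> v < n -> 4 + u * n + v < V.
Proof. by move=> un vn; have := cell_ltU un vn; have := U_lt; clear; lia. Qed.

Lemma find_end_ok s A sigma : path_order A sigma -> rg s rn = n ->
  (forall u v, u < n -> v < n -> mm s (4 + u * n + v) = A u v) ->
  WP find_end (fun s' => rg s' rcur < n /\ degree A (rg s' rcur) < 2) s.
Proof.
move=> ord en hA; have UV := U_lt; have Ug := U_ge.
have n0 : 0 < n by apply: leq_ltn_trans b_lt.
have nb x : x <= n -> x <= bnd false by move=> xn; apply: small_bnd; move: xn; clear; lia.
apply: wp_seq; apply: wp_asn => //; rewrite /= en; set s0 := setr _ _ _.
pose J i s1 := (exists2 u, i <= u < n & degree A u < 2) ->
  rg s1 rcur < n /\ degree A (rg s1 rcur) < 2.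
apply: (@wp_loop _ _ _ _ false ru _ s0 _ J).
- exact: nb.
- by move=> [u /andP[]]; rewrite /s0 /= => h1 h2; move: (leq_ltn_trans h1 h2); rewrite ltnn.
- move=> u s1 un K hJ; rewrite /= in un.
  do 2![apply: wp_seq; apply: wp_asn => //].
  have n1 : rg s1 rn = n by kp.
  rewrite /= n1; set s2 := setr _ rv _.
  pose J2 i s3 := i <= n /\ rg s3 rdeg = \sum_(i <= v < n) A u v.
  have sumle i : \sum_(i <= v < n) A u v <= n.
    apply: (@leq_trans (\sum_(i <= v < n) 1)); last by rewrite sum_nat_const_nat muln1 leq_subr.
    by apply: leq_sum => v _; apply: leq_b1.
  apply: wp_seq; apply: (@wp_loop _ _ _ _ false rv _ s2 _ J2).
  + exact: nb.
  + by rewrite /J2 big_geq.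
  + move=> v s3 vn K3 [_ hs]; rewrite /= in vn.
    have n3 : rg s3 rn = n by kp.
    have u3 : rg s3 ru = u by kp.
    have m3 : mm s3 = mm s by kp => /=; kp.
    have sE : \sum_(v <= y < n) A u y = A u v + \sum_(v.+1 <= y < n) A u y by rewrite big_ltn.
    have cl := cell_lt un vn.
    have sV : \sum_(v.+1 <= y < n) A u y + A u v < V.
      by apply: small_lt; have := sumle v; rewrite sE; clear; lia.
    apply: wp_asn => /=; rewrite n3 u3 m3 hA // hs.
      by do ?split => //; move: cl; rewrite /V; clear; lia.
    by split; [exact: ltnW | rewrite sE addnC].
  + move=> s3 K3 [_ hs].
    have u3 : rg s3 ru = u by kp.
    have c3 : rg s3 rcur = rg s1 rcur by kp.
    apply: wp_if => //=; rewrite hs -/(degree A u) => dg.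
      apply: wp_asn => // _ /=; rewrite u3; split=> //.
      by rewrite -subn_gt0.
    change (J u s3); rewrite /J c3 => -[y /andP[h1 h2] h3]; apply: hJ; exists y => //.
    rewrite h2 andbT ltn_neqAle h1 andbT; apply: contraTneq h3 => <-.
    by rewrite -leqNgt -subn_eq0 dg.
- move=> s1 K; apply; exists (sigma 0); last exact: degree_end ord.
  by case: ord => lt *; rewrite lt.
Qed.

Lemma order_path_ok s A sigma : path_order A sigma -> rg s rn = n -> rg s rU = U ->
  (forall u v, u < n -> v < n -> mm s (4 + u * n + v) = A u v) ->
  (forall addr, U <= addr -> mm s addr = 0) ->
  WP order_path (fun s' => exists tau, [/\ path_order A tau,
    forall i, i <= n -> mm s' (U + i) = \sum_(i <= y < n) 2 ^ tau y &
    forall addr, 3 * U <= addr -> mm s' addr = 0]) s.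
Proof.
move=> ord0 en eU hA fresh; have UV := U_lt; have Ug := U_ge.
have n0 : 0 < n by apply: leq_ltn_trans b_lt.
have nb x : x <= n -> x <= bnd false by move=> xn; apply: small_bnd; move: xn; clear; lia.
apply: wp_seq; apply: (wp_use (find_end_ok ord0 en hA)) => s1 K1 [cn cdeg].
have [tau ord ec] := end_order ord0 cn cdeg.
have [lt inj sur adj] := ord.
have n1 : rg s1 rn = n by kp.
do 3![apply: wp_seq; apply: wp_asn => //]; rewrite /= n1; set s2 := setr _ ri _.
pose sum i := \sum_(i <= y < n) 2 ^ tau y.
have pU i : i < n -> 2 ^ tau i <= 2 ^ n by move=> /lt h'; rewrite leq_exp2l // ltnW.
have sumV i : sum i < V.
  apply: leq_ltn_trans (_ : n * 2 ^ n < V).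
    apply: (@leq_trans (\sum_(i <= y < n) 2 ^ n)).
      rewrite /sum big_nat [X in _ <= X]big_nat; apply: leq_sum => y /andP[_ yn].
      exact: pU.
    by rewrite sum_nat_const_nat leq_mul2r leq_subr orbT.
  apply: leq_trans addresses_lt; apply: (@leq_trans ((n + 1) * U)).
    apply: (@leq_trans ((n + 1) * 2 ^ n)); first by rewrite ltn_mul2r expn_gt0 addn1 /=.
    by rewrite leq_mul2l /U leq_exp2l // -addnA leq_addr orbT.
  rewrite leq_mul2r; apply/orP; right; apply: leq_trans (leq_addr _ _).
  by rewrite -{1}(expn1 (n + 1)) leq_pexp2l // addn1.
(* The positions from i on have been visited. Before the first visit [rprev] is n, which is no
   vertex; after position 0 there is no next vertex, so [rcur] is described for 0 < i only. *)
pose J i s3 :=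
  [/\ i <= n,
      0 < i -> rg s3 rcur = tau i.-1,
      rg s3 rprev = if i < n then tau i else n,
      rg s3 racc = sum i &
      (forall y, i <= y <= n -> mm s3 (U + y) = sum y) /\
      forall addr, ~~ (U <= addr < 2 * U) -> mm s3 addr = mm s addr].
have m1 : mm s1 = mm s by kp.
have sumn : sum n = 0 by rewrite /sum big_geq.
apply: (@wp_loop _ _ _ _ false ri _ s2 _ J).
- exact: nb.
- split=> //.
  + by rewrite /s2 /= ltnn.
  + split=> [y yn|addr _]; last by rewrite /s2 /= m1.
    have -> : y = n by move: yn; rewrite /s2 /=; clear; lia.
    by rewrite /s2 /= m1 sumn fresh // leq_addr.
- move=> i s3 i_n K3 [_ hcur hprev hacc [hS hM]]; rewrite /= in i_n.
  have {}hcur : rg s3 rcur = tau i by apply: hcur.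
  have ti := lt i i_n.
  have pwV : 2 ^ tau i < V.
    apply: leq_ltn_trans (sumV i); rewrite /sum big_ltn //; exact: leq_addr.
  do 2![apply: wp_seq; apply: wp_asn => //].
  rewrite /= hcur; set s4 := setr _ rx _.
  apply: wp_seq; apply: (@wp_loop _ _ _ _ false rx _ s4 _
    (fun x s5 => rg s5 rpw * 2 ^ x = 2 ^ tau i)).
  + by apply: nb; exact: ltnW.
  + by rewrite /s4 /= mul1n.
  + move=> x s5 _ _ e.
    have e' : (rg s5 rpw + rg s5 rpw) * 2 ^ x = 2 ^ tau i by rewrite -e expnS mulnA muln2 addnn.
    apply: wp_asn => //=; do ?split => //; rewrite -/V; apply: leq_ltn_trans pwV.
    by rewrite -e' leq_pmulr // expn_gt0.
  move=> s5 K5; rewrite muln1 => epw.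
  have sE : sum i = 2 ^ tau i + sum i.+1 by rewrite /sum big_ltn.
  have acc5 : rg s5 racc = sum i.+1 by kp.
  apply: wp_seq; apply: wp_asn.
    by rewrite /= acc5 epw addnC -sE -/V.
  rewrite /= acc5 epw addnC -sE.
  have U5 : rg s5 rU = U by kp => /=; kp => /=; kp => /=; kp.
  have i5 : rg s5 ri = i by kp.
  have n5 : rg s5 rn = n by kp => /=; kp => /=; kp => /=; kp.
  have cur5 : rg s5 rcur = tau i by kp.
  have prev5 : rg s5 rprev = if i.+1 < n then tau i.+1 else n by kp.
  have m5 : mm s5 = mm s3 by kp.
  apply: wp_seq; apply: wp_put => //=; rewrite ?U5 ?i5.
    by do ?split => //; rewrite -/V; move: i_n UV Ug; clear; lia.
  apply: wp_seq; apply: wp_asn => //; rewrite /= n5; set s6 := setr _ rv _.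
  have M6 addr : ~~ (U <= addr < 2 * U) -> mm s6 addr = mm s addr.
    move=> ha; rewrite /s6 /= ifF ?m5 ?hM //.
    by apply: contraNF ha => /eqP ->; move: i_n Ug; clear; lia.
  have S6 y : i <= y <= n -> mm s6 (U + y) = sum y.
    move=> yi; rewrite /s6 /= eqn_add2l m5; case: eqP => [->//|ne].
    by apply: hS; move: yi ne; clear; lia.
  have A6 v : v < n -> mm s6 (4 + tau i * n + v) = A (tau i) v.
    by move=> vn; rewrite M6 ?hA // leqNgt cell_ltU.
  pose J2 v s7 := [/\ v <= n, 0 < i -> v <= tau i.-1 -> rg s7 rnxt = tau i.-1,
    mm s7 = mm s6 & rg s7 rcur = tau i].
  (* The neighbours of position i are at i + 1, which is [rprev], and at i - 1, so the filter leaves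
     only the next vertex of the walk. *)
  have good v : v < n -> A (tau i) v -> v <> rg s6 rprev -> 0 < i /\ v = tau i.-1.
    rewrite /s6 /= prev5 => vn; have [l l_n <-] := sur v vn.
    rewrite adj // => /orP[/eqP e|/eqP <-] ne; last by [].
    by move: l_n ne; rewrite -e => -> .
  apply: wp_seq; apply: (@wp_loop _ _ _ _ false rv _ s6 _ J2).
  + by apply: nb.
  + split=> //= i0; rewrite leqNgt lt //.
    by apply: leq_ltn_trans i_n; apply: leq_pred.
  + move=> v s7 vn K7 [_ hn hm hc]; rewrite /= in vn.
    have n7 : rg s7 rn = n by kp.
    have prev7 : rg s7 rprev = rg s6 rprev by kp.
    have skip : ~ (A (tau i) v /\ v <> rg s6 rprev) -> J2 v (setr s7 rv v).
      move=> bad; split=> //; first exact: ltnW.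
      move=> i0 vle /=; apply: hn => //; rewrite ltn_neqAle vle andbT; apply/eqP => e.
      have i1n : i.-1 < n by apply: leq_ltn_trans i_n; apply: leq_pred.
      apply: bad; rewrite e adj // prednK // eqxx orbT; split=> //.
      rewrite /s6 /= prev5; case: ltnP => h1; last first.
        by move=> e2; have := lt _ i1n; rewrite e2 ltnn.
      by move=> /(inj _ _ i1n h1); move: i0; clear; lia.
    have cl := cell_lt ti vn.
    have cl2 : 4 + tau i * n < V by move: cl; clear; lia.
    have cl3 : tau i * n < V by move: cl; clear; lia.
    apply: wp_if => /=; rewrite n7 hc ?hm ?A6 //.
    - move=> a1; have {}a1 : A (tau i) v by case: (A _ _) a1.
      apply: wp_ifeq => //= e; first by apply: wp_skip; apply: skip => -[_]; rewrite -prev7 -e.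
      rewrite prev7 in e; have [i0 ev] := good v vn a1 e.
      by apply: wp_asn => //; split=> //; exact: ltnW.
    - by move=> a0; apply: wp_skip; apply: skip => -[]; case: (A _ _) a0.
  + move=> s7 K7 [_ hn hm hc].
    apply: wp_seq; apply: wp_asn => //; apply: wp_asn => //.
    have acc7 : rg s7 racc = sum i by kp.
    split=> /=; first exact: ltnW.
    - by move=> i0; apply: hn.
    - by rewrite hc i_n.
    - by [].
    - by rewrite hm; split.
- move=> s3 K3 [_ _ _ _ [hS hM]]; exists tau; split=> // addr ha.
  rewrite hM; last by rewrite negb_and -!leqNgt; apply/orP; right; move: ha; clear; lia.
  by apply: fresh; move: ha; clear; lia.
Qed.

End Program.

(** * Districts of a path are intervals *)

Section Intervals.

Variables (I : wgm) (eta : chooser I).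

Local Notation n := (nvoters I).

Variable s : 'I_n -> 'I_n.

Hypothesis s_inj : injective s.
Hypothesis s_adj : forall i j : 'I_n,
  adj (s i) (s j) = (i.+1 == j :> nat) || (j.+1 == i :> nat).

Definition seg (t : tile) : {set 'I_n} := [set x | [exists i : 'I_n, (s i == x) && (t.1 <= i < t.2)]].

Lemma mem_seg t i : (s i \in seg t) = (t.1 <= i < t.2).
Proof.
rewrite inE; apply/existsP/idP => [[j /andP[/eqP/s_inj ->]]//|h].
by exists i; rewrite eqxx.
Qed.

Lemma s_onto x : exists i, s i = x.
Proof. by have [g _ gK] := injF_bij s_inj; exists (g x). Qed.

Lemma adj_step (U : {set 'I_n}) (i j : 'I_n) : s i \in U -> s j \in U -> i.+1 = j ->
  connect (induced (@adj I) U) (s i) (s j).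
Proof. by move=> iU jU e; apply: connect1; rewrite /induced /= iU jU s_adj e eqxx. Qed.

Lemma seg_district v e : v < e -> e <= n -> district (seg (v, e)).
Proof.
move=> ve en; have vn : v < n by apply: leq_trans en.
apply/andP; split.
  by apply/set0Pn; exists (s (Ordinal vn)); rewrite mem_seg /= leqnn.
have sym : connect_sym (induced (@adj I) (seg (v, e))).
  by apply: sym_connect_sym => x y; rewrite /induced /= adj_sym andbCA.
have up (i : 'I_n) d (lt : i + d < n) : v <= i -> i + d < e ->
    connect (induced (@adj I) (seg (v, e))) (s i) (s (Ordinal lt)).
  move=> vi; elim: d lt => [|d IH] lt ie.
    rewrite (_ : Ordinal lt = i) ?connect0 //; apply: val_inj => /=; exact: addn0.
  have lt' : i + d < n by apply: ltn_trans lt; rewrite addnS.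
  have ie' : i + d < e by apply: ltn_trans ie; rewrite addnS.
  apply: connect_trans (IH lt' ie') _; apply: adj_step; rewrite ?mem_seg /= ?addnS //.
    by rewrite ie' andbT (leq_trans vi) // leq_addr.
  by move: ie; rewrite addnS => ->; rewrite andbT (leq_trans vi) // -addnS leq_addr.
have conn (i j : 'I_n) : i <= j -> v <= i -> j < e ->
    connect (induced (@adj I) (seg (v, e))) (s i) (s j).
  move=> ij vi je; have lt : i + (j - i) < n by rewrite subnKC.
  have e_j : Ordinal lt = j by apply: val_inj => /=; rewrite subnKC.
  by rewrite -[in X in connect _ _ X]e_j; apply: up; rewrite // subnKC.
apply/forall_inP => x; have [i <-] := s_onto x; rewrite mem_seg /= => /andP[vi ie].
apply/forall_inP => y; have [j <-] := s_onto y; rewrite mem_seg /= => /andP[vj je].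
by have [ij|ji] := leqP i j; [apply: conn | rewrite sym; apply: conn => //; exact: ltnW].
Qed.

(** If s j were missing from U, no edge inside U could lead from a position below j to one above, so
    the positions below j would be closed under connection. *)
Lemma district_convex (U : {set 'I_n}) (i j l : 'I_n) : district U ->
  i < j < l -> s i \in U -> s l \in U -> s j \in U.
Proof.
case/andP=> _ /forall_inP conn /andP[ij jl] iU lU; apply: contraT => jU.
have /forall_inP/(_ _ lU) c := conn _ iU.
have cl : closed (induced (@adj I) U) [pred x | [exists y : 'I_n, (s y == x) && (y < j)]].
  apply: intro_closed.
    by apply: sym_connect_sym => x y; rewrite /induced /= adj_sym andbCA.
  move=> x y /and3P[xU yU xy] /existsP[x' /andP[/eqP ex xj]]; apply/existsP.
  have [y' ey] := s_onto y; exists y'; rewrite ey eqxx /=.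
  move: xy; rewrite -ex -ey s_adj => /orP[/eqP e|/eqP e]; last by rewrite -e in xj; exact: ltnW.
  rewrite ltn_neqAle -{2}e xj andbT; apply: contraNneq jU => e2.
  by have -> : j = y' by [apply: val_inj]; rewrite ey.
have := closed_connect cl c; rewrite !inE => /esym.
have -> : [exists y, (s y == s i) && (y < j)] by apply/existsP; exists i; rewrite eqxx.
case/existsP=> y /andP[/eqP/s_inj -> lj].
by move: (ltn_trans jl lj); rewrite ltnn.
Qed.

Lemma tiling_cover hi lo ts i : tiling hi lo ts -> lo <= i < hi ->
  exists2 t, t \in ts & t.1 <= i < t.2.
Proof.
elim: ts hi => [|[v e] ts IH] hi /=; first by move/eqP->; lia.
case/and3P=> /eqP -> ve tl /andP[li ih]; have [vi|iv] := leqP v i.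
  by exists (v, hi); rewrite ?inE ?eqxx //= vi.
have [|t tts ti] := IH v tl; first by rewrite li.
by exists t => //; rewrite inE tts orbT.
Qed.

Lemma tiling_bounds hi lo ts t : tiling hi lo ts -> t \in ts -> t.1 < t.2 <= hi.
Proof.
elim: ts hi => [|[v e] ts IH] hi //= /and3P[/eqP -> ve tl].
rewrite inE => /orP[/eqP -> /=|/(IH _ tl) /andP[-> h]]; first by rewrite ve leqnn.
exact: leq_trans h (ltnW ve).
Qed.

Lemma tiling_disjoint hi lo ts t u : tiling hi lo ts -> t \in ts -> u \in ts ->
  t = u \/ t.2 <= u.1 \/ u.2 <= t.1.
Proof.
elim: ts hi => [|[v e] ts IH] hi //= /and3P[_ ve tl].
rewrite !inE => /orP[/eqP->|tts] /orP[/eqP->|uts]; first by left.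
- by right; right => /=; have /andP[] := tiling_bounds tl uts.
- by right; left => /=; have /andP[] := tiling_bounds tl tts.
- exact: IH tl tts uts.
Qed.

Lemma uniq_segs hi ts : hi <= n -> tiling hi 0 ts -> uniq (map seg ts).
Proof.
elim: ts hi => [|[v e] ts IH] hi hn //= /and3P[/eqP -> ve tl].
have vn : v < n by apply: leq_trans hn.
rewrite (IH v) ?andbT //; last exact: ltnW.
apply/mapP => -[t tts et]; have /andP[_ tv] := tiling_bounds tl tts.
have : s (Ordinal vn) \in seg (v, hi) by rewrite mem_seg /= leqnn.
rewrite et mem_seg /= => /andP[_ h].
by move: (leq_trans h tv); rewrite ltnn.
Qed.

Lemma card_segs (D : {set {set 'I_n}}) ts : tiling n 0 ts -> D =i map seg ts ->
  #|D| = size ts /\ forall q, wins eta D q = count (fun t => eta (seg t) == q) ts.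
Proof.
move=> tl eD; have un := uniq_segs (leqnn n) tl; split.
  by rewrite (eq_card eD) (card_uniqP un) size_map.
move=> q; have e : [set U in D | eta U == q] =i [seq U <- map seg ts | eta U == q].
  by move=> U; rewrite mem_filter inE eD andbC.
by rewrite /wins (eq_card e) (card_uniqP (filter_uniq _ un)) size_filter count_map.
Qed.

Lemma segs_partition ts : tiling n 0 ts ->
  partition [set U in map seg ts] [set: 'I_n] /\
  forall U, U \in [set U in map seg ts] -> district U.
Proof.
move=> tl; have dis U : U \in [set U in map seg ts] -> district U.
  rewrite inE => /mapP[[v e] tts ->]; have /andP[] := tiling_bounds tl tts.
  exact: seg_district.
split=> //; apply/and3P; split.
- apply/eqP/setP => x; rewrite inE; have [i <-] := s_onto x.
  have [t tts ti] := tiling_cover tl (ltn_ord i : 0 <= i < n).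
  by apply/bigcupP; exists (seg t); rewrite ?mem_seg // inE map_f.
- apply/trivIsetP => U V; rewrite !inE => /mapP[t tts ->] /mapP[u uts ->] ne.
  rewrite -setI_eq0; apply/eqP/setP => x; have [i <-] := s_onto x.
  rewrite in_setI in_set0 !mem_seg; case: (tiling_disjoint tl tts uts) => [e|h].
    by rewrite e eqxx in ne.
  apply/negbTE/negP => /andP[/andP[a1 a2] /andP[a3 a4]].
  case: h => h; first by have := leq_trans a2 (leq_trans h a3); rewrite ltnn.
  by have := leq_trans a4 (leq_trans h a1); rewrite ltnn.
- by apply/negP => /dis/andP[]; rewrite eqxx.
Qed.

(** Intervals are peeled off from the right: the district of the last position below e is convex,
    hence an interval [v, e), and no other district meets it, so none straddles v. *)
Lemma partition_segs (D : {set {set 'I_n}}) : partition D [set: 'I_n] ->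
  (forall U, U \in D -> district U) ->
  exists2 ts, tiling n 0 ts & D =i map seg ts.
Proof.
move=> /and3P[/eqP cov triv D0] dis.
have inD U V x : U \in D -> V \in D -> x \in U -> x \in V -> U = V.
  by move=> UD VD xU xV; have := def_pblock triv UD xU; rewrite (def_pblock triv VD xV).
(* The hypothesis on e says that no district straddles the cut at e. *)
suff H e : e <= n -> (forall U (i j : 'I_n), U \in D -> s i \in U -> s j \in U -> i < e -> j < e) ->
    exists2 ts, tiling e 0 ts &
      forall U, U \in map seg ts <-> U \in D /\ exists2 i : 'I_n, i < e & s i \in U.
  have [|ts tl eD] := H n (leqnn n); first by move=> *; apply: ltn_ord.
  exists ts => // U; apply/idP/idP => [UD|/eD[]//]; apply/eD; split=> //.
  have [x xU] : exists x, x \in U.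
    by apply/set0Pn; apply: contraNneq D0 => <-.
  by have [i ei] := s_onto x; exists i; rewrite ?ei.
elim/ltn_ind: e => -[|e] IH en cl.
  by exists [::] => // U; split=> // -[_ [i]].
set x := s (Ordinal en); pose U0 := pblock D x.
have xc : x \in cover D by rewrite cov inE.
have U0D : U0 \in D by apply: pblock_mem.
have xU0 : x \in U0 by rewrite mem_pblock.
have ex : exists i, (i < n) && [exists j : 'I_n, (j == i :> nat) && (s j \in U0)].
  by exists e; rewrite en; apply/existsP; exists (Ordinal en); rewrite eqxx.
case: (ex_minnP ex) => v /andP[vn /existsP[v' /andP[/eqP ev vU]]] vmin.
have vle (i : 'I_n) : s i \in U0 -> v <= i.
  by move=> iU; apply: vmin; rewrite ltn_ord; apply/existsP; exists i; rewrite eqxx.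
have segU : seg (v, e.+1) = U0.
  apply/setP => y; have [i <-] := s_onto y; rewrite mem_seg /=; apply/andP/idP.
    move=> [vi ie]; have [e1|ne1] := eqVneq (i : nat) v.
      by have -> : i = v' by [apply: val_inj; rewrite /= ev]; [].
    have [e2|ne2] := eqVneq (i : nat) e.
      by have -> : i = Ordinal en by [apply: val_inj]; [].
    apply: (district_convex (i := v') (l := Ordinal en)) => //; first exact: dis.
    by rewrite ev /= !ltn_neqAle eq_sym ne1 vi ne2 -ltnS.
  by move=> iU; split; [exact: vle | apply: (cl U0 (Ordinal en)) => //=].
have ve : v < e.+1 by rewrite ltnS; apply: (vle (Ordinal en)).
have [||ts tl eD] := IH v ve.
- exact: ltnW.
- move=> U i j UD iU jU iv; rewrite ltnNge; apply/negP => vj.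
  have je : j < e.+1 by apply: (cl U i) => //; apply: ltn_trans ve.
  have jU0 : s j \in U0 by rewrite -segU mem_seg /= vj.
  have eU := inD _ _ _ UD U0D jU jU0; rewrite eU in iU.
  by move: (leq_trans iv (vle i iU)); rewrite ltnn.
exists ((v, e.+1) :: ts); first by rewrite /= eqxx ve.
move=> U; rewrite /= inE; split.
  case/orP=> [/eqP->|/eD[UD [i iv iU]]].
    by rewrite segU; split=> //; exists (Ordinal en).
  by split=> //; exists i => //; apply: ltn_trans ve.
case=> UD [i ie iU]; have [vi|iv] := leqP v i; last first.
  by apply/orP; right; apply/eD; split=> //; exists i.
have iU0 : s i \in U0 by rewrite -segU mem_seg /= vi.
by rewrite (inD _ _ _ UD U0D iU iU0) segU eqxx.
Qed.

End Intervals.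

(** * Masks, input and running time *)

Lemma odd_binary (f : nat -> bool) N v : v < N ->
  odd ((\sum_(i < N) f i * 2 ^ i) %/ 2 ^ v) = f v.
Proof.
elim: N f v => // N IH f v vN.
have e : \sum_(i < N.+1) f i * 2 ^ i = f 0 + 2 * \sum_(i < N) f i.+1 * 2 ^ i.
  rewrite big_ord_recl muln1 big_distrr; congr (_ + _).
  by apply: eq_bigr => i _; rewrite /= expnS mulnCA.
rewrite e; case: v vN => [|v] vN.
  by rewrite divn1 oddD mul2n odd_double addbF; case: (f 0).
rewrite expnS divnMA addnC [2 * _]mulnC divnMDl // [f 0 %/ 2]divn_small ?addn0; last by case: (f 0).
exact: (IH (fun i => f i.+1)).
Qed.

Lemma set_of_maskE n (B : {set 'I_n}) : set_of_mask n (\sum_(x in B) 2 ^ x) = B.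
Proof.
apply/setP => v; rewrite inE.
pose f i := if insub i is Some x then x \in B else false.
have -> : \sum_(x in B) 2 ^ x = \sum_(i < n) f i * 2 ^ i.
  rewrite big_mkcond; apply: eq_bigr => x _; rewrite /f valK.
  by case: (x \in B); rewrite ?mul1n.
by rewrite odd_binary // /f valK.
Qed.

Lemma nth_allpairs (T1 T2 T : Type) (f : T1 -> T2 -> T) s t x0 a0 b0 i j :
  i < size s -> j < size t ->
  nth x0 [seq f x y | x <- s, y <- t] (i * size t + j) = f (nth a0 s i) (nth b0 t j).
Proof.
elim: s i => // x s IH [|i] isz jsz; rewrite /= nth_cat size_map.
  by rewrite jsz (nth_map b0).
rewrite mulSn -addnA ifF; last by apply/negbTE; rewrite -leqNgt leq_addr.
by rewrite addKn IH.
Qed.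

(** A halted machine stays put, so a single number of steps, the cost bound, serves all runs
    whatever the coins. *)
Lemma halted_iter (I : wgm) (eta : chooser I) w P c k :
  halted P c -> iter k (step eta w P) c = c.
Proof. by move=> hc; elim: k => //= k ->; case: c hc => l R M cs hc; rewrite /step hc. Qed.

(** * From the instance in memory to the answer *)

Section Main.

Variables (I : wgm) (eta : chooser I) (w : nat).

Local Notation n := (nvoters I).
Local Notation m := (ncands I).

Definition half : nat := (19 * n) %/ 74.

Definition loop_bound (g : bool) : nat :=
  if g then 8 ^ half + 3 ^ (n - 2 * half) else (n + m + 1) ^ 4.

Definition start : state := St (fun=> 0) (fun a => nth 0 (input I) a).

Hypothesis path : is_path (@adj I).
Hypothesis w_ge : 12 * (n + m + bitlength I) <= w.

Lemma n_gt0 : 0 < n. Proof. by case: path. Qed.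

Lemma m_gt0 : 0 < m. Proof. exact: leq_ltn_trans (ltn_ord (preferred I)). Qed.

Lemma half_lt : 2 * half < n.
Proof. by rewrite /half; have := n_gt0; lia. Qed.

Lemma pow_lt_w e : e <= 12 * (n + m + 1) -> 2 ^ e <= 2 ^ w.
Proof. by move=> le; rewrite leq_exp2l //; move: w_ge; rewrite /bitlength; lia. Qed.

Lemma words_addresses : ((n + 1) ^ 4 + 4) * 2 ^ (n + m + 3) <= 2 ^ w.
Proof.
apply: leq_trans (pow_lt_w (e := 4 * n + 3 + (n + m + 3)) _); last by lia.
rewrite [X in _ <= X]expnD leq_mul2r; apply/orP; right.
have : (n + 1) ^ 4 <= 2 ^ (4 * n).
  by rewrite mulnC expnM leq_exp2r // addn1; apply: ltn_expl.
rewrite expnD; have : 0 < 2 ^ (4 * n) by rewrite expn_gt0.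
by move: ((n + 1) ^ 4) (2 ^ (4 * n)) => x y; lia.
Qed.

Lemma words_sums : 8 ^ half * 3 ^ (n - 2 * half) * 8 <= 2 ^ w.
Proof.
apply: leq_trans (pow_lt_w (e := 3 * half + 2 * (n - 2 * half) + 3) _); last first.
  by have := half_lt; lia.
rewrite [2 ^ (_ + 3)]expnD [2 ^ (3 * half + _)]expnD !expnM leq_mul2r /=.
apply: leq_mul => //; case: (n - _) => // d; by rewrite leq_exp2r.
Qed.

Lemma input_bounded : bounded w (mm start).
Proof.
have all_lt : all (fun x => x < 2 ^ w) (input I).
  have nw : n < 2 ^ w by apply: leq_trans (ltn_expl n (ltnSn 1)) (pow_lt_w _); lia.
  have mw : m < 2 ^ w by apply: leq_trans (ltn_expl m (ltnSn 1)) (pow_lt_w _); lia.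
  have one : 1 < 2 ^ w by apply: (pow_lt_w (e := 1)); lia.
  have small x : x <= maxn (ndistricts I) (\max_v \max_q @weight I v q) -> x < 2 ^ w.
    move=> le; apply: leq_ltn_trans le _; apply: leq_trans (trunc_log_ltn _ (ltnSn 1)) _.
    by rewrite leq_exp2l //; move: w_ge; rewrite /bitlength; lia.
  rewrite /input !all_cat /= nw mw (ltn_trans (ltn_ord _) mw) (small (ndistricts I)) ?leq_maxl //=.
  apply/andP; split; apply/allP => x /allpairsP[[u v] [_ _ ->]] /=.
    exact: leq_ltn_trans (leq_b1 _) one.
  apply: small; apply: leq_trans (leq_maxr _ _).
  by apply: leq_trans (leq_bigmax u); apply: (leq_bigmax (F := fun q => weight u q)).
move=> a /=; have [alt|age] := ltnP a (size (input I)).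
  exact: (allP all_lt) (mem_nth _ alt).
by rewrite nth_default // expn_gt0.
Qed.

Lemma size_input : size (input I) = 4 + n * n + n * m.
Proof. by rewrite /input !size_cat !size_allpairs !size_enum_ord addnA. Qed.

Definition edge (u v : nat) : bool := mm start (4 + u * n + v) == 1.

Lemma start_cell (u v : 'I_n) : mm start (4 + u * n + v) = adj u v.
Proof.
rewrite -addnA; transitivity
  (nth 0 [seq (adj u v : nat) | u <- enum 'I_n, v <- enum 'I_n] (u * n + v)); last first.
  have := @nth_allpairs _ _ _ (fun u v : 'I_n => adj u v : nat) (enum 'I_n) (enum 'I_n) 0 u v u v.
  by rewrite !size_enum_ord => -> //; rewrite !nth_ord_enum.
transitivity (nth 0 ([seq (adj u v : nat) | u <- enum 'I_n, v <- enum 'I_n]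
   ++ [seq weight v q | v <- enum 'I_n, q <- enum 'I_m]) (u * n + v)); first by [].
rewrite nth_cat size_allpairs !size_enum_ord.
have -> : u * n + v < n * n; last by [].
by apply: (@leq_trans (u * n + n)); rewrite ?ltn_add2l // addnC -mulSn leq_mul2r ltn_ord orbT.
Qed.

Lemma edgeE (u v : 'I_n) : edge u v = adj u v.
Proof. by rewrite /edge start_cell; case: adj. Qed.

Lemma start_edge u v : u < n -> v < n -> mm start (4 + u * n + v) = edge u v.
Proof.
by move=> un vn; have := edgeE (Ordinal un) (Ordinal vn) => /= ->;
  have := start_cell (Ordinal un) (Ordinal vn).
Qed.

Lemma start_fresh addr : 2 ^ (n + m + 3) <= addr -> mm start addr = 0.
Proof.
move=> le; rewrite /= nth_default // size_input; apply: leq_trans le.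
apply: (@leq_trans ((n + m) * (n + m) + 4)); first by nia.
by elim: (n + m) => // L IH; rewrite addSn expnS; move: IH; clear; nia.
Qed.

Lemma path_order_start : exists sigma, path_order I edge sigma.
Proof.
have [n0 [s [[g sK gK] s_adj]]] := path; pose i0 := Ordinal n0.
exists (fun i => s (insubd i0 i) : nat).
have iK (i : 'I_n) : insubd i0 i = i by rewrite valKd.
split.
- by move=> i _; apply: ltn_ord.
- move=> i j i_n j_n; rewrite -[i]/(val (Ordinal i_n)) -[j]/(val (Ordinal j_n)) !iK.
  by move/val_inj/(can_inj sK) => ->.
- move=> v vn; exists (val (g (Ordinal vn))); first exact: ltn_ord.
  by rewrite iK gK.
- move=> i j i_n j_n; rewrite -[i]/(val (Ordinal i_n)) -[j]/(val (Ordinal j_n)) !iK.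
  by rewrite edgeE s_adj.
Qed.

Lemma gerrymanderableE sigma (S : nat -> nat) : path_order I edge sigma ->
  (forall i, i <= n -> S i = \sum_(i <= y < n) 2 ^ sigma y) ->
  (exists ts, winning (colour eta S) m (preferred I) n (ndistricts I) ts) <->
  gerrymanderable eta.
Proof.
move=> [lt inj sur adjE] SE.
pose s (i : 'I_n) := Ordinal (lt i (ltn_ord i)).
have s_inj : injective s.
  by move=> i j /(congr1 val) /= e; apply: val_inj; apply: inj e.
have s_adj (i j : 'I_n) : adj (s i) (s j) = (i.+1 == j :> nat) || (j.+1 == i :> nat).
  by rewrite -edgeE adjE.
have colE v e : v < e -> e <= n -> colour eta S v e = eta (seg s (v, e)).
  move=> ve en; rewrite /colour; have vn : v <= n by apply: leq_trans (ltnW ve) en.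
  congr (nat_of_ord (eta _)); rewrite -[RHS]set_of_maskE; congr set_of_mask.
  (* Suffix sums telescope: the difference is the sum of 2 ^ sigma y over the positions y in [v,
     e). *)
  rewrite !SE // (big_cat_nat (ltnW ve) en) /= addnK.
  have -> : \sum_(v <= y < e) 2 ^ sigma y = \sum_(i < n | v <= i < e) 2 ^ s i.
    rewrite (big_nat_widen _ _ _ _ _ en) (big_nat_widenl _ 0) // big_mkord.
    by apply: eq_bigl => i; rewrite andbC.
  have [g sK gK] := injF_bij s_inj.
  rewrite [RHS](reindex s) /=; last by exists g => x _.
  by apply: eq_bigl => i; rewrite (mem_seg s_inj).
have cntE ts q : tiling n 0 ts ->
    cnt (colour eta S) q ts = count (fun t => eta (seg s t) == q :> nat) ts.
  move=> tl; apply: eq_in_count => -[v e] /(tiling_bounds tl) /andP[ve en] /=.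
  by rewrite colE.
split.
  move=> [ts [tl sz win]]; have [par dis] := segs_partition s_inj s_adj tl.
  exists [set U in map (seg s) ts].
  have eD : [set U in map (seg s) ts] =i map (seg s) ts by move=> U; rewrite inE.
  have [cD wD] := card_segs eta s_inj tl eD.
  split=> //; first by rewrite cD.
  by move=> q qp; rewrite !wD -!(cntE _ _ tl); apply: win => //; apply: ltn_ord.
move=> [D [par cD dis win]].
have [ts tl eD] := partition_segs s_inj s_adj par dis.
have [cD' wD] := card_segs eta s_inj tl eD.
exists ts; split=> //; first by rewrite -cD'.
move=> q qm qp; rewrite !cntE //.
by have := win (Ordinal qm); rewrite !wD; apply.
Qed.

Lemma gerry_ok :
  wp eta w loop_bound gerry (fun s' => rg s' res != 0 <-> gerrymanderable eta) start.
Proof.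
have bn := half_lt; have aw := words_addresses; have sw := words_sums.
have pm := ltn_ord (preferred I).
have bp : (n + m + 1) ^ 4 <= loop_bound false by [].
have be : 8 ^ half + 3 ^ (n - 2 * half) <= loop_bound true by [].
have [sigma ord] := path_order_start.
apply: wp_seq; apply: (wp_use (setup_ok eta bn pm aw sw bp be (k := ndistricts I) (s := start) _ _ _ _ _)) => //.
move=> s1 K1 [[en em ek ep] eU eb eh [eL eR]].
have m1 : mm s1 = mm start by kp.
apply: wp_seq; apply: (wp_use (order_path_ok eta bn pm aw sw bp be ord en eU _ _)).
- by move=> u v un vn; rewrite m1 start_edge.
- by move=> addr ha; rewrite m1 start_fresh.
move=> s2 K2 [tau [tau_ord hS fresh]].
pose S i := \sum_(i <= y < n) 2 ^ tau y.
have C2 : context I half (ndistricts I) (preferred I) S s2.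
  by split; kp.
apply: wp_conseq (search_ok eta bn pm aw sw bp be C2 _ fresh); last by kp.
by move=> s' ->; apply: (gerrymanderableE tau_ord).
Qed.

End Main.

Lemma run_gerry (I : wgm) (eta : chooser I) w t r :
  is_path (@adj I) -> 12 * (nvoters I + ncands I + bitlength I) <= w ->
  cost (loop_bound I) gerry <= t ->
  halts eta w (compile 0 gerry) t r /\
  (accepts eta w (compile 0 gerry) t r <-> gerrymanderable eta).
Proof.
move=> path w_ge tge.
move eP : (compile 0 gerry) => P.
have w7 : 128 <= 2 ^ w.
  by apply: (pow_lt_w w_ge (e := 7)); have := n_gt0 path; lia.
have mw : ncands I <= 2 ^ w.
  apply: leq_trans (ltnW (ltn_expl _ (ltnSn 1))) (pow_lt_w w_ge _); lia.
have {}eP : P = [::] ++ compile (size (Nil instr)) gerry ++ [::] by rewrite cats0 eP.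
have zb : bounded w (fun=> 0) by move=> x; rewrite expn_gt0.
have [t0 [R [s [[t0le Q] run0 ag _ _]]]] :=
  compile_correct w7 mw r eP gerry_wf (gerry_ok eta path w_ge)
    (fun _ _ => erefl) zb zb (input_bounded w_ge).
have hP : halted P (Config (size (Nil instr) + clen gerry) R (mm s) r).
  by rewrite /halted eP cats0 size_compile.
have runE : run eta w P t r = Config (size (Nil instr) + clen gerry) R (mm s) r.
  rewrite /run -(subnK (leq_trans t0le tge)) iterD.
  have -> : initial I r = Config (size (Nil instr)) (fun=> 0) (mm (start I)) r by [].
  by rewrite run0 halted_iter.
have hlt : halts eta w P t r by rewrite /halts runE.
have accE : accepts eta w P t r = (R 0 != 0) by rewrite /accepts hlt runE.
by rewrite accE (ag 0 isT).
Qed.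

(** * Numerical estimates and the two time bounds *)

Local Open Scope ring_scope.

Definition rate : rat := 1708%:R / 1000%:R.

Lemma rate_gt0 : 0 < rate. Proof. by rewrite /rate divr_gt0 // ltr0n. Qed.

Lemma le_ratio_pow a x y e : (0 < y)%N -> (a * y ^ e <= x ^ e)%N ->
  a%:R <= (x%:R / y%:R : rat) ^+ e.
Proof.
by move=> y0 le; rewrite expr_div_n ler_pdivlMr ?exprn_gt0 ?ltr0n // -!natrX -natrM ler_nat.
Qed.

(** Fractional exponents are avoided by comparing e-th powers: B ^ k <= r ^ e stands for B ^ (k / e)
    <= r, and the factor B ^ j pays for rounding. *)
Lemma pow_le_root (r : rat) B e k i j n : 0 < r -> (0 < B)%N -> (0 < e)%N ->
  (B ^ k)%:R <= r ^+ e -> (i * e <= k * n + j * e)%N ->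
  (B ^ i)%:R <= (B ^ j)%:R * r ^+ n.
Proof.
move=> r0 B0 e0 Bk ie.
rewrite -(@ler_pXn2r _ e) // ?nnegrE ?mulr_ge0 ?ler0n ?exprn_ge0 ?(ltW r0) //.
rewrite exprMn -exprM mulnC exprM -!natrX.
apply: le_trans (_ : (B ^ (k * n + j * e))%N%:R <= _).
  by rewrite -expnM ler_nat leq_pexp2l.
rewrite expnD natrM mulrC !expnM ler_wpM2l ?ler0n // natrX.
by apply: lerXn2r; rewrite ?nnegrE ?ler0n ?exprn_ge0 ?(ltW r0).
Qed.

Lemma exponential_bound (I : wgm) :
  (loop_bound I true)%:R <= 10%:R * rate ^+ nvoters I.
Proof.
have r0 := rate_gt0.
have r8 : (8 ^ 19)%:R <= rate ^+ 74 by apply: le_ratio_pow; lia.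
have r3 : (3 ^ 36)%:R <= rate ^+ 74 by apply: le_ratio_pow; lia.
rewrite /loop_bound /half; move: (nvoters I) rate r0 r8 r3 => n r r0 r8 r3.
(* The 10 is 1 + 9: rounding [half] down can only shrink 8 ^ half, but it lengthens the right half
   by less than 2, at a cost of at most 3 ^ 2. *)
rewrite natrD (natrD _ 1 9) mulrDl; apply: lerD.
  by apply: (pow_le_root (j := 0) r0 _ _ r8); lia.
by apply: (pow_le_root (j := 2) r0 _ _ r3); lia.
Qed.

(** With L = n + m at least 2, constants turn into powers of L: c <= L ^ c for the program size c,
    (L + 1) ^ 4 <= L ^ 8 for each polynomial loop, and 10 <= L ^ 16. The same number scales the word
    length, for which 12 is enough. *)
Definition degree_bound : nat := (csize gerry + 8 * depth false gerry + 16)%N.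

Lemma cost_bound (I : wgm) : is_path (@adj I) ->
  (cost (loop_bound I) gerry)%:R
    <= rate ^+ nvoters I * (nvoters I + ncands I)%N%:R ^+ degree_bound.
Proof.
move=> path; set L := (nvoters I + ncands I)%N.
have L2 : (1 < L)%N by have := n_gt0 path; have := m_gt0 I; rewrite /L; lia.
have bgt0 g : (0 < loop_bound I g)%N.
  by case: g; rewrite /loop_bound ?addn_gt0 ?expn_gt0 // addn1.
have := cost_le gerry bgt0; rewrite gerry_depth expn1 /degree_bound.
move: (csize gerry) (depth false gerry) (cost _ _) => c d T le.
have polyL : (c * loop_bound I false ^ d <= L ^ (c + 8 * d))%N.
  rewrite expnD; apply: leq_mul.
    by apply: leq_trans (ltnW (ltn_expl c (ltnSn 1))) _; case: (c) => // c'; rewrite leq_exp2r.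
  rewrite expnM; case: (d) => // d'; rewrite leq_exp2r //= -/L.
  rewrite -[8%N]/(2 * 4)%N expnM leq_exp2r //; nia.
have := exponential_bound I; move: rate rate_gt0 => r r0 Xle.
apply: le_trans (_ : (L ^ (c + 8 * d) * loop_bound I true)%N%:R <= _).
  by rewrite ler_nat; apply: leq_trans le _; rewrite leq_mul2r polyL orbT.
rewrite natrM mulrC; apply: le_trans (ler_wpM2r (ler0n _ _) Xle) _.
rewrite mulrAC mulrC ler_wpM2l ?exprn_ge0 ?(ltW r0) // -natrM -natrX ler_nat.
rewrite [(L ^ (_ + 16))%N]expnD mulnC leq_mul2l; apply/orP; right.
apply: (@leq_trans (L ^ 4)); last by rewrite leq_exp2l.
by apply: (@leq_trans (2 ^ 4)); rewrite ?leq_exp2r.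
Qed.

Lemma ler_ratio x y z : (x <= y)%N -> x%:R / z%:R <= y%:R / z%:R :> rat.
Proof. by move=> le; apply: ler_wpM2r; rewrite ?invr_ge0 ?ler0n ?ler_nat. Qed.

Lemma ler_wpXM (x y z : rat) n : 0 < x -> x <= y -> 0 <= z -> x ^+ n * z <= y ^+ n * z.
Proof.
move=> x0 xy z0; apply: ler_wpM2r => //; apply: lerXn2r => //; rewrite nnegrE ltW //.
exact: lt_le_trans xy.
Qed.

Lemma rate_le : rate <= 1894%:R / 1000%:R.
Proof. apply: ler_ratio; lia. Qed.

Lemma accept_prob_const (I : wgm) (eta : chooser I) w P t (b : bool) :
  (forall r, accepts eta w P t r = b) -> accept_prob eta w P t = b%:R.
Proof.
move=> h; rewrite /accept_prob (eq_card (B := fun=> b)); last first.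
  by move=> r; rewrite inE h.
case: b {h}; last by rewrite (eq_card0 (A := fun=> false)) ?mul0r.
rewrite (eq_card (B := predT)) // card_tuple card_bool natrX divff //.
by rewrite expf_neq0 // pnatr_eq0.
Qed.

(** The verdict is the same for all coin sequences, so the probability is 0 or 1. *)
Lemma accept_prob_spec (I : wgm) (eta : chooser I) w P t (A : Prop) :
  (forall r, accepts eta w P t r <-> A) ->
  (A -> 2%:R / 3%:R <= accept_prob eta w P t) /\ (~ A -> accept_prob eta w P t = 0).
Proof.
move=> h; split=> hA.
  rewrite (accept_prob_const (b := true)); last by move=> r; apply/h.
  by rewrite ler_pdivrMr ?ltr0n // mul1r ler_nat.
by rewrite (accept_prob_const (b := false)) // => r; apply/negP => /h.
Qed.

Theorem theorem5 :
  (exists (P : program) (c : nat),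
     forall (I : wgm) (eta : chooser I),
       is_path (@adj I) -> tie_breaking eta ->
       exists t : nat,
         [/\ t%:R <= (1708%:R / 1000%:R) ^+ nvoters I
                     * (nvoters I + ncands I)%N%:R ^+ c :> rat,
             forall r : t.-tuple bool, halts eta (wordlength c I) P t r,
             gerrymanderable eta ->
               2%:R / 3%:R <= accept_prob eta (wordlength c I) P t
           & ~ gerrymanderable eta ->
               accept_prob eta (wordlength c I) P t = 0])
  /\
  (exists (P : program) (c : nat),
     deterministic P /\
     forall (I : wgm) (eta : chooser I),
       is_path (@adj I) -> tie_breaking eta ->
       exists t : nat,
         [/\ t%:R <= (1894%:R / 1000%:R) ^+ nvoters I
                     * (nvoters I + ncands I)%N%:R ^+ c :> rat,
             halts eta (wordlength c I) P t [::]
           & accepts eta (wordlength c I) P t [::] <-> gerrymanderable eta]).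
Proof.
have wl I : (12 * (nvoters I + ncands I + bitlength I) <= wordlength degree_bound I)%N.
  by rewrite /wordlength /degree_bound leq_mul2r; apply/orP; right; lia.
have run (I : wgm) (eta : chooser I) : is_path (@adj I) -> exists t : nat,
    t%:R <= rate ^+ nvoters I * (nvoters I + ncands I)%N%:R ^+ degree_bound /\
    forall r, halts eta (wordlength degree_bound I) (compile 0 gerry) t r /\
     (accepts eta (wordlength degree_bound I) (compile 0 gerry) t r <-> gerrymanderable eta).
  move=> path; exists (cost (loop_bound I) gerry); split; first exact: cost_bound.
  by move=> r; apply: run_gerry path (wl I) (leqnn _).
have det : deterministic (compile 0 gerry) by [].
(* From here on only the established properties of the program matter; abstracting it keeps
   unification from unfolding it. *)
move: degree_bound (compile 0 gerry) det run {wl} => c P det run.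
have r0 := rate_gt0; have r1 := rate_le.
split; exists P, c.
  move=> I eta path _; have [t [tle ok]] := run I eta path.
  have [p1 p2] := accept_prob_spec (fun r => (ok r).2).
  exists t; split; [exact: tle | exact: (fun r => (ok r).1) | exact: p1 | exact: p2].
split; [exact: det | move=> I eta path _]; have [t [tle ok]] := run I eta path.
exists t; have [hlt acc] := ok [::]; split; [|exact: hlt|exact: acc].
apply: (le_trans tle); apply: (ler_wpXM _ r0 r1); apply: exprn_ge0; exact: ler0n.
Qed.
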